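(* Let $q$ be an odd prime power, let $S\subseteq\mathbb P^1$ be a finite set of $\mathbb F_q$-rational places containing $B=\{0,\infty\}$, and let $S_0=S\setminus B$. Let $X_S=\Gamma_S\backslash\mathbf T_{S_0}$ and let $\mathcal D(X_S)$ be its double. If $\#S_0\geq2$, then the group $\pi_1(\mathcal D(X_S))$ is not residually finite.
   Context: Quaternionic lattice. Let $K=\mathbb F_q(t)$, $q$ odd, fix a non-square $c\in\mathbb F_q$ and let $D=K\{Z,F\}/(Z^2=c,\ F^2=t,\ FZ=-ZF)$, a quaternion algebra ramified exactly at $B=\{0,\infty\}$. The subring $\mathbb F_q[Z]=\mathbb F_q\oplus\mathbb F_qZ$ is a field with $q^2$ elements with norm $N$ to $\mathbb F_q$. For $S\supseteq B$ let $\mathfrak o_{K,S}$ be the ring of $S$-integers, $\mathcal A(\mathfrak o_{K,S})=\mathfrak o_{K,S}\oplus\mathfrak o_{K,S}Z\oplus\mathfrak o_{K,S}F\oplus\mathfrak o_{K,S}FZ$ and $\Lambda_S=\mathcal A(\mathfrak o_{K,S})^\times/\mathfrak o_{K,S}^\times$; $[w]$ is the class of $w$. For $\tau\in\mathbb F_q^\times$ (the place $t=\tau$) put $PA_\tau=\{[1+\alpha F]:\alpha\in\mathbb F_q[Z],\ N(\alpha)=\tau^{-1}\}$, and let $\Gamma_S\subseteq\Lambda_S$ be the subgroup generated by all $PA_\tau$, $\tau\in S_0$. For $v\in S_0$ let $\mathcal T_v$ be the Bruhat–Tits tree of $(D\otimes_KK_v)^\times/K_v^\times\simeq\mathrm{PGL}_2(K_v)$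 with distinguished vertex $\star_v$, the one fixed by the image of $\mathcal A(\mathfrak o_v)^\times$ ($\mathfrak o_v\subset K_v$ the valuation ring, $\mathcal A(\mathfrak o_v)=\mathfrak o_v\oplus\mathfrak o_vZ\oplus\mathfrak o_vF\oplus\mathfrak o_vFZ$). $\Gamma_S$ acts on $\mathbf T_{S_0}=\prod_{v\in S_0}\mathcal T_v$ preserving factors; it acts simply transitively on vertices and no non-trivial element stabilises a cell. Cubical sets. The category $\mathsf{Cube}$ has objects $[n]$, $n\ge0$; morphisms $[n]\to[m]$ are maps $f:\{\pm1\}^n\to\{\pm1\}^m$ for which there are an injection $\sigma:\{1,\dots,n\}\to\{1,\dots,m\}$ and signs $\varepsilon_1,\dots,\varepsilon_m$ with $f(a)_{j}=\varepsilon_ja_{\sigma^{-1}(j)}$ for $j\in\operatorname{im}\sigma$ and $f(a)_j=\varepsilon_j$ otherwise. A cubical set is a contravariant functor $X$ from $\mathsf{Cube}$ to sets, $X_n=X([n])$. Its realization is $|X|=\coprod_nX_n\times[-1,1]^n/\!\sim$, with $(f^*x,t)\sim(x,f_I(t))$, where $f_I:[-1,1]^n\to[-1,1]^m$ is given by the same formula as $f$; $\pi_1(X):=\pi_1(|X|)$. $\square^n=\mathrm{Hom}(-,[n])$ has realization $[-1,1]^n$. Fibre products $X\boxtimes_SY$ and quotients by groups are formed degreewise. A cell complex made of cubes (a product of trees, or a quotient of one by a group acting freely on cells and preserving factors) is viewed as the cubical set whose set of $n$-cubes consists of all parametrized $n$-cubes $[-1,1]^n\to X$, for all choices of orientation and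 ordering of the coordinates. Double. Let $d=\#S_0$. Each $\mathcal T_v$ has a unique map to $\square^1$ sending $\star_v$ to the vertex $1\in\{\pm1\}=(\square^1)_0$; taking products gives a map $\mathbf T_{S_0}\to(\square^1)^d=\square^d$. Let $\Gamma_{S,0}\subseteq\Gamma_S$ be the kernel of the induced type homomorphism $\Gamma_S\to\mathrm{Aut}(\square^1)^d=\{\pm1\}^d$ (which records in each factor whether the element preserves or exchanges the two bipartition classes of vertices), and $Y_S=\Gamma_{S,0}\backslash\mathbf T_{S_0}\to\square^d$. The double of $X_S$ is $\mathcal D(X_S)=(\Gamma_S/\Gamma_{S,0})\backslash(Y_S\boxtimes_{\square^d}Y_S)$ with $\Gamma_S/\Gamma_{S,0}$ acting diagonally. *)

(* Defs.v *)
From HB Require Import structures.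
From Stdlib Require Import Relation_Operators.
From mathcomp Require Import all_boot all_order all_algebra fingroup.
From mathcomp Require Import generic_quotient fraction.
From mathcomp Require Import all_classical reals topology normedtype homotopy.
From mathcomp Require Import ring lra.
Set Implicit Arguments.
Unset Strict Implicit.
Unset Printing Implicit Defensive.
Import Order.TTheory GRing.Theory Num.Theory.
Import numFieldNormedType.Exports.
Local Open Scope classical_set_scope.
Local Open Scope ring_scope.
Local Open Scope quotient_scope.

Section GeneratedQuotient.
Context (T : choiceType) (r : T -> T -> Prop).

Definition gen_equiv (x y : T) : bool := `[< clos_refl_sym_trans T r x y >].

Lemma gen_equiv_class : equiv_class_of gen_equiv.
Proof.
split=> [x|x y|y x z].
- by apply/asboolP; exact: rst_refl.
- by apply/asboolP/asboolP; exact: rst_sym.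
- move=> /asboolP xy /asboolP yz; apply/asboolP; exact: rst_trans xy yz.
Qed.

Canonical gen_equivalence := EquivRelPack gen_equiv_class.

Definition gen_quot := {eq_quot gen_equivalence}.
HB.instance Definition _ := Quotient.on gen_quot.
HB.instance Definition _ := Choice.on gen_quot.

Lemma gen_quotP (x y : T) :
  \pi_gen_quot x = \pi_gen_quot y <-> clos_refl_sym_trans T r x y.
Proof.
split=> [xy|xy]; last by apply/eqmodP/asboolP.
by apply/asboolP; move/eqmodP: xy.
Qed.

Lemma gen_quot_rel (x y : T) : r x y -> \pi_gen_quot x = \pi_gen_quot y.
Proof. by move=> rxy; apply/gen_quotP; exact: rst_step. Qed.

Lemma gen_quot_ind (U : Type) (f : T -> U) :
  (forall x y, r x y -> f x = f y) ->
  forall x y, \pi_gen_quot x = \pi_gen_quot y -> f x = f y.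
Proof.
move=> fr x y /gen_quotP; elim=> {x y} [x y /fr//|//|x y _ ->//|x y z _ -> _ //].
Qed.

End GeneratedQuotient.

(* A sign (-1)^b is encoded by the boolean b, so that the product of signs is
   (+) and the sign 1 is false. *)
Definition signs (n : nat) := {ffun 'I_n -> bool}.

Section SignedInclusion.
Context (n m : nat) (s : {ffun 'I_n -> 'I_m}) (e : signs m).

Definition signed_incl (a : signs n) : signs m :=
  [ffun j => if [pick k | s k == j] is Some k then e j (+) a k else e j].

Definition signed_incl_real (R : realType) (t : 'rV[R]_n) : 'rV[R]_m :=
  \row_j if [pick k | s k == j] is Some k then (-1) ^+ e j * t ord0 k
         else (-1) ^+ e j.

Lemma signed_incl_im (a : signs n) (k : 'I_n) :
  injective s -> signed_incl a (s k) = e (s k) (+) a k.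
Proof.
move=> sI; rewrite ffunE; case: pickP => [k' /eqP/sI -> //|/(_ k)].
by rewrite eqxx.
Qed.

Lemma signed_incl_out (a : signs n) (j : 'I_m) :
  (forall k, s k != j) -> signed_incl a j = e j.
Proof.
by move=> sj; rewrite ffunE; case: pickP => // k; rewrite (negPf (sj k)).
Qed.

End SignedInclusion.

Definition is_cube_map (n m : nat) (f : {ffun signs n -> signs m}) : bool :=
  [exists s : {ffun 'I_n -> 'I_m}, exists e : signs m,
    injectiveb s && [forall a, f a == signed_incl s e a]].

Lemma is_cube_mapP (n m : nat) (f : {ffun signs n -> signs m}) :
  reflect (exists (s : {ffun 'I_n -> 'I_m}) (e : signs m),
             injective s /\ forall a, f a = signed_incl s e a)
          (is_cube_map f).
Proof.
apply: (iffP existsP) => [[s /existsP[e /andP[/injectiveP sI /forallP fE]]]|].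
  by exists s, e; split=> // a; apply/eqP.
move=> [s [e [sI fE]]]; exists s; apply/existsP; exists e.
apply/andP; split; first exact/injectiveP.
by apply/forallP => a; apply/eqP.
Qed.

(* Morphisms [n] -> [m] of Cube. *)
Definition cube_hom (n m : nat) := {f : {ffun signs n -> signs m} | is_cube_map f}.

Definition CubeHom (n m : nat) (f : {ffun signs n -> signs m})
    (fP : is_cube_map f) : cube_hom n m :=
  exist (fun f : {ffun signs n -> signs m} => is_cube_map f) f fP.

Lemma cube_hom_eq (n m : nat) (f g : cube_hom n m) :
  (forall a, val f a = val g a) -> f = g.
Proof. by move=> fg; apply/val_inj/ffunP. Qed.

Lemma cube_id_subproof (n : nat) : is_cube_map [ffun a : signs n => a].
Proof.
apply/is_cube_mapP; exists [ffun k => k], [ffun=> false].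
have sI : injective [ffun k : 'I_n => k] by move=> x y; rewrite !ffunE.
split=> // a; apply/ffunP => k; rewrite ffunE.
by rewrite -[k in RHS](ffunE (fun k : 'I_n => k)) signed_incl_im // !ffunE.
Qed.

Definition cube_id (n : nat) : cube_hom n n := CubeHom (cube_id_subproof n).

Lemma cube_comp_subproof (n m l : nat) (g : cube_hom m l) (f : cube_hom n m) :
  is_cube_map [ffun a => val g (val f a)].
Proof.
case: f => f /= /is_cube_mapP[s [e [sI fE]]].
case: g => g /= /is_cube_mapP[s' [e' [s'I gE]]].
apply/is_cube_mapP.
exists [ffun k => s' (s k)], (signed_incl s' e' e).
have ssI : injective [ffun k => s' (s k)].
  by move=> x y; rewrite !ffunE => /s'I/sI.
split=> // a; rewrite ffunE fE gE; apply/ffunP => j.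
case: (pickP (fun k => s' k == j)) => [k /eqP <-|sj]; last first.
  rewrite !signed_incl_out // => k; rewrite ?ffunE ?sj //.
rewrite signed_incl_im //.
case: (pickP (fun i => s i == k)) => [i /eqP <-|si].
  rewrite signed_incl_im //.
  have -> : s' (s i) = [ffun k => s' (s k)] i by rewrite ffunE.
  by rewrite signed_incl_im // ffunE signed_incl_im // addbA.
rewrite signed_incl_out; last by move=> i; rewrite si.
rewrite [RHS]signed_incl_out; first by rewrite signed_incl_im.
by move=> i; rewrite ffunE (inj_eq s'I) si.
Qed.

Definition cube_comp (n m l : nat) (g : cube_hom m l) (f : cube_hom n m) :
  cube_hom n l := CubeHom (cube_comp_subproof g f).

Record cubical_set := CubicalSet {
  cell :> nat -> choiceType;
  face : forall n m, cube_hom n m -> cell m -> cell n;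
  face_id : forall n (x : cell n), face (cube_id n) x = x;
  face_comp : forall n m l (g : cube_hom m l) (f : cube_hom n m) (x : cell l),
    face (cube_comp g f) x = face f (face g x) }.

Record cubical_map (X Y : cubical_set) := CubicalMap {
  cmap_fun :> forall n, X n -> Y n;
  cmap_face : forall n m (f : cube_hom n m) (x : X m),
    cmap_fun (face f x) = face f (cmap_fun x) }.

(* The representable cubical set Hom(-, [d]). *)
Program Definition cube_rep (d : nat) : cubical_set :=
  @CubicalSet (fun n => cube_hom n d) (fun n m f x => cube_comp x f) _ _.
Next Obligation.
by move=> d n x; apply: cube_hom_eq => a; rewrite /= !ffunE.
Qed.
Next Obligation.
by move=> d n m l g f x; apply: cube_hom_eq => a; rewrite /= !ffunE.
Qed.

Section FibreProduct.
Context (X Y Z : cubical_set) (p : cubical_map X Z) (q : cubical_map Y Z).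

Definition fprod_cell (n : nat) := {xy : X n * Y n | p n xy.1 == q n xy.2}.

Lemma fprod_face_subproof (n m : nat) (f : cube_hom n m) (z : fprod_cell m) :
  p n (face f (val z).1) == q n (face f (val z).2).
Proof. by case: z => z /= /eqP zE; rewrite !cmap_face zE. Qed.

Program Definition fprod : cubical_set :=
  @CubicalSet fprod_cell
    (fun n m f z => exist _ (face f (val z).1, face f (val z).2)
                          (fprod_face_subproof f z)) _ _.
Next Obligation. by move=> n [[x y] xy]; apply: val_inj; rewrite /= !face_id. Qed.
Next Obligation.
by move=> n m l g f [[x y] xy]; apply: val_inj; rewrite /= !face_comp.
Qed.

End FibreProduct.

Section CubicalQuotient.
Context (X : cubical_set) (r : forall n, X n -> X n -> Prop).
Hypothesis r_face : forall n m (f : cube_hom n m) (x y : X m),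
  r x y -> r (face f x) (face f y).

Definition cquot_face (n m : nat) (f : cube_hom n m) (x : gen_quot (@r m)) :
  gen_quot (@r n) :=
  \pi_(gen_quot (@r n)) (face f (repr x)).

Lemma cquot_face_pi (n m : nat) (f : cube_hom n m) (x : X m) :
  cquot_face f (\pi_(gen_quot (@r m)) x) = \pi_(gen_quot (@r n)) (face f x).
Proof.
apply: (gen_quot_ind (r := @r m) (f := fun x => \pi_(gen_quot (@r n)) (face f x))).
  by move=> y z yz /=; apply: gen_quot_rel; exact: r_face.
exact: reprK.
Qed.

Lemma cquot_face_id (n : nat) (x : gen_quot (@r n)) :
  cquot_face (cube_id n) x = x.
Proof. by rewrite -[x]reprK cquot_face_pi face_id. Qed.

Lemma cquot_face_comp (n m l : nat) (g : cube_hom m l) (f : cube_hom n m)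
    (x : gen_quot (@r l)) :
  cquot_face (cube_comp g f) x = cquot_face f (cquot_face g x).
Proof.
rewrite -[x]reprK (cquot_face_pi (cube_comp g f)) (cquot_face_pi g).
by rewrite (cquot_face_pi f) face_comp.
Qed.

Definition cquot : cubical_set := CubicalSet cquot_face_id cquot_face_comp.

Section Lift.
Context (Z : cubical_set) (p : cubical_map X Z).
Hypothesis p_r : forall n (x y : X n), r x y -> p n x = p n y.

Lemma cquot_lift_pi (n : nat) (x : X n) :
  p n (repr (\pi_(gen_quot (@r n)) x)) = p n x.
Proof. by apply: (gen_quot_ind (@p_r n)); rewrite reprK. Qed.

Lemma cquot_lift_face (n m : nat) (f : cube_hom n m) (x : gen_quot (@r m)) :
  p n (repr (cquot_face f x)) = face f (p m (repr x)).
Proof.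
by rewrite -[x]reprK cquot_face_pi (cquot_lift_pi (face f _)) cmap_face reprK.
Qed.

Definition cquot_lift : cubical_map cquot Z :=
  @CubicalMap cquot Z (fun n (x : gen_quot (@r n)) => p n (repr x))
    cquot_lift_face.

End Lift.
End CubicalQuotient.

Section Realization.
Context (R : realType) (X : cubical_set).

Definition box (n : nat) : set 'rV[R]_n :=
  [set t | forall i, -1 <= t ord0 i <= 1].
Arguments box : clear implicits.

Definition box_space (n : nat) : topologicalType := set_type (box n).

(* The coproduct of the X_n x [-1,1]^n, with X_n discrete. *)
Definition cells_space : topologicalType :=
  {c : {n & X n} & box_space (tag c)}.

Definition cell_point (n : nat) (x : X n) (t : box_space n) : cells_space :=
  existT (fun c : {n & X n} => box_space (tag c)) (existT _ n x) t.

(* (f^* x, t) is glued to (x, f_I(t)). *)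
Definition glue (p q : cells_space) : Prop :=
  exists (n m : nat) (f : cube_hom n m) (s : {ffun 'I_n -> 'I_m}) (e : signs m)
    (x : X m) (t : box_space n) (u : box_space m),
  [/\ injective s, forall a, val f a = signed_incl s e a,
      val u = signed_incl_real s e (val t),
      p = cell_point (face f x) t & q = cell_point x u].

Definition realization : topologicalType := quotient_topology (gen_quot glue).

End Realization.

Record graph := Graph {
  vertex :> choiceType;
  adj : vertex -> vertex -> Prop;
  adj_sym : forall x y, adj x y -> adj y x }.

Section GraphProduct.
Context (d : nat) (T : 'I_d -> graph).

(* A parametrized n-cube of the product of the trees T_i is recorded by its
   vertices: it sends each of n distinct coordinates onto an edge of one of the
   factors, in one of its two orientations, and is constant in the others. *)
Definition is_param_cube (n : nat) (f : signs n -> forall i, T i) : Prop :=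
  exists s : 'I_n -> 'I_d,
  [/\ injective s,
      forall k, exists x y : T (s k),
        adj x y /\ forall a, f a (s k) = if a k then y else x
    & forall i, (forall k, s k <> i) -> exists x, forall a, f a i = x].

Definition param_cube (n : nat) : choiceType :=
  {classic {f : signs n -> forall i, T i | is_param_cube f}}.

Lemma param_cube_eq (n : nat) (f g : param_cube n) :
  (forall a i, sval f a i = sval g a i) -> f = g.
Proof.
case: f g => f Hf [g Hg] /= fg.
have {}fg : f = g by apply/funext => a; apply: functional_extensionality_dep.
by rewrite fg in Hf *; congr exist; exact: Prop_irrelevance.
Qed.

Lemma param_cube_face_subproof (n m : nat) (f : cube_hom n m)
    (x : param_cube m) : is_param_cube (fun a => sval x (val f a)).
Proof.
case: f => f /= /is_cube_mapP[s [e [sI fE]]].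
case: x => x /= [s' [s'I xe xc]].
exists (fun k => s' (s k)); split.
- by move=> k l /s'I/sI.
- move=> k; have [y [z [yz xE]]] := xe (s k).
  exists (if e (s k) then z else y), (if e (s k) then y else z); split.
    by case: (e (s k)) => //; exact: adj_sym.
  move=> a; rewrite xE fE signed_incl_im //.
  by case: (e _); case: (a k).
- move=> i si; have [[j ji]|ni] := pselect (exists j, s' j = i); last first.
    have [y yE] : exists y, forall a, x a i = y.
      by apply: xc => k ki; apply: ni; exists k.
    by exists y.
  have sj k : s k != j.
    by apply/eqP => skj; apply: (si k); rewrite skj.
  case: i / ji si => _.
  have [y [z [_ xE]]] := xe j.
  exists (if e j then z else y) => a.
  by rewrite xE fE signed_incl_out.
Qed.

Program Definition graph_product : cubical_set :=
  @CubicalSet param_cube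
    (fun n m f x => exist _ _ (param_cube_face_subproof f x)) _ _.
Next Obligation. by move=> n x; apply: param_cube_eq => a i /=; rewrite ffunE. Qed.
Next Obligation.
by move=> n m l g f x; apply: param_cube_eq => a i /=; rewrite ffunE.
Qed.

(* A map from a graph to the edge with vertices 1 and -1. *)
Definition edge_map (G : graph) (p : G -> bool) : Prop :=
  forall x y, adj x y -> p y = ~~ p x.

Context (p : forall i, T i -> bool) (p_edge : forall i, edge_map (@p i)).

Lemma product_map_subproof (n : nat) (x : param_cube n) :
  is_cube_map [ffun a => [ffun i => p (sval x a i)]].
Proof.
case: x => x /= [s [sI xe xc]].
apply/is_cube_mapP; exists [ffun k => s k], [ffun i => p (x [ffun=> false] i)].
have fsI : injective [ffun k => s k] by move=> k l; rewrite !ffunE => /sI.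
split=> // a; rewrite ffunE; apply/ffunP => i; rewrite ffunE.
have [[k ki]|ni] := pselect (exists k, s k = i); last first.
  rewrite signed_incl_out; last first.
    by move=> k; rewrite ffunE; apply/eqP => ki; apply: ni; exists k.
  have [y yE] : exists y, forall a, x a i = y.
    by apply: xc => k ki; apply: ni; exists k.
  by rewrite ffunE !yE.
case: i / ki; have -> : s k = [ffun k => s k] k by rewrite ffunE.
rewrite signed_incl_im // !ffunE.
have [y [z [yz xE]]] := xe k.
by rewrite !xE ffunE /=; case: (a k); rewrite ?(p_edge yz) (addbT, addbF).
Qed.

Program Definition product_map : cubical_map graph_product (cube_rep d) :=
  @CubicalMap graph_product (cube_rep d)
    (fun n x => CubeHom (product_map_subproof x)) _.
Next Obligation.
by move=> n m f x; apply: cube_hom_eq => a /=; rewrite !ffunE.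
Qed.

End GraphProduct.

Section ContinuousFunctions.
Context (R : realType) (X : topologicalType).
Implicit Types f g : X -> R.

Lemma cts_addr f g : continuous f -> continuous g ->
  continuous (fun x => f x + g x).
Proof. by move=> cf cg x; apply: cvgD; [exact: cf | exact: cg]. Qed.

Lemma cts_mulr f g : continuous f -> continuous g ->
  continuous (fun x => f x * g x).
Proof. by move=> cf cg x; apply: cvgM; [exact: cf | exact: cg]. Qed.

Lemma cts_oppr f : continuous f -> continuous (fun x => - f x).
Proof. by move=> cf x; apply: cvgN; exact: cf. Qed.

Lemma cts_const (r : R) : continuous (fun _ : X => r).
Proof. by move=> x; exact: cvg_cst. Qed.

Lemma cts_normr f : continuous f -> continuous (fun x => `|f x|).
Proof. by move=> cf x; apply: cvg_norm; exact: cf. Qed.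

Lemma cts_maxr f g : continuous f -> continuous g ->
  continuous (fun x => Num.max (f x) (g x)).
Proof. by move=> cf cg x; apply: (@continuous_max R X f g x (cf x) (cg x)). Qed.

Lemma cts_minr f g : continuous f -> continuous g ->
  continuous (fun x => Num.min (f x) (g x)).
Proof. by move=> cf cg x; apply: (@continuous_min R X f g x (cf x) (cg x)). Qed.

Lemma cts_comp (Y Z : topologicalType) (f : X -> Y) (g : Y -> Z) :
  continuous f -> continuous g -> continuous (fun x => g (f x)).
Proof. by move=> cf cg x; apply: (@continuous_comp X Y Z f g x); [exact: cf|exact: cg]. Qed.

Lemma cts_pair (Y Z : topologicalType) (f : X -> Y) (g : X -> Z) :
  continuous f -> continuous g -> continuous (fun x => (f x, g x)).
Proof. by move=> cf cg x; apply: cvg_pair; [exact: cf|exact: cg]. Qed.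

Lemma cts_if (T : topologicalType) (h : X -> R) (f g : X -> T) :
  continuous h -> continuous f -> continuous g ->
  (forall x, h x = 1 -> f x = g x) ->
  continuous (fun x => if h x <= 1 then f x else g x).
Proof.
move=> ch cf cg fg.
pose A := h @^-1` [set r | r <= 1]; pose B := h @^-1` [set r | 1 <= r].
have Acl : closed A by apply: closed_comp => [x _|]; [exact: ch|exact: closed_le].
have Bcl : closed B by apply: closed_comp => [x _|]; [exact: ch|exact: closed_ge].
have ABT : A `|` B = setT.
  apply/seteqP; split => // x _; rewrite /A /B /=.
  by case/orP: (le_total (h x) 1) => hx; [left|right].
apply/continuous_subspace_setT; rewrite -ABT.
apply: withinU_continuous => //.
- apply: (@subspace_eq_continuous _ _ _ f); last exact: continuous_subspaceT.
  by move=> x; rewrite inE /A /from_subspace /= => hx; rewrite hx.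
- apply: (@subspace_eq_continuous _ _ _ g); last exact: continuous_subspaceT.
  move=> x; rewrite inE /B /from_subspace /= => hx; case: ifP => // hx'.
  by rewrite fg //; apply/eqP; rewrite eq_le hx' hx.
Qed.

End ContinuousFunctions.

Section UnitInterval.
Context (R : realType).

Definition unit_interval := set_type `[0, 1 : R]%classic.
HB.instance Definition _ := Topological.on unit_interval.

Definition clamp_real (r : R) : R := Num.max 0 (Num.min r 1).

Lemma clamp_subproof (r : R) : clamp_real r \in `[0, 1 : R]%classic.
Proof.
rewrite inE /= in_itv /= /clamp_real le_max lexx /= ge_max ler01 /=.
by rewrite ge_min lexx orbT.
Qed.

Definition clamp (r : R) : unit_interval := SigSub (clamp_subproof r).

Lemma clamp_lt0 (r : R) : r <= 0 -> clamp r = clamp 0.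
Proof.
move=> r0; apply: val_inj => /=; rewrite /clamp_real.
by rewrite (min_idPl ler01) !(min_idPl (le_trans r0 ler01)) (max_idPl r0) maxxx.
Qed.

Lemma clamp_gt1 (r : R) : 1 <= r -> clamp r = clamp 1.
Proof.
by move=> r1; apply: val_inj; rewrite /= /clamp_real (min_idPr r1) minxx.
Qed.

Lemma val_itv (s : unit_interval) : 0 <= val s <= 1.
Proof. by case: s => s /=; rewrite inE /= in_itv. Qed.

Lemma clampK (s : unit_interval) : clamp (val s) = s.
Proof.
apply: val_inj; rewrite /= /clamp_real; have /andP[s0 s1] := val_itv s.
by rewrite (min_idPl s1) (max_idPr s0).
Qed.

Lemma clamp01 : clamp 0 != clamp 1.
Proof.
apply/eqP => /(congr1 val); rewrite /= /clamp_real minxx.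
by rewrite (min_idPl ler01) maxxx (max_idPr ler01) => /eqP; rewrite eq_sym oner_eq0.
Qed.

HB.instance Definition _ := isBiPointed.Build unit_interval clamp01.

Lemma cts_clamp : continuous clamp.
Proof.
apply: (@continuous_comp_initial (unit_interval : choiceType) R R set_val) => /=.
rewrite /comp set_valE /=.
apply: cts_maxr; first exact: cts_const.
by apply: cts_minr; [move=> x; exact: cvg_id|exact: cts_const].
Qed.

Lemma cts_val : continuous (val : unit_interval -> R).
Proof. by have := @initial_continuous (unit_interval : choiceType) R set_val; rewrite set_valE. Qed.

End UnitInterval.

Section FundamentalGroup.
Context (R : realType) (T : topologicalType) (x0 : T).
Local Notation I := (unit_interval R).

Definition loop := {path I from x0 to x0 in T}.

(* Homotopy of loops relative to the end points. *)
Definition homotopic (p q : loop) : Prop :=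
  exists H : I * I -> T,
  [/\ continuous H,
      forall s, H (s, zero) = p s,
      forall s, H (s, one) = q s
    & forall t, H (zero, t) = x0 /\ H (one, t) = x0].

Lemma homotopic_refl p : homotopic p p.
Proof.
exists (fun z => p z.1); split=> //.
  by apply: cts_comp; [move=> z; exact: cvg_fst|exact: cts_fun].
by move=> t /=; rewrite path_zero path_one.
Qed.

Lemma cts_vfst : continuous (fun z : I * I => val z.1).
Proof. by apply: cts_comp; [move=> z; exact: cvg_fst|exact: cts_val]. Qed.

Lemma cts_vsnd : continuous (fun z : I * I => val z.2).
Proof. by apply: cts_comp; [move=> z; exact: cvg_snd|exact: cts_val]. Qed.

Lemma val0 : val (zero : I) = 0 :> R.
Proof. by rewrite /= /clamp_real (min_idPl ler01) maxxx. Qed.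

Lemma val1 : val (one : I) = 1 :> R.
Proof. by rewrite /= /clamp_real minxx (max_idPr ler01). Qed.

Lemma cts_affine (X : topologicalType) (f : X -> R) (a b : R) :
  continuous f -> continuous (fun x => a * f x + b).
Proof.
move=> cf; apply: cts_addr; last exact: cts_const.
by apply: cts_mulr => //; exact: cts_const.
Qed.

Lemma homotopic_sym p q : homotopic p q -> homotopic q p.
Proof.
move=> [H [cH H0 H1 Hb]].
exists (fun z => H (z.1, clamp (-1 * val z.2 + 1))); split.
- apply: cts_comp cH; apply: cts_pair; first by move=> z; exact: cvg_fst.
  by apply: cts_comp (@cts_clamp R); apply: cts_affine; exact: cts_vsnd.
- by move=> s; rewrite val0 mulr0 add0r H1.
- by move=> s; rewrite val1 mulr1 addNr H0.
- by move=> t; exact: Hb.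
Qed.

Lemma homotopic_trans q p r : homotopic p q -> homotopic q r -> homotopic p r.
Proof.
move=> [H [cH H0 H1 Hb]] [K [cK K0 K1 Kb]].
exists (fun z => if 2 * val z.2 + 0 <= 1 then H (z.1, clamp (2 * val z.2 + 0))
                 else K (z.1, clamp (2 * val z.2 + -1))); split.
- apply: cts_if.
  + by apply: cts_affine; exact: cts_vsnd.
  + apply: cts_comp cH; apply: cts_pair; first by move=> z; exact: cvg_fst.
    by apply: cts_comp (@cts_clamp R); apply: cts_affine; exact: cts_vsnd.
  + apply: cts_comp cK; apply: cts_pair; first by move=> z; exact: cvg_fst.
    by apply: cts_comp (@cts_clamp R); apply: cts_affine; exact: cts_vsnd.
  + move=> z; rewrite addr0 => ->; rewrite subrr -/(one : I).
    by rewrite (H1 z.1) (K0 z.1).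
- by move=> s; rewrite val0 mulr0 addr0 ler01 H0.
- move=> s; rewrite val1 mulr1 addr0 ifF; last by apply/negbTE; rewrite -ltNge; lra.
  by rewrite (_ : 2 + -1 = 1 :> R) ?K1 //; lra.
- by move=> t /=; case: ifP => _; [exact: Hb|exact: Kb].
Qed.

Lemma homotopic_equiv : equiv_class_of (fun p q => `[< homotopic p q >]).
Proof.
split=> [p|p q|q p r].
- by apply/asboolP; exact: homotopic_refl.
- by apply/asboolP/asboolP; exact: homotopic_sym.
- move=> /asboolP pq /asboolP qr; apply/asboolP; exact: homotopic_trans pq qr.
Qed.

Canonical homotopic_equivalence := EquivRelPack homotopic_equiv.

Definition pi1 := {eq_quot homotopic_equivalence}.
HB.instance Definition _ := Quotient.on pi1.
HB.instance Definition _ := Choice.on pi1.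

Lemma pi1P p q : homotopic p q -> \pi_pi1 p = \pi_pi1 q.
Proof. by move=> pq; apply/eqmodP/asboolP. Qed.

Lemma pi1_repr p : homotopic (repr (\pi_pi1 p)) p.
Proof.
have pE : \pi_pi1 (repr (\pi_pi1 p)) = \pi_pi1 p by rewrite reprK.
by apply/asboolP; move/eqmodP: pE.
Qed.

(* A loop extended to the real line by its base point. *)
Definition ext (p : loop) (r : R) : T := p (clamp r).

Lemma cts_ext p : continuous (ext p).
Proof. by apply: cts_comp (@cts_clamp R) _; exact: cts_fun. Qed.

Lemma ext_le0 p r : r <= 0 -> ext p r = x0.
Proof. by move=> r0; rewrite /ext clamp_lt0 // (path_zero (s := p)). Qed.

Lemma ext_ge1 p r : 1 <= r -> ext p r = x0.
Proof. by move=> r1; rewrite /ext clamp_gt1 // (path_one (s := p)). Qed.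

Lemma ext_val p (s : I) : ext p (val s) = p s.
Proof. by rewrite /ext clampK. Qed.

Section MkLoop.
Context (P : R -> T) (cP : continuous P) (P0 : P 0 = x0) (P1 : P 1 = x0).

Lemma mk_loop_cts : continuous (fun s : I => P (val s)).
Proof. exact: cts_comp (@cts_val R) cP. Qed.

Lemma mk_loop_zero : P (val (zero : I)) = x0.
Proof. by rewrite val0. Qed.

Lemma mk_loop_one : P (val (one : I)) = x0.
Proof. by rewrite val1. Qed.

Definition mk_loop : loop := mk_path mk_loop_cts mk_loop_zero mk_loop_one.

Lemma mk_loopE s : mk_loop s = P (val s). Proof. by []. Qed.

End MkLoop.

Definition join (P Q : R -> T) (r : R) : T := if r <= 1 then P r else Q (r - 1).

Lemma cts_join (P Q : R -> T) : continuous P -> continuous Q -> P 1 = Q 0 ->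
  continuous (join P Q).
Proof.
move=> cP cQ PQ; apply: cts_if => //.
- by move=> r; exact: cvg_id.
- apply: cts_comp cQ; apply: cts_addr; last exact: cts_const.
  by move=> r; exact: cvg_id.
- by move=> r ->; rewrite subrr.
Qed.

Lemma cts_scale2 : continuous (fun r : R => 2 * r).
Proof. by apply: cts_mulr; [exact: cts_const|move=> r; exact: cvg_id]. Qed.

Lemma cts_join_ext p q : continuous (join (ext p) (ext q)).
Proof. by apply: cts_join; [exact: cts_ext..|rewrite ext_ge1 // ext_le0]. Qed.

Lemma concat_cts p q : continuous (fun r : R => join (ext p) (ext q) (2 * r)).
Proof. exact: cts_comp cts_scale2 (@cts_join_ext p q). Qed.

Lemma concat0 p q : join (ext p) (ext q) (2 * 0) = x0.
Proof. by rewrite mulr0 /join ler01 ext_le0. Qed.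

Lemma concat1 p q : join (ext p) (ext q) (2 * 1) = x0.
Proof.
rewrite mulr1 /join ifF; first by rewrite ext_ge1 //; lra.
by apply/negbTE; rewrite -ltNge; lra.
Qed.

(* s |-> p (2 s) for s <= 1/2 and q (2 s - 1) for s > 1/2. *)
Definition concat (p q : loop) : loop :=
  mk_loop (@concat_cts p q) (concat0 p q) (concat1 p q).

Lemma ext_concat p q r : ext (concat p q) r = join (ext p) (ext q) (2 * r).
Proof.
have [r0|r0] := lerP r 0.
  rewrite ext_le0 // /join ifT; last by lra.
  by rewrite ext_le0 //; lra.
have [r1|r1] := lerP 1 r.
  rewrite ext_ge1 // /join ifF; last by apply/negbTE; rewrite -ltNge; lra.
  by rewrite ext_ge1 //; lra.
rewrite /ext mk_loopE /= /clamp_real.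
by rewrite (min_idPl (ltW r1)) (max_idPr (ltW r0)).
Qed.

Lemma rev_cts p : continuous (fun r : R => ext p (-1 * r + 1)).
Proof.
by apply: cts_comp (@cts_ext p); apply: cts_affine => r; exact: cvg_id.
Qed.

Lemma rev0 p : ext p (-1 * 0 + 1) = x0.
Proof. by rewrite ext_ge1 //; lra. Qed.

Lemma rev1 p : ext p (-1 * 1 + 1) = x0.
Proof. by rewrite ext_le0 //; lra. Qed.

Definition rev_loop (p : loop) : loop := mk_loop (@rev_cts p) (rev0 p) (rev1 p).

Lemma ext_rev p r : ext (rev_loop p) r = ext p (-1 * r + 1).
Proof.
have [r0|r0] := lerP r 0.
  by rewrite ext_le0 // ext_ge1 //; lra.
have [r1|r1] := lerP 1 r.
  by rewrite ext_ge1 // ext_le0 //; lra.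
rewrite {1}/ext mk_loopE /= /clamp_real.
by rewrite (min_idPl (ltW r1)) (max_idPr (ltW r0)).
Qed.

Definition const_loop : loop :=
  @mk_loop (fun _ => x0) (@cst_continuous _ _ x0) erefl erefl.

Lemma ext_const r : ext const_loop r = x0. Proof. by []. Qed.

Lemma straight_homotopic (P : R -> T) (f g : R -> R) (p q : loop) :
  continuous P -> continuous f -> continuous g -> f 0 = g 0 -> f 1 = g 1 ->
  (forall r, 0 <= r <= 1 -> ext p r = P (f r)) ->
  (forall r, 0 <= r <= 1 -> ext q r = P (g r)) -> homotopic p q.
Proof.
move=> cP cf cg fg0 fg1 pE qE.
exists (fun z => P ((-1 * val z.2 + 1) * f (val z.1) + val z.2 * g (val z.1))).
split.
- apply: cts_comp cP; apply: cts_addr; apply: cts_mulr.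
  + by apply: cts_affine; exact: cts_vsnd.
  + exact: cts_comp cts_vfst cf.
  + exact: cts_vsnd.
  + exact: cts_comp cts_vfst cg.
- move=> s; rewrite val0 mulr0 add0r mul1r mul0r addr0 -pE ?ext_val //.
  exact: val_itv.
- move=> s; rewrite val1 mulr1 addNr mul0r mul1r add0r -qE ?ext_val //.
  exact: val_itv.
- move=> t; split.
    rewrite val0 -fg0 -mulrDl (_ : _ + _ + _ = 1); last by lra.
    by rewrite mul1r -pE ?lexx ?ler01 // ext_le0.
  rewrite val1 -fg1 -mulrDl (_ : _ + _ + _ = 1); last by lra.
  by rewrite mul1r -pE ?lexx ?ler01 // ext_ge1.
Qed.

Lemma concat_homotopic p p' q q' :
  homotopic p p' -> homotopic q q' -> homotopic (concat p q) (concat p' q').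
Proof.
move=> [H [cH H0 H1 Hb]] [K [cK K0 K1 Kb]].
exists (fun z => if 2 * val z.1 + 0 <= 1 then H (clamp (2 * val z.1 + 0), z.2)
                 else K (clamp (2 * val z.1 + -1), z.2)); split.
- apply: cts_if.
  + by apply: cts_affine; exact: cts_vfst.
  + apply: cts_comp cH; apply: cts_pair; last by move=> z; exact: cvg_snd.
    by apply: cts_comp (@cts_clamp R); apply: cts_affine; exact: cts_vfst.
  + apply: cts_comp cK; apply: cts_pair; last by move=> z; exact: cvg_snd.
    by apply: cts_comp (@cts_clamp R); apply: cts_affine; exact: cts_vfst.
  + move=> z; rewrite addr0 => ->; rewrite subrr.
    by rewrite (Hb z.2).2 (Kb z.2).1.
- by move=> s; rewrite mk_loopE /join addr0 H0 K0.
- by move=> s; rewrite mk_loopE /join addr0 H1 K1.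
- move=> t; split.
    by rewrite val0 mulr0 addr0 ler01 (Hb t).1.
  rewrite val1 mulr1 addr0 ifF; last by apply/negbTE; rewrite -ltNge; lra.
  by rewrite (_ : 2 + -1 = 1 :> R) ?(Kb t).2 //; lra.
Qed.

Lemma rev_homotopic p q : homotopic p q -> homotopic (rev_loop p) (rev_loop q).
Proof.
move=> [H [cH H0 H1 Hb]].
exists (fun z => H (clamp (-1 * val z.1 + 1), z.2)); split.
- apply: cts_comp cH; apply: cts_pair; last by move=> z; exact: cvg_snd.
  by apply: cts_comp (@cts_clamp R); apply: cts_affine; exact: cts_vfst.
- by move=> s; rewrite mk_loopE H0.
- by move=> s; rewrite mk_loopE H1.
- move=> t; rewrite val0 val1 mulr0 add0r mulr1 addNr.
  by split; [exact: (Hb t).2|exact: (Hb t).1].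
Qed.

Lemma concatA p q r :
  homotopic (concat p (concat q r)) (concat (concat p q) r).
Proof.
pose W := join (ext p) (join (ext q) (ext r)).
apply: (@straight_homotopic W (fun u => Num.max (2 * u) (4 * u - 1))
                              (fun u => Num.min (4 * u) (2 * u + 1))).
- apply: cts_join; [exact: cts_ext|exact: cts_join_ext|].
  by rewrite /join ler01 ext_ge1 // ext_le0.
- apply: cts_maxr; first exact: cts_scale2.
  by apply: cts_affine => u; exact: cvg_id.
- apply: cts_minr; last by apply: cts_affine => u; exact: cvg_id.
  by apply: cts_mulr; [exact: cts_const|move=> u; exact: cvg_id].
- by rewrite (max_idPl _) ?(min_idPl _) //; lra.
- by rewrite (max_idPr _) ?(min_idPr _) //; lra.
- move=> u _; rewrite ext_concat /W /join ext_concat /join.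
  have [u1|u1] := lerP (2 * u) 1.
    by rewrite (max_idPl _) ?u1 //; lra.
  rewrite (max_idPr _); last by lra.
  rewrite [RHS]ifF; last by apply/negbTE; rewrite -ltNge; lra.
  by rewrite (_ : 2 * (2 * u - 1) = 4 * u - 1 - 1) //; ring.
- move=> u _; rewrite ext_concat /W /join ext_concat /join.
  have [u1|u1] := lerP (2 * u) 1.
    rewrite (min_idPl _); last by lra.
    rewrite (_ : 2 * (2 * u) = 4 * u); last by lra.
    case: ifP => // u2; rewrite ifT //; lra.
  rewrite (min_idPr _); last by lra.
  rewrite ifF; last by apply/negbTE; rewrite -ltNge; lra.
  rewrite ifF; last by apply/negbTE; rewrite -ltNge; lra.
  by rewrite (_ : 2 * u + 1 - 1 - 1 = 2 * u - 1) //; lra.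
Qed.

Lemma cts_idr : continuous (fun u : R => u).
Proof. by move=> u; exact: cvg_id. Qed.

Lemma concat_const_l p : homotopic (concat const_loop p) p.
Proof.
apply: (@straight_homotopic (ext p) (fun u => Num.max 0 (2 * u - 1)) id).
- exact: cts_ext.
- by apply: cts_maxr; [exact: cts_const|apply: cts_affine; exact: cts_idr].
- exact: cts_idr.
- by rewrite (max_idPl _) //; lra.
- by rewrite (max_idPr _) /=; lra.
- move=> u _; rewrite ext_concat /join ext_const.
  have [u1|u1] := lerP (2 * u) 1.
    by rewrite (max_idPl _) ?ext_le0 //; lra.
  by rewrite (max_idPr _) //; lra.
- by [].
Qed.

Lemma concat_const_r p : homotopic (concat p const_loop) p.
Proof.
apply: (@straight_homotopic (ext p) (fun u => Num.min 1 (2 * u)) id).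
- exact: cts_ext.
- by apply: cts_minr; [exact: cts_const|exact: cts_scale2].
- exact: cts_idr.
- by rewrite (min_idPr _) /=; lra.
- by rewrite (min_idPl _) //; lra.
- move=> u _; rewrite ext_concat /join ext_const.
  have [u1|u1] := lerP (2 * u) 1.
    by [].
  by rewrite ext_ge1.
- by [].
Qed.

Lemma concat_rev_l p : homotopic (concat (rev_loop p) p) const_loop.
Proof.
apply: (@straight_homotopic (ext p) (fun u => `|2 * u - 1|) (fun _ => 1)).
- exact: cts_ext.
- by apply: cts_normr; apply: cts_affine; exact: cts_idr.
- exact: cts_const.
- by rewrite mulr0 add0r normrN normr1.
- by rewrite mulr1 ger0_norm; lra.
- move=> u _; rewrite ext_concat /join ext_rev.
  have [u1|u1] := lerP (2 * u) 1.
    by congr ext; lra.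
  by congr ext; lra.
- by move=> u _; rewrite ext_const ext_ge1.
Qed.

Lemma concat_rev_r p : homotopic (concat p (rev_loop p)) const_loop.
Proof.
apply: (@straight_homotopic (ext p) (fun u => -1 * `|2 * u - 1| + 1) (fun _ => 0)).
- exact: cts_ext.
- apply: cts_affine; apply: cts_normr; apply: cts_affine; exact: cts_idr.
- exact: cts_const.
- by rewrite mulr0 add0r normrN normr1; lra.
- by rewrite mulr1 ger0_norm; lra.
- move=> u _; rewrite ext_concat /join ext_rev.
  have [u1|u1] := lerP (2 * u) 1.
    by congr ext; lra.
  by congr ext; lra.
- by move=> u _; rewrite ext_const ext_le0.
Qed.

Definition pi1_one : pi1 := \pi_pi1 const_loop.
Definition pi1_mul (a b : pi1) : pi1 := \pi_pi1 (concat (repr a) (repr b)).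
Definition pi1_inv (a : pi1) : pi1 := \pi_pi1 (rev_loop (repr a)).

Lemma pi1_mulE p q : pi1_mul (\pi_pi1 p) (\pi_pi1 q) = \pi_pi1 (concat p q).
Proof. by apply: pi1P; apply: concat_homotopic; exact: pi1_repr. Qed.

Lemma pi1_invE p : pi1_inv (\pi_pi1 p) = \pi_pi1 (rev_loop p).
Proof. by apply: pi1P; apply: rev_homotopic; exact: pi1_repr. Qed.

Lemma pi1_mulA : associative pi1_mul.
Proof.
move=> a b c; rewrite -[a]reprK -[b]reprK -[c]reprK.
move: (repr a) (repr b) (repr c) => p q r.
rewrite (pi1_mulE q r) (pi1_mulE p q) (pi1_mulE p (concat q r)).
rewrite (pi1_mulE (concat p q) r).
by apply: pi1P; exact: concatA.
Qed.

Lemma pi1_mul1 : left_id pi1_one pi1_mul.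
Proof.
move=> a; rewrite -[a]reprK; move: (repr a) => p.
by rewrite (pi1_mulE const_loop p); apply: pi1P; exact: concat_const_l.
Qed.

Lemma pi1_mulr1 : right_id pi1_one pi1_mul.
Proof.
move=> a; rewrite -[a]reprK; move: (repr a) => p.
by rewrite (pi1_mulE p const_loop); apply: pi1P; exact: concat_const_r.
Qed.

Lemma pi1_mulV : left_inverse pi1_one pi1_inv pi1_mul.
Proof.
move=> a; rewrite -[a]reprK; move: (repr a) => p.
by rewrite (pi1_invE p) (pi1_mulE (rev_loop p) p); apply: pi1P; exact: concat_rev_l.
Qed.

Lemma pi1_mulrV : right_inverse pi1_one pi1_inv pi1_mul.
Proof.
move=> a; rewrite -[a]reprK; move: (repr a) => p.
by rewrite (pi1_invE p) (pi1_mulE p (rev_loop p)); apply: pi1P; exact: concat_rev_r.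
Qed.

HB.instance Definition _ :=
  isGroup.Build pi1 pi1_mulA pi1_mul1 pi1_mulr1 pi1_mulV pi1_mulrV.

End FundamentalGroup.

Definition residually_finite (G : groupType) : Prop :=
  forall g : G, g <> 1%g ->
  exists (gT : finGroupType) (f : {multiplicative G -> gT}), f g <> 1%g.

(* w = x0 + x1 Z + x2 F + x3 FZ in A{Z, F}/(Z^2 = c, F^2 = t, FZ = -ZF). *)
Record quat (A : Type) (c t : A) := Quat { qx0 : A; qx1 : A; qx2 : A; qx3 : A }.
Arguments Quat {A} c t qx0 qx1 qx2 qx3.

Section Quaternions.
Context (A : comNzRingType) (c t : A).
Local Notation D := (quat c t).

Definition quat_tuple (x : D) : A * A * A * A := (qx0 x, qx1 x, qx2 x, qx3 x).
Definition tuple_quat (x : A * A * A * A) : D :=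
  let: (a0, a1, a2, a3) := x in Quat c t a0 a1 a2 a3.
Lemma quat_tupleK : cancel quat_tuple tuple_quat. Proof. by case. Qed.
HB.instance Definition _ := Choice.copy D (can_type quat_tupleK).

Definition quat_zero : D := Quat c t 0 0 0 0.
Definition quat_one : D := Quat c t 1 0 0 0.
Definition quat_opp (x : D) : D := Quat c t (- qx0 x) (- qx1 x) (- qx2 x) (- qx3 x).
Definition quat_add (x y : D) : D :=
  Quat c t (qx0 x + qx0 y) (qx1 x + qx1 y) (qx2 x + qx2 y) (qx3 x + qx3 y).
Definition quat_mul (x y : D) : D :=
  let: Quat x0 x1 x2 x3 := x in let: Quat y0 y1 y2 y3 := y in
  Quat c t
    (x0 * y0 + c * x1 * y1 + t * x2 * y2 - t * c * x3 * y3)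
    (x0 * y1 + x1 * y0 + t * x2 * y3 - t * x3 * y2)
    (x0 * y2 + x2 * y0 - c * x1 * y3 + c * x3 * y1)
    (x0 * y3 + x3 * y0 - x1 * y2 + x2 * y1).
Definition quat_scale (a : A) (x : D) : D :=
  Quat c t (a * qx0 x) (a * qx1 x) (a * qx2 x) (a * qx3 x).

Local Ltac quat_ring :=
  rewrite /quat_mul /quat_add /quat_opp /quat_scale /quat_one /quat_zero /=;
  congr Quat; ring.

Lemma quat_addA : associative quat_add.
Proof. by move=> [? ? ? ?] [? ? ? ?] [? ? ? ?]; quat_ring. Qed.
Lemma quat_addC : commutative quat_add.
Proof. by move=> [? ? ? ?] [? ? ? ?]; quat_ring. Qed.
Lemma quat_add0 : left_id quat_zero quat_add.
Proof. by move=> [? ? ? ?]; quat_ring. Qed.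
Lemma quat_addN : left_inverse quat_zero quat_opp quat_add.
Proof. by move=> [? ? ? ?]; quat_ring. Qed.
HB.instance Definition _ :=
  GRing.isZmodule.Build D quat_addA quat_addC quat_add0 quat_addN.

Lemma quat_mulA : associative quat_mul.
Proof. by move=> [? ? ? ?] [? ? ? ?] [? ? ? ?]; quat_ring. Qed.
Lemma quat_mul1 : left_id quat_one quat_mul.
Proof. by move=> [? ? ? ?]; quat_ring. Qed.
Lemma quat_mulr1 : right_id quat_one quat_mul.
Proof. by move=> [? ? ? ?]; quat_ring. Qed.
Lemma quat_mulDl : left_distributive quat_mul quat_add.
Proof. by move=> [? ? ? ?] [? ? ? ?] [? ? ? ?]; quat_ring. Qed.
Lemma quat_mulDr : right_distributive quat_mul quat_add.
Proof. by move=> [? ? ? ?] [? ? ? ?] [? ? ? ?]; quat_ring. Qed.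
Lemma quat_one_neq0 : quat_one != quat_zero.
Proof. by apply/eqP => -[/eqP]; rewrite oner_eq0. Qed.
HB.instance Definition _ := GRing.Zmodule_isNzRing.Build D
  quat_mulA quat_mul1 quat_mulr1 quat_mulDl quat_mulDr quat_one_neq0.

Lemma quat_scaleA (a b : A) (x : D) :
  quat_scale a (quat_scale b x) = quat_scale (a * b) x.
Proof. by case: x => [? ? ? ?]; quat_ring. Qed.
Lemma quat_scale1 : left_id 1 quat_scale.
Proof. by move=> [? ? ? ?]; quat_ring. Qed.
Lemma quat_scaleDr : right_distributive quat_scale +%R.
Proof. by move=> a [? ? ? ?] [? ? ? ?]; rewrite /GRing.add /=; quat_ring. Qed.
Lemma quat_scaleDl (x : D) : {morph quat_scale^~ x : a b / a + b}.
Proof. by move=> a b; case: x => [? ? ? ?]; rewrite [RHS]/GRing.add /=; quat_ring. Qed.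
HB.instance Definition _ := GRing.Zmodule_isLmodule.Build A D
  quat_scaleA quat_scale1 quat_scaleDr quat_scaleDl.

Lemma quat_scaleAl (a : A) (x y : D) : a *: (x * y) = (a *: x) * y.
Proof.
by case: x y => [? ? ? ?] [? ? ? ?]; rewrite /GRing.scale /GRing.mul /=; quat_ring.
Qed.
HB.instance Definition _ := GRing.Lmodule_isLalgebra.Build A D quat_scaleAl.

Definition quat_Z : D := Quat c t 0 1 0 0.
Definition quat_F : D := Quat c t 0 0 1 0.

Lemma quat_ZZ : quat_Z * quat_Z = c%:A.
Proof.
by change (quat_mul quat_Z quat_Z = quat_scale c quat_one); rewrite /quat_Z; quat_ring.
Qed.
Lemma quat_FF : quat_F * quat_F = t%:A.
Proof.
by change (quat_mul quat_F quat_F = quat_scale t quat_one); rewrite /quat_F; quat_ring.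
Qed.
Lemma quat_FZ : quat_F * quat_Z = - (quat_Z * quat_F).
Proof.
change (quat_mul quat_F quat_Z = quat_opp (quat_mul quat_Z quat_F)).
by rewrite /quat_Z /quat_F; quat_ring.
Qed.
Lemma quatE (x : D) :
  x = (qx0 x)%:A + qx1 x *: quat_Z + qx2 x *: quat_F
      + qx3 x *: (quat_F * quat_Z).
Proof.
case: x => a0 a1 a2 a3.
change (Quat c t a0 a1 a2 a3 =
  quat_add (quat_add (quat_add (quat_scale a0 quat_one) (quat_scale a1 quat_Z))
    (quat_scale a2 quat_F)) (quat_scale a3 (quat_mul quat_F quat_Z))).
by rewrite /quat_Z /quat_F; quat_ring.
Qed.

(* The lattice o + o Z + o F + o FZ. *)
Definition quat_order (o : set A) : set D :=
  [set x | [/\ o (qx0 x), o (qx1 x), o (qx2 x) & o (qx3 x)]].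

End Quaternions.

Definition quat_map (A B : Type) (f : A -> B) (c t : A) (x : quat c t) :
    quat (f c) (f t) :=
  Quat (f c) (f t) (f (qx0 x)) (f (qx1 x)) (f (qx2 x)) (f (qx3 x)).

Section QuaternionMap.
Context (A B : comNzRingType) (f : {rmorphism A -> B}) (c t : A).
Lemma quat_mapM (x y : quat c t) : quat_map f (x * y) = quat_map f x * quat_map f y.
Proof.
change (quat_map f (quat_mul x y) = quat_mul (quat_map f x) (quat_map f y)).
case: x y => [? ? ? ?] [? ? ? ?]; rewrite /quat_map /quat_mul /=.
by congr Quat; rewrite !(rmorphD, rmorphN, rmorphM) /=.
Qed.
Lemma quat_map1 : quat_map f 1 = 1 :> quat (f c) (f t).
Proof.
change (quat_map f (quat_one c t) = quat_one (f c) (f t)).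
by rewrite /quat_map /= rmorph1 rmorph0.
Qed.
End QuaternionMap.

Definition gen_subgroup (G : groupType) (A : set G) : set G :=
  [set g | forall H : set G, H 1%g -> (forall x y, H x -> H y -> H (x * y)%g) ->
             (forall x, H x -> H x^-1%g) -> A `<=` H -> H g].

Section GlobalQuaternions.
Context (F : finFieldType) (c : F) (S : {set option F}).

Local Notation K := {fraction {poly F}}.
Definition kconst (a : F) : K := tofrac a%:P.
Definition kt : K := tofrac 'X.

(* The points of the projective line over F are encoded by option F: Some x is
   the place t = x and None is infinity. *)
Definition S0 : {set F} := [set x | (Some x \in S) && (x != 0)].

(* The places of K are infinity and the irreducible polynomials, and f is
   integral at pi iff it has a denominator prime to pi. There is no condition
   at infinity because infinity always belongs to S below. *)
Definition s_integers : set K :=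
  [set f | forall pi : {poly F}, irreducible_poly pi ->
     (forall x, Some x \in S -> ~~ root pi x) ->
     exists a b : {poly F}, f = tofrac a / tofrac b /\ ~~ (pi %| b)].

Lemma s_integers_poly (a : {poly F}) : s_integers (tofrac a).
Proof.
move=> pi [pi1 _] _; exists a, 1; rewrite tofrac1 divr1; split=> //.
by rewrite dvdp1 neq_ltn pi1 orbT.
Qed.

Lemma s_integersN f : s_integers f -> s_integers (- f).
Proof.
move=> fS pi pii piS; have [a [b [-> pib]]] := fS pi pii piS.
by exists (- a), b; rewrite tofracN mulNr.
Qed.

Lemma s_integers_denom (pi b b' : {poly F}) : irreducible_poly pi ->
  ~~ (pi %| b) -> ~~ (pi %| b') -> ~~ (pi %| b * b').
Proof.
move=> pii; rewrite -!irreducible_poly_coprime // coprimepMr => ->.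
by move=> ->.
Qed.

Lemma s_integersM f g : s_integers f -> s_integers g -> s_integers (f * g).
Proof.
move=> fS gS pi pii piS.
have [a [b [-> pib]]] := fS pi pii piS.
have [a' [b' [-> pib']]] := gS pi pii piS.
exists (a * a'), (b * b'); split; last exact: s_integers_denom.
by rewrite !tofracM invfM mulrACA.
Qed.

Lemma s_integersD f g : s_integers f -> s_integers g -> s_integers (f + g).
Proof.
move=> fS gS pi pii piS.
have [a [b [-> pib]]] := fS pi pii piS.
have [a' [b' [-> pib']]] := gS pi pii piS.
have nz (e : {poly F}) : ~~ (pi %| e) -> tofrac e != 0 :> K.
  by rewrite tofrac_eq0; apply: contraNneq => ->; exact: dvdp0.
exists (a * b' + a' * b), (b * b'); split; last exact: s_integers_denom.
by rewrite tofracD !tofracM addf_div ?nz.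
Qed.

Local Notation D := (quat (kconst c) kt).
Definition global_order : set D := quat_order s_integers.

Lemma s_integers0 : s_integers 0.
Proof. by rewrite -(tofrac0 {poly F}); exact: s_integers_poly. Qed.

Lemma s_integers1 : s_integers 1.
Proof. by rewrite -(tofrac1 {poly F}); exact: s_integers_poly. Qed.

Lemma global_order1 : global_order 1.
Proof. by split; rewrite /=; [exact: s_integers1|exact: s_integers0..]. Qed.

Lemma global_orderM x y : global_order x -> global_order y -> global_order (x * y).
Proof.
case: x y => [x0 x1 x2 x3] [y0 y1 y2 y3] [/= X0 X1 X2 X3] [/= Y0 Y1 Y2 Y3].
have cS : s_integers (kconst c) by exact: s_integers_poly.
have tS : s_integers kt by exact: s_integers_poly.
by split=> /=; do ?[apply: s_integersD | apply: s_integersN | apply: s_integersM].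
Qed.

Record global_unit := GlobalUnit {
  gu_val :> D;
  gu_inv : D;
  gu_valP : global_order gu_val;
  gu_invP : global_order gu_inv;
  gu_mulV : gu_val * gu_inv = 1;
  gu_Vmul : gu_inv * gu_val = 1 }.

Lemma global_unit_eq (u v : global_unit) : gu_val u = gu_val v -> u = v.
Proof.
case: u v => [u u' Hu Hu' uu' u'u] [v v' Hv Hv' vv' v'v] /= uv; subst v.
have u'v' : u' = v' by rewrite -[u']mulr1 -vv' mulrA u'u mul1r.
by subst v'; congr GlobalUnit; exact: Prop_irrelevance.
Qed.

HB.instance Definition _ := gen_eqMixin global_unit.
HB.instance Definition _ := gen_choiceMixin global_unit.

Definition gu_one : global_unit :=
  GlobalUnit global_order1 global_order1 (mulr1 1) (mulr1 1).

Lemma gu_mul_subproof (u v : global_unit) :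
  gu_val u * gu_val v * (gu_inv v * gu_inv u) = 1.
Proof. by rewrite mulrA -(mulrA (gu_val u)) gu_mulV mulr1 gu_mulV. Qed.

Lemma gu_mulV_subproof (u v : global_unit) :
  gu_inv v * gu_inv u * (gu_val u * gu_val v) = 1.
Proof. by rewrite mulrA -(mulrA (gu_inv v)) gu_Vmul mulr1 gu_Vmul. Qed.

Definition gu_mul (u v : global_unit) : global_unit :=
  GlobalUnit (global_orderM (gu_valP u) (gu_valP v))
    (global_orderM (gu_invP v) (gu_invP u))
    (gu_mul_subproof u v) (gu_mulV_subproof u v).

Definition gu_V (u : global_unit) : global_unit :=
  GlobalUnit (gu_invP u) (gu_valP u) (gu_Vmul u) (gu_mulV u).

Lemma gu_mulA : associative gu_mul.
Proof. by move=> u v w; apply: global_unit_eq; exact: mulrA. Qed.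
Lemma gu_mul1 : left_id gu_one gu_mul.
Proof. by move=> u; apply: global_unit_eq; exact: mul1r. Qed.
Lemma gu_mulr1 : right_id gu_one gu_mul.
Proof. by move=> u; apply: global_unit_eq; exact: mulr1. Qed.
Lemma gu_mulVg : left_inverse gu_one gu_V gu_mul.
Proof. by move=> u; apply: global_unit_eq; exact: gu_Vmul. Qed.
Lemma gu_mulgV : right_inverse gu_one gu_V gu_mul.
Proof. by move=> u; apply: global_unit_eq; exact: gu_mulV. Qed.
HB.instance Definition _ :=
  isGroup.Build global_unit gu_mulA gu_mul1 gu_mulr1 gu_mulVg gu_mulgV.

Definition scalar_equiv (u v : global_unit) : Prop :=
  exists s : K, [/\ s != 0, s_integers s, s_integers s^-1 & gu_val u = s *: gu_val v].

Lemma scalar_equiv_class : equiv_class_of (fun u v => `[< scalar_equiv u v >]).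
Proof.
have refl u : scalar_equiv u u.
  exists 1; rewrite oner_neq0 invr1 scale1r; split=> //; exact: s_integers1.
have sym u v : scalar_equiv u v -> scalar_equiv v u.
  move=> [s [s0 sS sVS uv]]; exists s^-1; rewrite invr_eq0 invrK uv scalerA.
  by rewrite mulVf // scale1r; split.
split=> [u|u v|v u w].
- exact/asboolP.
- by apply/asboolP/asboolP; exact: sym.
- move=> /asboolP[s [s0 sS sVS uv]] /asboolP[r [r0 rS rVS vw]]; apply/asboolP.
  exists (s * r); split; first exact: (mulf_neq0 s0 r0).
  - exact: s_integersM.
  - by rewrite invfM; exact: s_integersM.
  - by rewrite -scalerA -vw.
Qed.

Canonical scalar_equivalence := EquivRelPack scalar_equiv_class.

Definition Lambda := {eq_quot scalar_equivalence}.
HB.instance Definition _ := Quotient.on Lambda.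
HB.instance Definition _ := Choice.on Lambda.

Definition lclass (u : global_unit) : Lambda := \pi_Lambda u.

Lemma lclassP u v : lclass u = lclass v <-> scalar_equiv u v.
Proof.
split=> [uv|uv]; last by apply/eqmodP/asboolP.
by apply/asboolP; move/eqmodP: uv.
Qed.

Lemma lclass_repr (u : global_unit) : scalar_equiv (repr (lclass u)) u.
Proof. by apply/lclassP; rewrite /lclass reprK. Qed.

Definition lambda_one : Lambda := lclass 1%g.
Definition lambda_mul (a b : Lambda) : Lambda := lclass (repr a * repr b)%g.
Definition lambda_inv (a : Lambda) : Lambda := lclass (repr a)^-1%g.

Lemma scale_quatM (s r : K) (x y : D) : (s *: x) * (r *: y) = (s * r) *: (x * y).
Proof.
change (quat_mul (quat_scale s x) (quat_scale r y)
        = quat_scale (s * r) (quat_mul x y)).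
case: x y => [? ? ? ?] [? ? ? ?]; rewrite /quat_mul /quat_scale /=.
by congr Quat; ring.
Qed.

Lemma lambda_mulE u v : lambda_mul (lclass u) (lclass v) = lclass (u * v)%g.
Proof.
apply/lclassP; have [s [s0 sS sVS us]] := lclass_repr u.
have [r [r0 rS rVS vr]] := lclass_repr v.
exists (s * r); split; first exact: (mulf_neq0 s0 r0).
- exact: s_integersM.
- by rewrite invfM; exact: s_integersM.
- by rewrite -scale_quatM -us -vr.
Qed.

Lemma lambda_invE u : lambda_inv (lclass u) = lclass u^-1%g.
Proof.
apply/lclassP; have [s [s0 sS sVS us]] := lclass_repr u.
exists s^-1; rewrite invr_eq0 invrK; split=> //.
set w := repr _ in us *.
have wE : (s^-1 *: gu_inv u) * gu_val w = 1.
  by rewrite us scale_quatM mulVf // scale1r gu_Vmul.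
change (gu_inv w = s^-1 *: gu_inv u).
by rewrite -[gu_inv w]mul1r -wE -mulrA gu_mulV mulr1.
Qed.

Lemma lclass_surj (a : Lambda) : exists u, a = lclass u.
Proof. by exists (repr a); rewrite /lclass reprK. Qed.

Lemma lambda_mulA : associative lambda_mul.
Proof.
move=> a b d; have [u ->] := lclass_surj a; have [v ->] := lclass_surj b.
have [w ->] := lclass_surj d.
rewrite (lambda_mulE v w) (lambda_mulE u v) (lambda_mulE u (v * w)%g).
by rewrite (lambda_mulE (u * v)%g w) mulgA.
Qed.
Lemma lambda_mul1 : left_id lambda_one lambda_mul.
Proof. by move=> a; have [u ->] := lclass_surj a; rewrite lambda_mulE mul1g. Qed.
Lemma lambda_mulr1 : right_id lambda_one lambda_mul.
Proof. by move=> a; have [u ->] := lclass_surj a; rewrite lambda_mulE mulg1. Qed.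
Lemma lambda_mulV : left_inverse lambda_one lambda_inv lambda_mul.
Proof.
by move=> a; have [u ->] := lclass_surj a; rewrite lambda_invE lambda_mulE mulVg.
Qed.
Lemma lambda_mulrV : right_inverse lambda_one lambda_inv lambda_mul.
Proof.
by move=> a; have [u ->] := lclass_surj a; rewrite lambda_invE lambda_mulE mulgV.
Qed.
HB.instance Definition _ :=
  isGroup.Build Lambda lambda_mulA lambda_mul1 lambda_mulr1 lambda_mulV lambda_mulrV.

(* The element a + b Z of F[Z], of norm a^2 - c b^2. *)
Definition fz (a b : F) : D := (kconst a)%:A + kconst b *: quat_Z (kconst c) kt.
Definition fz_norm (a b : F) : F := a ^+ 2 - c * b ^+ 2.

Definition PA (tau : F) : set Lambda :=
  [set g | exists (a b : F) (u : global_unit),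
     [/\ fz_norm a b = tau^-1,
         gu_val u = 1 + fz a b * quat_F (kconst c) kt & g = lclass u]].

Definition Gamma : set Lambda :=
  gen_subgroup [set g | exists2 tau, tau \in S0 & PA tau g].

End GlobalQuaternions.
Arguments Gamma {F} c S.

(* x has valuation at least n, for a valuation v whose value at 0 is junk. *)
Definition val_ge (L : fieldType) (v : L -> int) (n : int) : set L :=
  [set x | x = 0 \/ n <= v x].

Section Completion.
Context (F : finFieldType) (tau : F).
Local Notation K := {fraction {poly F}}.

(* The completion of F(t) at the place t = tau, whose valuation on F[t] is the
   multiplicity of tau as a root. *)
Record completion := Completion {
  cfield :> fieldType;
  cemb : {rmorphism K -> cfield};
  cval : cfield -> int;
  cvalM : forall x y, x != 0 -> y != 0 -> cval (x * y) = cval x + cval y;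
  cvalD : forall n x y,
    val_ge cval n x -> val_ge cval n y -> val_ge cval n (x + y);
  cval_emb : forall p : {poly F}, p != 0 -> cval (cemb (tofrac p)) = (mup tau p)%:Z;
  cemb_dense : forall x n, exists k, val_ge cval n (x - cemb k);
  ccomplete : forall u : nat -> cfield,
    (forall n, exists N, forall i j, (N <= i)%N -> (N <= j)%N ->
       val_ge cval n (u i - u j)) ->
    exists l, forall n, exists N, forall i, (N <= i)%N ->
      val_ge cval n (u i - l) }.

Section LocalObjects.
Context (Kv : completion).

Definition local_integers : set Kv := val_ge (@cval Kv) 0.

Definition uniformizer : Kv := cemb Kv (tofrac ('X - tau%:P)).

Lemma uniformizer_neq0 : uniformizer != 0.
Proof. by rewrite fmorph_eq0 tofrac_eq0 polyXsubC_eq0. Qed.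

(* The o_v-lattices in K_v^2. *)
Definition lattice (L : set 'cV[Kv]_2) : Prop :=
  exists2 M : 'M[Kv]_2, M \in unitmx &
    L = [set M *m x | x in [set x : 'cV[Kv]_2 | forall i, local_integers (x i ord0)]].

Definition lattice_scale (a : Kv) (L : set 'cV[Kv]_2) : set 'cV[Kv]_2 :=
  [set a *: x | x in L].

Definition homothety_class (L : set 'cV[Kv]_2) : set (set 'cV[Kv]_2) :=
  [set lattice_scale a L | a in [set a | a != 0]].

Definition bt_vertex : choiceType :=
  {classic {C : set (set 'cV[Kv]_2) |
              exists2 L, lattice L & C = homothety_class L}}.

Definition bt_adj (x y : bt_vertex) : Prop :=
  exists L L', [/\ sval x L, sval y L',
    lattice_scale uniformizer L `<` L' & L' `<` L].

Lemma lattice_scaleA a b L :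
  lattice_scale a (lattice_scale b L) = lattice_scale (a * b) L.
Proof.
apply/seteqP; split=> [_ [_ [v Lv <-] <-]|_ [v Lv <-]].
  by exists v => //; rewrite scalerA.
by exists (b *: v); [exists v|rewrite scalerA].
Qed.

Lemma lattice_scale_proper a L L' : a != 0 ->
  L `<` L' -> lattice_scale a L `<` lattice_scale a L'.
Proof.
move=> a0 [LL' L'L]; split=> [_ [v Lv <-]|aL'L].
  by exists v => //; exact: LL'.
apply: L'L => v L'v; have [w Lw] : lattice_scale a L (a *: v).
  by apply: aL'L; exists v.
by move=> /(scalerI a0) <-.
Qed.

Lemma bt_adj_sym x y : bt_adj x y -> bt_adj y x.
Proof.
move=> [L [L' [xL yL' piLL' L'L]]].
exists L', (lattice_scale uniformizer L); split=> //.
  case: x xL => C /= [L0 _ ->] [a a0 <-]; exists (uniformizer * a).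
    by rewrite /= mulf_neq0 // uniformizer_neq0.
  by rewrite lattice_scaleA.
by apply: lattice_scale_proper => //; exact: uniformizer_neq0.
Qed.

(* The Bruhat-Tits tree of PGL_2(K_v). *)
Definition bt_tree : graph := Graph bt_adj_sym.

(* y is the image of x under the class of the invertible matrix g. *)
Definition bt_image (g : 'M[Kv]_2) (x y : bt_tree) : Prop :=
  sval y = [set [set g *m v | v in L] | L in sval x].

Definition local_quat (c : F) : Type := quat (cemb Kv (kconst c)) (cemb Kv (kt F)).

End LocalObjects.
End Completion.

Section CubeDouble.
Context (F : finFieldType) (c : F) (S : {set option F}).

Definition place (i : 'I_#|S0 S|) : F := enum_val i.

Context (Kv : forall i : 'I_#|S0 S|, completion (place i)).
Context (phi : forall i, local_quat (Kv i) c -> 'M[Kv i]_2).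
Context (p : forall i, bt_tree (Kv i) -> bool).
Hypothesis p_edge : forall i, edge_map (@p i).

Definition tree_product : cubical_set := graph_product (fun i => bt_tree (Kv i)).

(* phi identifies (D (x) K_v)^* / K_v^* with PGL_2(K_v); y is the image of x
   under the class of u, acting on the i-th tree. *)
Definition tree_act (u : global_unit c S) (i : 'I_#|S0 S|)
    (x y : bt_tree (Kv i)) : Prop :=
  bt_image (phi (quat_map (cemb (Kv i)) (gu_val u))) x y.

Definition cube_act (u : global_unit c S) (n : nat) (x y : tree_product n) : Prop :=
  forall a i, tree_act u (sval x a i) (sval y a i).

(* The kernel of the type homomorphism: the elements of Gamma that preserve both
   bipartition classes of every tree. *)
Definition Gamma0 : set (Lambda c S) :=
  [set g | Gamma c S g /\ forall u, lclass u = g ->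
     forall i (x y : bt_tree (Kv i)), tree_act u x y -> p y = p x].

Definition Gamma0_orbit (n : nat) (x y : tree_product n) : Prop :=
  exists2 u, Gamma0 (lclass u) & cube_act u x y.

Lemma Gamma0_orbit_face n m (f : cube_hom n m) (x y : tree_product m) :
  Gamma0_orbit x y -> Gamma0_orbit (face f x) (face f y).
Proof. by move=> [u Gu xy]; exists u => // a i; exact: xy. Qed.

Definition Y_S : cubical_set := cquot Gamma0_orbit_face.

Lemma Gamma0_type n (x y : tree_product n) :
  Gamma0_orbit x y -> product_map p_edge n x = product_map p_edge n y.
Proof.
move=> [u [_ up] xy]; apply: cube_hom_eq => a /=; apply/ffunP => i.
by rewrite !ffunE; apply/esym/(up u).
Qed.

Definition Y_S_type : cubical_map Y_S (cube_rep #|S0 S|) :=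
  cquot_lift Gamma0_orbit_face Gamma0_type.

(* y' is the image of y under the class of u modulo Gamma0. *)
Definition Y_S_act (u : global_unit c S) (n : nat) (y y' : Y_S n) : Prop :=
  exists x x' : tree_product n,
  [/\ cube_act u x x', y = \pi_(gen_quot (@Gamma0_orbit n)) x
    & y' = \pi_(gen_quot (@Gamma0_orbit n)) x'].

Definition diagonal_orbit (n : nat) (z z' : fprod Y_S_type Y_S_type n) : Prop :=
  exists u, [/\ Gamma c S (lclass u), Y_S_act u (val z).1 (val z').1
              & Y_S_act u (val z).2 (val z').2].

Lemma Y_S_act_face u n m (f : cube_hom n m) (y y' : Y_S m) :
  Y_S_act u y y' -> Y_S_act u (face f y) (face f y').
Proof.
move=> [x [x' [xx' -> ->]]]; exists (face f x), (face f x'); split.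
- by move=> a i; exact: xx'.
- exact: (cquot_face_pi Gamma0_orbit_face).
- exact: (cquot_face_pi Gamma0_orbit_face).
Qed.

Lemma diagonal_orbit_face n m (f : cube_hom n m)
    (z z' : fprod Y_S_type Y_S_type m) :
  diagonal_orbit z z' -> diagonal_orbit (face f z) (face f z').
Proof. by move=> [u [Gu z1 z2]]; exists u; split=> //; exact: Y_S_act_face. Qed.

Definition cube_double : cubical_set := cquot diagonal_orbit_face.

End CubeDouble.

(* Main.v *)
(* A cube of the double is a pair of cubes of the product of trees with the same
   type, up to pairs of elements of Gamma with the same type; in particular the
   double has a single vertex, and a pair (l, l') of letters at a place gives an
   edge loop rho l l' in its fundamental group. Fix two places i and j. The loops
   rho b b of the letters b at j commensurate the group generated by the loops
   rho a a of the letters a at i, and there are only finitely many loops k of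
   four pairs of letters at j whose two component words are both trivial; the
   loops rho a a permute them, in the sense that k * rho a a = rho a a * k'. If
   the fundamental group were residually finite, closing up in the profinite
   topology would give n > 0 such that every conjugate c of (rho a a)^n by a
   product of diagonal loops commutes with every such k.
     Now a^n is not scalar, so it moves a vertex of the tree at j, and some
   conjugate gamma of a^n moves the base vertex. Take k to be the loop with
   component words b b^-1 b^-1 b and b b b^-1 b^-1. Lifted to pairs of points of
   the trees, the loop k started at the base vertex crosses the edge from
   (star, star) to (b star, b star) once, and started at gamma it never does.
   As the parity of the number of crossings of that edge is a homotopy invariant,
   the corresponding c does not commute with k. *)
From HB Require Import structures.
From mathcomp Require Import all_boot all_order all_algebra fingroup perm gproduct cyclic.
From mathcomp Require Import generic_quotient fraction.
From mathcomp Require Import all_classical reals topology normedtype homotopy.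
From mathcomp Require Import ring lra zify.
Require Import Defs.
Set Implicit Arguments.
Unset Strict Implicit.
Unset Printing Implicit Defensive.
Import Order.TTheory GRing.Theory Num.Theory.
Import numFieldNormedType.Exports.
Local Open Scope classical_set_scope.
Local Open Scope ring_scope.
Local Open Scope quotient_scope.

(** * Commensurated subgroups of residually finite groups *)

(** One exponent [n] has to serve conjugators of every length. A letter at j conjugates the group A
    of the letters at i into itself only on a subgroup of finite index, and iterating this would
    shrink that subgroup for ever. Profinite closures repair this: the closure of a finite index
    subgroup of A contains the trace on the closure of A of the kernel of a finite quotient, and
    kernels are normal. Hence the trace of one kernel is stable under all the conjugations, and it
    contains all n-th powers for n the order of the quotient. Residual finiteness enters once, to
    see that centralisers are closed. The fundamental group of the double is never computed. The
    space of pairs of points of equal type covers the realization but is not simply connected: the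
    loops k lift to closed paths in it. They are detected by its double cover dual to one edge. Both
    coverings are treated together as a set of positions with a sign and a relation of closeness, so
    that no topology is put on a total space. *)

Section ResidualClosure.
Context (G : groupType).
Local Open Scope group_scope.
Implicit Types (A M : set G) (x y g h : G).

(** The closure of [A] in the profinite topology of [G]. *)
Definition rclosure A : set G := [set g |
  forall (gT : finGroupType) (f : {multiplicative G -> gT}),
  exists2 a, A a & f a = f g].

Lemma quotient1 (gT : finGroupType) (f : {multiplicative G -> gT}) : f 1 = 1.
Proof. by apply: (mulgI (f 1)); rewrite -gmulfM !mulg1. Qed.

Lemma quotientV (gT : finGroupType) (f : {multiplicative G -> gT}) x :
  f x^-1 = (f x)^-1.
Proof. by apply: (mulgI (f x)); rewrite -gmulfM !mulgV quotient1. Qed.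

Lemma quotientX (gT : finGroupType) (f : {multiplicative G -> gT}) x n :
  f (x ^+ n) = f x ^+ n.
Proof. by elim: n => [|n IH]; rewrite ?quotient1 // !expgS gmulfM IH. Qed.

Lemma join_quotients (gT1 gT2 : finGroupType) (f1 : {multiplicative G -> gT1})
    (f2 : {multiplicative G -> gT2}) :
  exists (gT : finGroupType) (f : {multiplicative G -> gT}),
  forall x y, f x = f y -> f1 x = f1 y /\ f2 x = f2 y.
Proof.
pose f x := (f1 x, f2 x).
have fM : {morph f : x y / x * y} by move=> x y; rewrite /f !gmulfM.
pose F : {multiplicative G -> (gT1 * gT2)%type} :=
  HB.pack f (isMultiplicative.Build G (gT1 * gT2)%type f fM).
by exists (gT1 * gT2)%type, F => x y [-> ->].
Qed.

(** [P] need not pass to refinements, so [f] is only asked to refine, for each [i], some quotient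
    with [P i]. *)
Lemma join_quotients_fin (I : finType)
    (P : I -> forall gT : finGroupType, {multiplicative G -> gT} -> Prop) :
  (forall i, exists gT f, P i gT f) ->
  exists (gT : finGroupType) (f : {multiplicative G -> gT}), forall i,
    exists (gT' : finGroupType) (f' : {multiplicative G -> gT'}),
      P i gT' f' /\ forall x y, f x = f y -> f' x = f' y.
Proof.
move=> Pex.
suff [gT [f fP]] : exists (gT : finGroupType) (f : {multiplicative G -> gT}),
    forall i, i \in enum I ->
    exists (gT' : finGroupType) (f' : {multiplicative G -> gT'}),
      P i gT' f' /\ forall x y, f x = f y -> f' x = f' y.
  by exists gT, f => i; apply: fP; rewrite mem_enum.
elim: (enum I) => [|i s [gT [f IH]]].
  by exists {perm bool}, (@one_fun G {perm bool}).
have [gT1 [f1 P1]] := Pex i.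
have [gT2 [f2 f2P]] := join_quotients f1 f.
exists gT2, f2 => j; rewrite inE => /predU1P[->|/IH[gT' [f' [P' f'E]]]].
  by exists gT1, f1; split=> // x y /f2P[].
by exists gT', f'; split=> // x y /f2P[_ /f'E].
Qed.

(** Elements of one colour lie in one right coset of [M]. If a colour meets the complement of the
    closure of [M], one finite quotient separates all its elements from [M]; [f] refines these
    quotients. An [h] killed by [f] is approximated by some [u] in [A] killed as well. As 1 lies in
    [M], this [u] is not separated from [M], so it lies in the closure of [M]. *)
Lemma rclosure_finite_index A M (I : finType) (cf : G -> I) :
  (forall x y, M x -> M y -> M (x * y)) -> (forall x, M x -> M x^-1) ->
  (forall u v, A u -> A v -> cf u = cf v -> M (u * v^-1)) ->
  exists (gT : finGroupType) (f : {multiplicative G -> gT}),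
  forall h, rclosure A h -> f h = 1 -> rclosure M h.
Proof.
move=> MM MV AM.
pose P i (gT : finGroupType) (f : {multiplicative G -> gT}) :=
  forall u, A u -> cf u = i -> rclosure M u \/ forall m, M m -> f m <> f u.
have Pex i : exists gT f, P i gT f.
  have [[u [Au cu Mu]]|noM] :=
    pselect (exists u, [/\ A u, cf u = i & ~ rclosure M u]); last first.
    exists {perm bool}, (@one_fun G {perm bool}) => u Au cu.
    by left; apply: contrapT => Mu; apply: noM; exists u.
  move/existsNP : Mu => [gT /existsNP[f fu]]; exists gT, f => v Av cv; right=> m Mm mv.
  have Muv : M (u * v^-1) by apply: AM => //; rewrite cu.
  by apply: fu; exists (u * v^-1 * m); [exact: MM|rewrite gmulfM mv -gmulfM mulgKV].
have [gT0 [f0 f0P]] := join_quotients_fin Pex.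
exists gT0, f0 => h Ah fh gT f.
have [gT1 [f1 f1P]] := join_quotients f f0.
have [u Au /f1P[fu f0u]] := Ah gT1 f1.
have [gT2 [f2 [f2P f2E]]] := f0P (cf u).
have f2u : f2 u = f2 1 by apply: f2E; rewrite f0u fh quotient1.
have M1 : M 1 by rewrite -(mulgV u); exact: AM.
have [Mu|/(_ _ M1)] := f2P u Au erefl; last by rewrite f2u.
by have [m Mm mE] := Mu gT f; exists m => //; rewrite mE.
Qed.

Lemma rclosureM A x y : (forall a b, A a -> A b -> A (a * b)) ->
  rclosure A x -> rclosure A y -> rclosure A (x * y).
Proof.
move=> AM Ax Ay gT f; have [a Aa fa] := Ax gT f; have [b Ab fb] := Ay gT f.
by exists (a * b); [exact: AM|rewrite !gmulfM fa fb].
Qed.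

Lemma sub_rclosure A : A `<=` rclosure A.
Proof. by move=> a Aa gT f; exists a. Qed.

(** The generated submonoid; it is a subgroup for the sets used below, which are stable under
    inversion. *)
Inductive products A : G -> Prop :=
| products1 : products A 1
| productsM x y : A x -> products A y -> products A (x * y).

Lemma productsMM A x y : products A x -> products A y -> products A (x * y).
Proof.
by move=> Ax Ay; elim: Ax => [|z t Az _ IH]; rewrite ?mul1g // -mulgA; exact: productsM.
Qed.

Lemma products_sub A : A `<=` products A.
Proof. by move=> x Ax; rewrite -[x]mulg1; apply: productsM => //; exact: products1. Qed.

Lemma productsV A x : (forall x, A x -> A x^-1) -> products A x -> products A x^-1.
Proof.
move=> AV; elim=> [|y z Ay _ IH]; first by rewrite invg1; exact: products1.
by rewrite invgM; apply: productsMM => //; apply/products_sub/AV.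
Qed.

End ResidualClosure.

Section CommensuratedSubgroup.
Context (G : groupType) (IA : Type) (IB IK : finType).
Context (al : IA -> G) (be : IB -> G) (ka : IK -> G).
Local Open Scope group_scope.

Hypothesis residually_finite_G : residually_finite G.
Hypothesis al_inv : forall a, exists a', al a' = (al a)^-1.
Hypothesis be_al : forall b a, exists a' b', be b * al a = al a' * be b'.
Hypothesis ka_al : forall k a, exists k', ka k * al a = al a * ka k'.

Let A : set G := products (range al).

Let AM x y : A x -> A y -> A (x * y).
Proof. exact: productsMM. Qed.

Let AV x : A x -> A x^-1.
Proof. by apply: productsV => _ [a _ <-]; have [a' <-] := al_inv a; exists a'. Qed.

Let be_A b g : A g -> exists2 h, A h & exists b', be b * g = h * be b'.
Proof.
move=> Ag; elim: Ag b => {g} [b|_ g [a _ <-] Ag IH b].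
  by exists 1; [exact: products1|exists b; rewrite mulg1 mul1g].
have [a' [b' ba]] := be_al b a; have [h Ah [b'' b'g]] := IH b'.
exists (al a' * h); first by apply: productsM => //; exists a'.
by exists b''; rewrite mulgA ba -mulgA b'g mulgA.
Qed.

Let ka_A k g : A g -> exists k', ka k * g = g * ka k'.
Proof.
move=> Ag; elim: Ag k => {g} [k|_ g [a _ <-] Ag IH k].
  by exists k; rewrite mulg1 mul1g.
have [k' kk'] := ka_al k a; have [k'' kk''] := IH k'.
by exists k''; rewrite mulgA kk' -mulgA kk'' mulgA.
Qed.

(** [M] is the part of [A] that [be b] conjugates into [A]. Moving [be b] through [u] leaves a
    remainder [be b'], and two elements with the same remainder differ by an element of [M];
    finiteness of [IB] thus bounds the index. Conjugates are controlled only up to closure, which is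
    why the closure of [A] replaces [A] from here on. *)
Lemma rclosure_conj b : exists (gT : finGroupType) (f : {multiplicative G -> gT}),
  forall h, rclosure A h -> f h = 1 -> rclosure A (be b * h * (be b)^-1).
Proof.
pose M : set G := [set u | A u /\ A (be b * u * (be b)^-1)].
have /choice[cf cfP] u : exists b', A u -> exists2 h, A h & be b * u = h * be b'.
  have [/(be_A b)[h Ah [b' bu]]|nAu] := pselect (A u); last by exists b.
  by exists b' => _; exists h.
have [|||gT [f fP]] := @rclosure_finite_index G A M IB cf.
- move=> x y [Ax xM] [Ay yM]; split; first exact: AM.
  rewrite (_ : _ * _ = be b * x * (be b)^-1 * (be b * y * (be b)^-1)); first exact: AM.
  by rewrite !mulgA mulgKV.
- move=> x [Ax xM]; split; first exact: AV.
  rewrite (_ : _ * _ = (be b * x * (be b)^-1)^-1); first exact: AV.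
  by rewrite !invgM invgK mulgA.
- move=> u v Au Av uv; split; first by apply: AM => //; exact: AV.
  have [h Ah hu] := cfP u Au; have [k Ak kv] := cfP v Av.
  rewrite mulgA hu uv (_ : v^-1 = (be b * v)^-1 * be b); last first.
    by rewrite invgM mulgKV.
  rewrite kv invgM !mulgA mulgK mulgK; apply: AM => //; exact: AV.
exists gT, f => h Ah fh gT' f'.
have [m [Am bm] fm] := fP h Ah fh gT' f'.
by exists (be b * m * (be b)^-1); rewrite // !gmulfM fm.
Qed.

(** [A] conjugates the finite family [ka] into itself, and elements that induce the same map on
    indices differ by a centralising one. An element in the closure of the centraliser still
    centralises: a non-trivial commutator would survive in a finite quotient, where [h] agrees with
    a centralising element. *)
Lemma rclosure_centralises : exists (gT : finGroupType) (f : {multiplicative G -> gT}),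
  forall h, rclosure A h -> f h = 1 -> forall k, commute h (ka k).
Proof.
pose M : set G := [set u | forall k, commute u (ka k)].
have /choice[cf cfP] u : exists k' : {ffun IK -> IK}, A u ->
    forall k, ka k * u = u * ka (k' k).
  have [Au|nAu] := pselect (A u); last by exists [ffun k => k].
  have /choice[k' k'P] : forall k, exists k', ka k * u = u * ka k'.
    by move=> k; exact: ka_A.
  by exists [ffun k => k' k] => _ k; rewrite ffunE.
have [|||gT [f fP]] := @rclosure_finite_index G A M {ffun IK -> IK} cf.
- by move=> x y Mx My k; apply/commute_sym/commuteM; apply/commute_sym; [exact: Mx|exact: My].
- by move=> x Mx k; apply/commute_sym/commuteV/commute_sym/Mx.
- move=> u v Au Av uv k; rewrite /commute.
  have ku := cfP u Au k; have kv := cfP v Av k.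
  rewrite -mulgA (_ : v^-1 * ka k = ka (cf v k) * v^-1).
    by rewrite mulgA -uv -ku mulgA.
  by apply: (mulgI v); rewrite mulVKg mulgA -kv mulgK.
exists gT, f => h Ah fh k; have Mh := fP h Ah fh.
apply: contrapT => hk.
pose c := h * ka k * h^-1 * (ka k)^-1.
have /residually_finite_G[gT' [f' f'c]] : c <> 1.
  by move=> c1; apply: hk; rewrite /commute -[RHS]mul1g -c1 /c !mulgA mulgKV mulgKV.
apply: f'c; have [m Mm fm] := Mh gT' f'.
have e : f' (m * ka k) = f' (ka k * m) by rewrite (Mm k).
rewrite !gmulfM fm in e.
by rewrite /c !gmulfM !quotientV e mulgK mulgV.
Qed.

(** The property carried through the induction on [g] is to lie in the closure of [A] and in the
    kernel of [f]. Conjugation by [al] preserves it because [al] lies in [A], conjugation by [be]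
    because [f] refines the quotients of [rclosure_conj]. The exponent is the order of the target of
    [f]. *)
Lemma commensurated_commute : exists2 n, (0 < n)%N &
  forall g a k, products (range al `|` range be) g ->
    commute (g * al a ^+ n * g^-1) (ka k).
Proof.
have [gT1 [f1 f1P]] := rclosure_centralises.
have [gT2 [f2 f2P]] := join_quotients_fin rclosure_conj.
have [gT [f fP]] := join_quotients f1 f2.
have f1E h : f h = 1 -> f1 h = 1.
  by rewrite -(quotient1 f) => /fP[-> _]; exact: quotient1.
have f2E h : f h = 1 -> f2 h = 1.
  by rewrite -(quotient1 f) => /fP[_ ->]; exact: quotient1.
exists #|gT| => [|g a k gP]; first by apply/card_gt0P; exists 1.
suff [Ah fh] : rclosure A (g * al a ^+ #|gT| * g^-1) /\ f (g * al a ^+ #|gT| * g^-1) = 1.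
  by apply: f1P => //; exact: f1E.
elim: gP => [|x y xX _ [IH1 IH2]].
  rewrite mul1g invg1 mulg1; split; last by rewrite quotientX; apply/eqP; rewrite -order_dvdn -cardsT order_dvdG ?inE.
  apply: sub_rclosure; elim: #|gT| => [|n IH]; first exact: products1.
  by rewrite expgS; apply: productsM => //; exists a.
rewrite (_ : _ * _ = x * (y * al a ^+ #|gT| * y^-1) * x^-1); last first.
  by rewrite invgM !mulgA.
split; last by rewrite gmulfM [X in (X * _)%g]gmulfM IH2 mulg1 quotientV mulgV.
case: xX => [[b _ <-]|[b _ <-]].
  have Ab : rclosure A (al b) by apply/sub_rclosure/products_sub; exists b.
  apply: rclosureM => //; first by apply: rclosureM.
  by apply/sub_rclosure/AV/products_sub; exists b.
have [gT' [f' [f'P f'E]]] := f2P b; apply: f'P => //.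
by rewrite -(quotient1 f'); apply: f'E; rewrite f2E // quotient1.
Qed.

End CommensuratedSubgroup.

(** * Monodromy *)

Section SegmentInduction.
Context (R : realType).
Implicit Types (a b s t e : R).

(** Connectedness of a segment, by the supremum of the initial segments on which [Q] holds. *)
Lemma locally_constant_left (Q : R -> Prop) a b :
  (forall s, a <= s <= b -> exists2 e, 0 < e & forall s1 s2, a <= s1 <= b ->
     a <= s2 <= b -> `|s - s1| < e -> `|s - s2| < e -> Q s1 -> Q s2) ->
  a <= b -> Q a -> Q b.
Proof.
move=> Qloc ab Qa.
pose S := [set x | a <= x <= b /\ forall y, a <= y <= x -> Q y].
have Sa : S a.
  split; first by rewrite lexx ab.
  by move=> y; rewrite -eq_le => /eqP <-.
have Sub : ubound S b by move=> x [/andP[]].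
have Ssup : has_sup S by split; [exists a|exists b].
set s := sup S.
have as_ : a <= s by apply: sup_upper_bound.
have sb : s <= b by apply: ge_sup => //; exists a.
have [e e0 Qe] := Qloc s ltac:(by rewrite as_ sb).
have [x xS] := sup_adherent e0 Ssup; rewrite -/s => xs.
have [/andP[ax xb] Sx] := xS.
have xles : x <= s by apply: sup_upper_bound.
have Qx : Q x by apply: Sx; rewrite ax lexx.
have Qy y : a <= y <= b -> y < s + e -> Q y.
  move=> /andP[ay yb] ye; have [yx|xy] := lerP y x; first by apply: Sx; rewrite ay yx.
  apply: (Qe x y) => //; rewrite ?ax ?ay ?xb ?yb //.
    by rewrite ger0_norm ?subr_ge0 //; lra.
  by rewrite ltr_norml; apply/andP; split; lra.
have [bs|sb'] := lerP b s; first by apply: Qy; rewrite ?ab ?lexx //; lra.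
pose y := Num.min b (s + e / 2).
have ys : s < y by rewrite lt_min sb' /=; lra.
have : S y.
  split; first by rewrite ge_min lexx /= andbT (le_trans as_ (ltW ys)).
  move=> z /andP[az zy]; apply: Qy.
    by rewrite az /= (le_trans zy) // ge_min lexx.
  by apply: (le_lt_trans zy); rewrite gt_min; apply/orP; right; lra.
by move=> /(sup_upper_bound Ssup); rewrite -/s leNgt ys.
Qed.

(** The value is carried from [s1] back to [a] by applying the one-sided lemma to the negation of
    [Q], and then from [a] to [s2]. *)
Lemma locally_constant (Q : R -> Prop) a b :
  (forall s, a <= s <= b -> exists2 e, 0 < e & forall s1 s2, a <= s1 <= b ->
     a <= s2 <= b -> `|s - s1| < e -> `|s - s2| < e -> Q s1 -> Q s2) ->
  forall s1 s2, a <= s1 <= b -> a <= s2 <= b -> Q s1 -> Q s2.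
Proof.
move=> Qloc s1 s2 /andP[as1 s1b] /andP[as2 s2b] Q1.
have sub (Q' : R -> Prop) s : a <= s -> s <= b ->
    (forall s, a <= s <= b -> exists2 e, 0 < e & forall s1 s2, a <= s1 <= b ->
     a <= s2 <= b -> `|s - s1| < e -> `|s - s2| < e -> Q' s1 -> Q' s2) ->
    Q' a -> Q' s.
  move=> as_ sb Qloc'; apply: locally_constant_left => // t /andP[at_ ts].
  have [e e0 Qe] := Qloc' t ltac:(by rewrite at_ (le_trans ts)).
  exists e => // t1 t2 /andP[at1 t1s] /andP[at2 t2s]; apply: Qe.
    by rewrite at1 (le_trans t1s).
  by rewrite at2 (le_trans t2s).
apply: (sub Q s2) => //; apply: contrapT => nQa.
suff : ~ Q s1 by [].
apply: (sub (fun x => ~ Q x)) => // s sab; have [e e0 Qe] := Qloc s sab.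
exists e => // t1 t2 t1ab t2ab st1 st2 nQt1 Qt2; apply: nQt1.
exact: (Qe t2 t1).
Qed.

Lemma near_between (t t1 t2 d x : R) : `|t - t1| < d -> `|t - t2| < d ->
  Num.min t1 t2 <= x <= Num.max t1 t2 -> `|t - x| < d.
Proof.
rewrite !ltr_norml => /andP[? ?] /andP[? ?] /andP[mx xM].
have h1 : t - d < x by apply: lt_le_trans mx; rewrite lt_min; apply/andP; split; lra.
have h2 : x < t + d by apply: (le_lt_trans xM); rewrite gt_max; apply/andP; split; lra.
by apply/andP; split; lra.
Qed.

End SegmentInduction.

Section Monodromy.
Context (R : realType) (B : topologicalType) (E : Type).
Context (over : B -> E -> Prop) (close : E -> E -> Prop).
Implicit Types (a b s t e : R) (V : set B) (p : R -> B) (g : R -> E).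

(** A covering without a topology on the total space: [E] is a bare type, and [close] stands for
    lying on a common sheet over nearby points. A trivializing set has a sheet through each point
    above it. *)
Definition trivializing V : Prop := forall x u, V x -> over x u ->
  exists sg : B -> E, [/\ sg x = u, forall y, V y -> over y (sg y)
    & forall y z, V y -> V z -> close (sg y) (sg z)].

Hypothesis close_sym : forall u v, close u v -> close v u.
Hypothesis close_refl : forall u, close u u.
Hypothesis over_inj : forall x u v w,
  over x u -> over x v -> close w u -> close w v -> u = v.
Hypothesis cover : forall x, exists V, [/\ open V, V x & trivializing V].

(** Continuity of the lift [g] is expressed through [close] alone. *)
Definition lift_on a b p g : Prop := forall s, a <= s <= b ->
  over (p s) (g s) /\ exists2 e, 0 < e & forall s', a <= s' <= b ->
    `|s - s'| < e -> close (g s) (g s').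

Lemma lift_sub a b a' b' p g :
  a <= a' -> b' <= b -> lift_on a b p g -> lift_on a' b' p g.
Proof.
move=> aa bb pg s /andP[as_ sb].
have [|po [e e0 pe]] := pg s; first by rewrite (le_trans aa) // (le_trans sb).
split=> //; exists e => // s' /andP[as' s'b]; apply: pe.
by rewrite (le_trans aa) // (le_trans s'b).
Qed.

(** Agreement of two lifts is locally constant in both directions, because [over_inj] separates the
    sheets. *)
Lemma lift_unique a b p g g' : lift_on a b p g -> lift_on a b p g' ->
  forall s t, a <= s <= b -> a <= t <= b -> g s = g' s -> g t = g' t.
Proof.
move=> pg pg'; apply: locally_constant => s sab.
have [os [e e0 ge]] := pg s sab; have [os' [e' e'0 ge']] := pg' s sab.
suff key s1 : a <= s1 <= b -> `|s - s1| < Num.min e e' -> g s = g' s <-> g s1 = g' s1.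
  exists (Num.min e e'); first by rewrite lt_min e0.
  by move=> s1 s2 s1ab s2ab d1 d2 /(key s1 s1ab d1)/(key s2 s2ab d2).
move=> s1ab; rewrite lt_min => /andP[d1 d2].
have [[os1 _] [os1' _]] := (pg s1 s1ab, pg' s1 s1ab).
have c1 := ge s1 s1ab d1; have c2 := ge' s1 s1ab d2.
split=> eq_g.
  by rewrite -eq_g in c2; exact: over_inj os1 os1' c1 c2.
rewrite -eq_g in c2; exact: over_inj os os' (close_sym c1) (close_sym c2).
Qed.

Lemma lift_glue a m b p g g' : lift_on a m p g -> lift_on m b p g' ->
  g m = g' m -> lift_on a b p (fun r => if r <= m then g r else g' r).
Proof.
move=> pg pg' gm s /andP[as_ sb].
have [sm|ms|sm] := ltgtP s m.
- have [|os [e e0 ge]] := pg s; first by rewrite as_ ltW.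
  split=> //; exists (Num.min e (m - s)); first by rewrite lt_min e0 subr_gt0.
  move=> s' /andP[as' s'b]; rewrite lt_min => /andP[d1].
  rewrite ltr_norml => /andP[d2 d3].
  have s'm : s' <= m by lra.
  by rewrite s'm; apply: ge; rewrite // as' s'm.
- have [|os [e e0 ge]] := pg' s; first by rewrite (ltW ms).
  split=> //; exists (Num.min e (s - m)); first by rewrite lt_min e0 subr_gt0.
  move=> s' /andP[as' s'b]; rewrite lt_min => /andP[d1].
  rewrite ltr_norml => /andP[d2 d3].
  have s'm : m < s' by lra.
  by rewrite leNgt s'm /=; apply: ge; rewrite // s'b ltW.
- subst s.
  have [|os [e e0 ge]] := pg m; first by rewrite as_ lexx.
  have [|os' [e' e'0 ge']] := pg' m; first by rewrite sb lexx.
  split=> //; exists (Num.min e e'); first by rewrite lt_min e0.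
  move=> s' /andP[as' s'b]; rewrite lt_min => /andP[d1 d2].
  case: lerP => s'm; first by apply: ge; rewrite // as' s'm.
  by rewrite gm; apply: ge'; rewrite // s'b ltW.
Qed.

Lemma lift_section a b p (V : set B) (sg : B -> E) :
  (forall s, a <= s <= b -> V (p s)) ->
  (forall y, V y -> over y (sg y)) ->
  (forall y z, V y -> V z -> close (sg y) (sg z)) ->
  lift_on a b p (fun s => sg (p s)).
Proof.
move=> Vp so sc s sab; split; first by apply: so; exact: Vp.
by exists 1 => // s' s'ab _; apply: sc; exact: Vp.
Qed.

Lemma continuous_near (X : topologicalType) (f : R -> X) s (V : set X) :
  continuous f -> open V -> V (f s) ->
  exists2 e, 0 < e & forall s', `|s - s'| < e -> V (f s').
Proof.
move=> cf oV Vs.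
have /nbhs_ballP[e /= e0 eV] : nbhs s (f @^-1` V) by apply: cf; exact: open_nbhs_nbhs.
by exists e => // s' ss'; apply: eV.
Qed.

(** Existence of a lift up to [s] is a locally constant property of [s]: inside a trivializing set a
    lift is prolonged by the sheet through its current end. *)
Lemma lift_exists a b p u : continuous p -> a <= b -> over (p a) u ->
  exists2 g, lift_on a b p g & g a = u.
Proof.
move=> cp ab ou.
pose Q s := exists2 g, lift_on a s p g & g a = u.
have Ia : a <= a <= b by rewrite lexx.
have Ib : a <= b <= b by rewrite lexx ab.
apply: (locally_constant (Q := Q) _ Ia Ib); last first.
  exists (fun _ => u) => // s sa; have -> : s = a by apply/eqP; rewrite eq_le andbC.
  by split=> //; exists 1.
move=> s sab; have [V [oV Vs tV]] := cover (p s).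
have [e e0 eV] := continuous_near cp oV Vs.
exists e => // s1 s2 /andP[as1 s1b] /andP[as2 s2b] d1 d2 [g pg ga].
have [s21|s12] := lerP s2 s1; first by exists g => //; exact: lift_sub pg.
have [o1 _] := pg s1 ltac:(by rewrite as1 lexx).
have [sg [sg1 so sc]] := tV (p s1) (g s1) (eV _ d1) o1.
have pg' : lift_on s1 s2 p (fun s => sg (p s)).
  apply: (@lift_section _ _ _ V) => // t /andP[s1t ts2]; apply: eV.
  by move: d1 d2; rewrite !ltr_norml => /andP[? ?] /andP[? ?]; apply/andP; split; lra.
exists (fun r => if r <= s1 then g r else sg (p r)); last by rewrite as1.
exact: lift_glue pg pg' _.
Qed.

(** Each path [H s] is lifted from [g s], and the values at time 1 form the new lift. Its continuity
    at [s0] is propagated along [t]: the property [Q] allows the neighbourhood of [s0] to depend on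
    [t], so it is locally constant. The ends stay put because a constant path has a constant
    lift. *)
Lemma homotopy_lift (H : R -> R -> B) g :
  (forall s t V, open V -> V (H s t) -> exists2 e, 0 < e & forall s' t',
     `|s - s'| < e -> `|t - t'| < e -> V (H s' t')) ->
  (forall s, continuous (H s)) ->
  (forall t, H 0 t = H 0 0) -> (forall t, H 1 t = H 1 0) ->
  lift_on 0 1 (fun s => H s 0) g ->
  exists g', [/\ lift_on 0 1 (fun s => H s 1) g', g' 0 = g 0 & g' 1 = g 1].
Proof.
move=> cH cHs H0 H1 pg.
have /choice[G GP] s : exists k, 0 <= s <= 1 -> lift_on 0 1 (H s) k /\ k 0 = g s.
  have [s01|ns] := pselect (0 <= s <= 1 :> Prop); last by exists (fun _ => g 0).
  have [o _] := pg s s01.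
  by have [k] := lift_exists (cHs s) ler01 o; exists k.
have I0 : 0 <= (0 : R) <= 1 by rewrite lexx ler01.
have I1 : 0 <= (1 : R) <= 1 by rewrite lexx ler01.
exists (fun s => G s 1); split.
- move=> s0 s01; have [lG0 G00] := GP s0 s01; split; first exact: (lG0 1 ltac:(exact: I1)).1.
  pose Q t := exists2 e, 0 < e & forall s, 0 <= s <= 1 -> `|s0 - s| < e ->
    close (G s0 t) (G s t).
  suff [e e0 ge] : Q 1 by exists e.
  apply: (locally_constant (Q := Q) _ I0 I1); last first.
    have [_ [e e0 ge]] := pg s0 s01; exists e => // s s01' d.
    by rewrite G00 (GP s s01').2; exact: ge.
  move=> t t01; have [V [oV Vt tV]] := cover (H s0 t).
  have [d d0 dV] := cH s0 t V oV Vt.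
  exists d => // t1 t2 t1I t2I d1 d2 [e e0 Ge].
  have z0 : `|s0 - s0| < d by rewrite subrr normr0.
  have [o1 _] := lG0 t1 t1I.
  have [sg [sg1 so sc]] := tV _ _ (dV _ _ z0 d1) o1.
  exists (Num.min d e) => [|s sI]; first by rewrite lt_min d0.
  rewrite lt_min => /andP[sd se]; have [lGs _] := GP s sI.
  pose m := Num.min t1 t2; pose M := Num.max t1 t2.
  have mM x : m <= x <= M -> `|t - x| < d by exact: near_between.
  have m0 : 0 <= m by rewrite le_min; case/andP: t1I => -> _; case/andP: t2I => ->.
  have M1 : M <= 1 by rewrite ge_max; case/andP: t1I => _ ->; case/andP: t2I => _ ->.
  have t1M : m <= t1 <= M by rewrite ge_min le_max !lexx.
  have t2M : m <= t2 <= M by rewrite ge_min le_max !lexx !orbT.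
  have agree s' : 0 <= s' <= 1 -> `|s0 - s'| < d -> G s' t1 = sg (H s' t1) ->
      G s' t2 = sg (H s' t2).
    move=> s'I s'd; have [lGs' _] := GP s' s'I.
    apply: (@lift_unique m M (H s') (G s') (fun x => sg (H s' x))) => //.
      exact: lift_sub lGs'.
    by apply: (@lift_section _ _ _ V) => // x xm; apply: dV => //; exact: mM.
  rewrite (agree s0) // (agree s) //; first by apply: sc; exact: dV.
  apply: (over_inj (lGs t1 t1I).1 (so _ (dV _ _ sd d1)) (Ge s sI se)).
  by rewrite -sg1; apply: sc; exact: dV.
- have [l0 <-] := GP 0 I0; apply/esym.
  apply: (lift_unique (g := fun _ => G 0 0) (g' := G 0) _ l0 I0 I1) => //.
  move=> t tI; rewrite H0; split; first exact: (l0 0 I0).1.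
  by exists 1.
- have [l1 <-] := GP 1 I1; apply/esym.
  apply: (lift_unique (g := fun _ => G 1 0) (g' := G 1) _ l1 I0 I1) => //.
  move=> t tI; rewrite H1; split; first exact: (l1 0 I0).1.
  by exists 1.
Qed.

End Monodromy.

(** * Holonomy of classes of loops *)

Section Holonomy.
Context (R : realType) (B : topologicalType) (x0 : B) (E : Type).
Context (over : B -> E -> Prop) (close : E -> E -> Prop).
Hypothesis close_sym : forall u v, close u v -> close v u.
Hypothesis close_refl : forall u, close u u.
Hypothesis over_inj : forall x u v w,
  over x u -> over x v -> close w u -> close w v -> u = v.
Hypothesis cover : forall x, exists V,
  [/\ open V, V x & trivializing over close V].
Local Notation lift := (@lift_on R B E over close).
Implicit Types (p q : loop R x0) (u v w : E).

Lemma lift_reparam (P : R -> B) g (k c a b : R) : 0 < k ->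
  lift (k * a + c) (k * b + c) P g ->
  lift a b (fun s => P (k * s + c)) (fun s => g (k * s + c)).
Proof.
move=> k0 Pg s /andP[as_ sb].
have mono x y : x <= y -> k * x + c <= k * y + c by move=> xy; rewrite lerD2r ler_pM2l.
have [|os [e e0 ge]] := Pg (k * s + c); first by rewrite !mono.
split=> //; exists (e / k); first exact: divr_gt0.
move=> s' /andP[as' s'b] d; apply: ge; first by rewrite !mono.
rewrite (_ : _ - _ = k * (s - s')); last by ring.
by rewrite normrM (gtr0_norm k0) mulrC -ltr_pdivlMr.
Qed.

Lemma lift_on_ext (P P' : R -> B) g g' (a b : R) :
  (forall s, a <= s <= b -> P s = P' s) -> (forall s, a <= s <= b -> g s = g' s) ->
  lift a b P g -> lift a b P' g'.
Proof.
move=> PP gg Pg s sab; have [os [e e0 ge]] := Pg s sab.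
rewrite -PP // -gg //; split=> //; exists e => // s' s'ab d.
by rewrite -gg //; exact: ge.
Qed.

Definition lift_end p u v : Prop :=
  exists g, [/\ lift 0 1 (ext p) g, g 0 = u & g 1 = v].

Let I0 : 0 <= (0 : R) <= 1. Proof. by rewrite lexx ler01. Qed.
Let I1 : 0 <= (1 : R) <= 1. Proof. by rewrite lexx ler01. Qed.

Lemma lift_end_homotopic p q u v : homotopic p q -> lift_end p u v -> lift_end q u v.
Proof.
move=> [H [cH H0 H1 Hb]] [g [pg g0 g1]].
pose K s t := H (clamp s, clamp t).
have K0 : (fun s => K s 0) = ext p by apply/funext => s; rewrite /K H0.
have K1 : (fun s => K s 1) = ext q by apply/funext => s; rewrite /K H1.
have [|||||g' []] := homotopy_lift close_sym close_refl over_inj cover (H := K) (g := g).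
- move=> s t V oV Vst.
  have cK : continuous (fun z : R * R => K z.1 z.2).
    apply: cts_comp cH; apply: cts_pair.
      by apply: cts_comp (@cts_clamp R) => z; exact: cvg_fst.
    by apply: cts_comp (@cts_clamp R) => z; exact: cvg_snd.
  have /nbhs_ballP[e /= e0 eV] : nbhs (s, t) ((fun z : R * R => K z.1 z.2) @^-1` V).
    by apply: cK; exact: open_nbhs_nbhs.
  by exists e => // s' t' ds dt; apply: (eV (s', t')).
- move=> s; apply: cts_comp cH; apply: cts_pair; first exact: cst_continuous.
  exact: cts_clamp.
- by move=> t; rewrite /K (Hb (clamp t)).1 (Hb (clamp 0)).1.
- by move=> t; rewrite /K (Hb (clamp t)).2 (Hb (clamp 0)).2.
- by rewrite K0.
by rewrite K1 => qg' g'0 g'1; exists g'; rewrite g'0 g'1.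
Qed.

Lemma lift_end_inj p u v u' v' :
  lift_end p u v -> lift_end p u' v' -> (u = u') <-> (v = v').
Proof.
move=> [g [pg <- <-]] [g' [pg' <- <-]].
by split=> [gg'|gg']; apply: (lift_unique close_sym over_inj pg pg' _ _ gg').
Qed.

Lemma lift_end_const u : over x0 u -> lift_end (const_loop R x0) u u.
Proof. by move=> ou; exists (fun _ => u); split=> // s sI; split=> //; exists 1. Qed.

Lemma lift_end_exists p u : over x0 u -> exists v, lift_end p u v.
Proof.
rewrite -(ext_le0 p (lexx 0)) => ou.
have [g pg g0] := lift_exists close_refl cover (@cts_ext _ _ _ p) ler01 ou.
by exists (g 1), g.
Qed.

Lemma lift_end_over p u v : lift_end p u v -> over x0 u /\ over x0 v.
Proof.
move=> [g [pg <- <-]]; have [o0 _] := pg 0 I0; have [o1 _] := pg 1 I1.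
by rewrite ext_le0 // in o0; rewrite ext_ge1 // in o1.
Qed.

Lemma lift_end_concat p q u v w :
  lift_end p u v -> lift_end q v w -> lift_end (concat p q) u w.
Proof.
move=> [g [pg g0 g1]] [k [qk k0 k1]].
have half : 0 <= (1 / 2 : R) by lra.
exists (fun r => if r <= 1 / 2 then g (2 * r + 0) else k (2 * r + -1)).
split; last 2 first.
- by rewrite half mulr0 addr0.
- rewrite ifF; last by apply/negbTE; rewrite -ltNge; lra.
  by have -> : 2 * 1 + -1 = 1 :> R by lra.
apply: lift_glue.
- apply: (@lift_on_ext (fun r => ext p (2 * r + 0)) _ (fun r => g (2 * r + 0))) => //.
    move=> s /andP[s0 s1]; rewrite ext_concat /join addr0 ifT //; lra.
  apply: lift_reparam; first by lra.
  have -> : 2 * (1 / 2) + 0 = 1 :> R by lra.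
  by rewrite mulr0 add0r.
- apply: (@lift_on_ext (fun r => ext q (2 * r + -1)) _ (fun r => k (2 * r + -1))) => //.
    move=> s /andP[s0 s1]; rewrite ext_concat /join; case: ifP => // s2.
    have -> : s = 1 / 2 by lra.
    by rewrite [LHS]ext_le0 ?[RHS]ext_ge1 //; lra.
  apply: lift_reparam; first by lra.
  have -> : 2 * (1 / 2) + -1 = 0 :> R by lra.
  by have -> : 2 * 1 + -1 = 1 :> R by lra.
- have -> : 2 * (1 / 2) + 0 = 1 :> R by lra.
  have -> : 2 * (1 / 2) + -1 = 0 :> R by lra.
  by rewrite g1 k0.
Qed.

(** A partial relation on [E]: elements that do not lie over the base point have no image. The
    choice of [repr] is harmless by [lift_end_homotopic]. *)
Definition hol (a : pi1 R x0) u v : Prop := lift_end (repr a) u v.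

Lemma hol_pi p u v : lift_end p u v -> hol (\pi_(pi1 R x0) p) u v.
Proof. by apply: lift_end_homotopic; apply: homotopic_sym; exact: pi1_repr. Qed.

Lemma hol_inj a u v u' v' : hol a u v -> hol a u' v' -> (u = u') <-> (v = v').
Proof. exact: lift_end_inj. Qed.

Lemma holM a b u v w : hol a u v -> hol b v w -> hol (a * b)%g u w.
Proof. by move=> au bv; apply: hol_pi; exact: lift_end_concat au bv. Qed.

Lemma hol1 u : over x0 u -> hol 1%g u u.
Proof. by move=> ou; apply: hol_pi; exact: lift_end_const. Qed.

(** The inverse class is lifted from [v] to some end [w]; comparison with the constant lift of the
    product gives [w = u]. *)
Lemma holV a u v : hol a u v -> hol a^-1%g v u.
Proof.
move=> au; have [ou ov] := lift_end_over au.
have [w aw] := lift_end_exists (repr (a^-1%g : pi1 R x0)) ov.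
have h1 : hol 1%g u w by rewrite -(mulgV a); exact: holM au aw.
have [/(_ erefl) uw _] := hol_inj (hol1 ou) h1.
by rewrite uw.
Qed.

End Holonomy.

(** * Points of a realization *)

Section RealizationPoints.
Context (R : realType).

Definition coord (n : nat) (t : box_space R n) (k : 'I_n) : R := val t ord0 k.

Lemma coord_itv (n : nat) (t : box_space R n) k : -1 <= coord t k <= 1.
Proof. by rewrite /coord; case: t => t /=; rewrite inE. Qed.

(** Clamping makes [box_pt] total. It also lets one affine formula describe a path that runs along
    the boundary of a cube. *)
Definition box_clamp (x : R) : R := Num.max (-1) (Num.min 1 x).

Lemma box_clamp_itv x : -1 <= box_clamp x <= 1.
Proof.
by rewrite /box_clamp le_max lexx /= ge_max ge_min lexx /= andbT; lra.
Qed.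

Lemma box_clampE x : -1 <= x <= 1 -> box_clamp x = x.
Proof. by move=> /andP[x0 x1]; rewrite /box_clamp (min_idPr x1) (max_idPr x0). Qed.

Lemma box_pt_subproof n (r : 'I_n -> R) :
  (\row_k box_clamp (r k)) \in (@box R n).
Proof. by rewrite inE => k; rewrite mxE; exact: box_clamp_itv. Qed.

Definition box_pt n (r : 'I_n -> R) : box_space R n := SigSub (box_pt_subproof r).

Lemma box_ptE n (r : 'I_n -> R) k : -1 <= r k <= 1 -> coord (box_pt r) k = r k.
Proof. by move=> rk; rewrite /coord /= mxE box_clampE. Qed.

Lemma box_space_eq n (t u : box_space R n) :
  coord t =1 coord u -> t = u.
Proof. by move=> tu; apply/val_inj/rowP => k; exact: tu. Qed.

Lemma cts_box_pt (X : topologicalType) n (c : X -> 'I_n -> R) :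
  (forall k, continuous (c^~ k)) -> continuous (fun x => box_pt (c x)).
Proof.
move=> cc.
apply: (@continuous_comp_initial (box_space R n : choiceType) X 'rV[R]_n set_val) => /=.
rewrite /comp set_valE /= => x A [Q Qx QA].
have : \forall y \near x, forall k, Q ord0 k ((\row_k box_clamp (c y k) : 'rV_n) ord0 k).
  apply: filter_forall => k.
  have ck : continuous (fun y => box_clamp (c y k)).
    by apply: cts_maxr; [exact: cts_const|apply: cts_minr; [exact: cts_const|exact: cc]].
  have h : \forall y \near x, Q ord0 k (box_clamp (c y k)).
    by apply: (ck x); have := Qx ord0 k; rewrite mxE.
  by apply: filterS h => y; rewrite mxE.
move=> h; apply: filterS h => y Qy; apply: QA => i k; rewrite (ord1 i); exact: Qy.
Qed.

Lemma box_coord_near n (t : box_space R n) (e : R) : 0 < e ->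
  \forall u \near t, forall k, `|coord t k - coord u k| < e.
Proof.
move=> e0.
have cv : continuous (val : box_space R n -> 'rV[R]_n).
  by have := @initial_continuous (box_space R n : choiceType) 'rV[R]_n set_val; rewrite set_valE.
have h := cv t [set M : 'rV[R]_n | forall k, `|val t ord0 k - M ord0 k| < e]; apply: h.
exists (fun i k => [set y | `|val t i k - y| < e]) => [i k|M Me k]; last exact: Me.
by apply/nbhs_ballP; exists e.
Qed.

Context (X : cubical_set).

Definition pt n (x : X n) (t : box_space R n) : realization R X :=
  \pi_(gen_quot (@glue R X)) (cell_point x t).

Lemma pt_surj (b : realization R X) : exists n (x : X n) t, b = pt x t.
Proof.
have -> : b = \pi_(gen_quot (@glue R X)) (repr b) by rewrite reprK.
by case: (repr b) => -[n x] t; exists n, x, t.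
Qed.

Lemma pt_face n m (f : cube_hom n m) (s : {ffun 'I_n -> 'I_m}) (e : signs m)
    (x : X m) t u : injective s -> (forall a, val f a = signed_incl s e a) ->
  val u = signed_incl_real s e (val t) -> pt (face f x) t = pt x u.
Proof. by move=> sI fE uE; apply: gen_quot_rel; exists n, m, f, s, e, x, t, u. Qed.

Lemma cts_pt n (x : X n) : continuous (pt x).
Proof.
move=> t; apply: (@continuous_comp _ _ _ (@cell_point R X n x)
  (\pi_(gen_quot (@glue R X)) : _ -> realization R X)).
  exact: (@existT_continuous _ (fun c : {n & X n} => box_space R (tag c)) (existT _ n x)).
exact: (@pi_continuous _ (gen_quot (@glue R X))).
Qed.

(** The topology is the quotient of that of a disjoint union of cubes, so openness is tested in one
    cube at a time. *)
Lemma open_realization (V : set (realization R X)) :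
  (forall n (x : X n) t, V (pt x t) -> \forall u \near t, V (pt x u)) -> open V.
Proof.
move=> Vnear.
suff : open ((\pi_(gen_quot (@glue R X)) : cells_space R X -> _) @^-1` V) by [].
apply/sigT_openP => -[n x]; rewrite openE => t /= Vt; exact: Vnear.
Qed.

End RealizationPoints.

(** * Change of base point *)

Section LoopLemmas.
Context (R : realType) (T : topologicalType).

Lemma homotopic_eq (x0 : T) (p q : loop R x0) : p =1 q -> homotopic p q.
Proof.
move=> pq; have [H [cH H0 H1 Hb]] := homotopic_refl p.
by exists H; split=> // s; rewrite H1.
Qed.

Lemma clamp_realE (r : R) : 0 <= r <= 1 -> clamp_real r = r.
Proof. by move=> /andP[r0 r1]; rewrite /clamp_real (min_idPl r1) (max_idPr r0). Qed.

Lemma ext_mk_loop (x0 : T) (P : R -> T) (cP : continuous P) P0 P1 r :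
  0 <= r <= 1 -> ext (mk_loop cP P0 P1 : loop R x0) r = P r.
Proof. by move=> r01; rewrite /ext mk_loopE /= clamp_realE. Qed.

Lemma clamp_mul3 (r : R) : clamp (3 * r - 1) = clamp (clamp_real (3 * r - 1)).
Proof.
apply: val_inj => /=; rewrite [RHS]clamp_realE // /clamp_real.
by rewrite le_max lexx /= ge_max ler01 ge_min lexx orbT.
Qed.

Lemma cts_clamp_real : continuous (@clamp_real R).
Proof.
apply: cts_maxr; first exact: cts_const.
by apply: cts_minr; [exact: cts_idr|exact: cts_const].
Qed.

Lemma cts_comp2 (X : topologicalType) (P : R -> R -> T) (f g : X -> R) :
  continuous (fun z : R * R => P z.1 z.2) -> continuous f -> continuous g ->
  continuous (fun x => P (f x) (g x)).
Proof. move=> cP cf cg; exact: (cts_comp (cts_pair cf cg) cP). Qed.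

Definition concat3 (A B C : R -> R -> T) (s t : R) : T :=
  if 3 * s + 0 <= 1 then A (3 * s) t else
  if 3 * s + -1 <= 1 then B (3 * s - 1) t else C (3 * s - 2) t.

Lemma cts_concat3 (X : topologicalType) (A B C : R -> R -> T) (f g : X -> R) :
  continuous (fun z : R * R => A z.1 z.2) ->
  continuous (fun z : R * R => B z.1 z.2) ->
  continuous (fun z : R * R => C z.1 z.2) ->
  (forall t, A 1 t = B 0 t) -> (forall t, B 1 t = C 0 t) ->
  continuous f -> continuous g -> continuous (fun x => concat3 A B C (f x) (g x)).
Proof.
move=> cA cB cC AB BC cf cg; rewrite /concat3.
have c3 (P : R -> R -> T) k : continuous (fun z : R * R => P z.1 z.2) ->
    continuous (fun x => P (3 * f x + k) (g x)).
  by move=> cP; apply: cts_comp2 cP _ cg; exact: cts_affine.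
apply: cts_if.
- exact: cts_affine.
- rewrite (_ : (fun x => _) = (fun x => A (3 * f x + 0) (g x))); first exact: c3.
  by apply/funext => x; rewrite addr0.
- apply: cts_if.
  + exact: cts_affine.
  + exact: c3.
  + exact: c3.
  + by move=> x fx; rewrite fx BC; congr C; lra.
- move=> x fx; rewrite ifT; last by lra.
  rewrite (_ : 3 * f x = 1) ?AB; last by lra.
  by rewrite subrr.
Qed.

End LoopLemmas.

Section BaseChange.
Context (R : realType) (T : topologicalType).

Section Path.
Context (x y : T) (de : R -> T) (cde : continuous de) (de0 : de 0 = x) (de1 : de 1 = y).

Let D (a : R) : T := de (clamp_real a).

Let cD : continuous D.
Proof. by apply: cts_comp cde; exact: cts_clamp_real. Qed.

Let D0 : D 0 = x. Proof. by rewrite /D clamp_realE // lexx ler01. Qed.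
Let D1 : D 1 = y. Proof. by rewrite /D clamp_realE // lexx ler01. Qed.

Let c2 (f : R * R -> R) : continuous f -> continuous (fun z : R * R => D (f z)).
Proof. by move=> cf; exact: cts_comp cf cD. Qed.

Let c1 : continuous (fun z : R * R => z.1). Proof. by move=> z; exact: cvg_fst. Qed.
Let cs : continuous (fun z : R * R => z.2). Proof. by move=> z; exact: cvg_snd. Qed.

Definition conj_path (p : loop R y) (s : R) : T :=
  concat3 (fun r _ => D r) (fun r _ => ext p r) (fun r _ => D (1 - r)) s 0.

Lemma conj_path_cts p : continuous (conj_path p).
Proof.
apply: cts_concat3.
- exact: c2.
- by apply: cts_comp (@cts_ext _ _ _ p); exact: c1.
- apply: c2; apply: cts_addr; [exact: cts_const|exact: cts_oppr].
- by move=> t; rewrite D1 ext_le0.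
- by move=> t; rewrite ext_ge1 // subr0 D1.
- exact: cts_idr.
- exact: cts_const.
Qed.

Lemma conj_path0 p : conj_path p 0 = x.
Proof. by rewrite /conj_path /concat3 mulr0 addr0 ler01 D0. Qed.

Lemma conj_path1 p : conj_path p 1 = x.
Proof.
rewrite /conj_path /concat3 !ifF; try (by apply/negbTE; rewrite -ltNge; lra).
by rewrite (_ : 1 - _ = 0) //; lra.
Qed.

Definition conj_loop p : loop R x := mk_loop (@conj_path_cts p) (conj_path0 p) (conj_path1 p).

Lemma concat3_homotopy (p q : loop R x) (A B C : R -> R -> T) :
  continuous (fun z : R * R => A z.1 z.2) ->
  continuous (fun z : R * R => B z.1 z.2) ->
  continuous (fun z : R * R => C z.1 z.2) ->
  (forall t, A 1 t = B 0 t) -> (forall t, B 1 t = C 0 t) ->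
  (forall t, A 0 t = x) -> (forall t, C 1 t = x) ->
  (forall s, concat3 A B C (val s) 0 = p s) ->
  (forall s, concat3 A B C (val s) 1 = q s) -> homotopic p q.
Proof.
move=> cA cB cC AB BC A0 C1 pE qE.
exists (fun z => concat3 A B C (val z.1) (val z.2)); split.
- by apply: cts_concat3 => //; [exact: cts_vfst|exact: cts_vsnd].
- by move=> s; rewrite val0.
- by move=> s; rewrite val1.
- move=> t; rewrite val0 val1 /concat3 mulr0 addr0 ler01 A0; split=> //.
  rewrite !ifF; try (by apply/negbTE; rewrite -ltNge; lra).
  by rewrite (_ : _ - 2 = 1) //; lra.
Qed.

Lemma stretch_homotopic (z : T) (p q : loop R z) :
  (forall s, q s = ext p (3 * val s - 1)) -> homotopic p q.
Proof.
move=> qE.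
apply: (@straight_homotopic _ _ _ (ext p) id (fun u => clamp_real (3 * u + -1))) => //.
- exact: cts_ext.
- exact: cts_idr.
- by apply: cts_comp (@cts_clamp_real R); apply: cts_affine; exact: cts_idr.
- by rewrite /clamp_real (min_idPl _) ?(max_idPl _) //; lra.
- by rewrite /clamp_real (min_idPr _) ?(max_idPr _) //; lra.
- move=> r r01; have -> : ext q r = ext p (3 * r - 1).
    by rewrite {1}/ext qE /= clamp_realE.
  by rewrite /ext clamp_mul3.
Qed.

(** The base point travels along [de] during the homotopy. *)
Definition free_homotopic (p : loop R x) (q : loop R y) : Prop :=
  exists K : R -> R -> T, [/\ continuous (fun z : R * R => K z.1 z.2),
    forall s, 0 <= s <= 1 -> K s 0 = ext p s,
    forall s, 0 <= s <= 1 -> K s 1 = ext q s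
    & forall t, K 0 t = D t /\ K 1 t = D t].

Lemma conj_loop_homotopic p q : homotopic p q -> homotopic (conj_loop p) (conj_loop q).
Proof.
move=> [H [cH H0 H1 Hb]].
apply: (@concat3_homotopy _ _ (fun r _ => D r) (fun r t => H (clamp r, clamp t))
  (fun r _ => D (1 - r))).
- exact: c2.
- apply: cts_comp cH; apply: cts_pair; first by apply: cts_comp (@cts_clamp R); exact: c1.
  by apply: cts_comp (@cts_clamp R); exact: cs.
- by apply: c2; apply: cts_addr; [exact: cts_const|exact: cts_oppr].
- by move=> t; rewrite D1 (Hb (clamp t)).1.
- by move=> t; rewrite (Hb (clamp t)).2 subr0 D1.
- by [].
- by move=> _; rewrite subrr D0.
- by move=> s; rewrite mk_loopE /conj_path /concat3 !H0.
- by move=> s; rewrite mk_loopE /conj_path /concat3 !H1.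
Qed.

(** At time [t] the loop follows [de] up to [t], runs through the intermediate loop of [K] and
    returns. At time 0 the outer thirds are constant, and [stretch_homotopic] removes them. *)
Lemma free_homotopic_conj p q : free_homotopic p q -> homotopic p (conj_loop q).
Proof.
move=> [K [cK K0 K1 Kb]].
pose p3 s := concat3 (fun _ _ => x) (fun r _ => ext p r) (fun _ _ => x) s 0.
have cp3 : continuous p3.
  apply: cts_concat3; try (by move=> t; rewrite ?(ext_le0 _ (lexx 0)) ?(ext_ge1 _ (lexx 1))).
  - exact: cst_continuous.
  - by apply: cts_comp (@cts_ext _ _ _ p); exact: c1.
  - exact: cst_continuous.
  - exact: cts_const.
have p30 : p3 0 = x by rewrite /p3 /concat3 mulr0 addr0 ler01.
have p31 : p3 1 = x.
  by rewrite /p3 /concat3 !ifF //; try (by apply/negbTE; rewrite -ltNge; lra).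
apply: (@homotopic_trans _ _ _ (mk_loop cp3 p30 p31)).
  apply: stretch_homotopic => s; rewrite mk_loopE /p3 /concat3.
  case: ifP => h1; first by rewrite ext_le0 //; lra.
  by case: ifP => h2 //; rewrite ext_ge1 //; lra.
have cm (f g : R * R -> R) : continuous f -> continuous g ->
    continuous (fun z => D (f z * g z)).
  by move=> cf cg; apply: c2; exact: cts_mulr.
apply: (@concat3_homotopy _ _ (fun r t => D (clamp_real t * r)) (fun r t => K r (clamp_real t))
  (fun r t => D (clamp_real t * (1 - r)))).
- by apply: cm; [apply: cts_comp (@cts_clamp_real R); exact: cs|exact: c1].
- apply: (cts_comp2 cK) => //.
  by apply: cts_comp (@cts_clamp_real R); exact: cs.
- apply: cm; first by apply: cts_comp (@cts_clamp_real R); exact: cs.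
  by apply: cts_addr; [exact: cts_const|exact: cts_oppr].
- by move=> t; rewrite mulr1 (Kb _).1.
- by move=> t; rewrite subr0 mulr1 (Kb _).2.
- by move=> t; rewrite mulr0 D0.
- by move=> t; rewrite subrr mulr0 D0.
- move=> s; rewrite mk_loopE /p3 /concat3 clamp_realE ?lexx ?ler01 // !mul0r D0.
  case: ifP => h1 //; case: ifP => h2 //; rewrite K0 //.
  by apply/andP; split; have /andP[] := val_itv s; lra.
- move=> s; rewrite mk_loopE /conj_path /concat3 clamp_realE ?lexx ?ler01 // !mul1r.
  case: ifP => h1 //; case: ifP => h2 //; rewrite K1 //.
  by apply/andP; split; have /andP[] := val_itv s; lra.
Qed.

(** At time [t] the outer thirds keep only the part of [de] after [t]; at time 1 they are constant,
    so [q'] is [q] squeezed into the middle third. *)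
Lemma conj_free_homotopic q : exists2 q', homotopic q q' & free_homotopic (conj_loop q) q'.
Proof.
pose q3 s := concat3 (fun _ _ => y) (fun r _ => ext q r) (fun _ _ => y) s 0.
have cq3 : continuous q3.
  apply: cts_concat3; try (by move=> t; rewrite ?(ext_le0 _ (lexx 0)) ?(ext_ge1 _ (lexx 1))).
  - exact: cst_continuous.
  - by apply: cts_comp (@cts_ext _ _ _ q); exact: c1.
  - exact: cst_continuous.
  - exact: cts_const.
have q30 : q3 0 = y by rewrite /q3 /concat3 mulr0 addr0 ler01.
have q31 : q3 1 = y.
  by rewrite /q3 /concat3 !ifF //; try (by apply/negbTE; rewrite -ltNge; lra).
exists (mk_loop cq3 q30 q31).
  apply: stretch_homotopic => s; rewrite mk_loopE /q3 /concat3.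
  case: ifP => h1; first by rewrite ext_le0 //; lra.
  by case: ifP => h2 //; rewrite ext_ge1 //; lra.
have cc (f g : R * R -> R) : continuous f -> continuous g ->
    continuous (fun z => D (f z + (1 - f z) * g z)).
  move=> cf cg; apply: c2; apply: cts_addr => //; apply: cts_mulr => //.
  by apply: cts_addr; [exact: cts_const|exact: cts_oppr].
exists (concat3 (fun r t => D (clamp_real t + (1 - clamp_real t) * r)) (fun r _ => ext q r)
  (fun r t => D (clamp_real t + (1 - clamp_real t) * (1 - r)))); split.
- apply: cts_concat3 => //.
  + by apply: cc => //; apply: cts_comp (@cts_clamp_real R); exact: cs.
  + by apply: cts_comp (@cts_ext _ _ _ q); exact: c1.
  + apply: cc; first by apply: cts_comp (@cts_clamp_real R); exact: cs.
    by apply: cts_addr; [exact: cts_const|exact: cts_oppr].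
  + by move=> t; rewrite mulr1 [X in D X](_ : _ = 1) ?D1 ?ext_le0 //; ring.
  + by move=> t; rewrite subr0 mulr1 [X in D X](_ : _ = 1) ?D1 ?ext_ge1 //; ring.
- move=> s s01; rewrite ext_mk_loop // /conj_path /concat3 clamp_realE ?lexx ?ler01 //.
  by rewrite !add0r subr0 !mul1r.
- move=> s s01; rewrite ext_mk_loop // /q3 /concat3 clamp_realE ?lexx ?ler01 //.
  by rewrite subrr !mul0r !addr0 D1.
- move=> t; rewrite /concat3 mulr0 addr0 ler01 mulr0 addr0; split.
    by rewrite /D; congr de; apply: clamp_realE; rewrite /clamp_real le_max lexx /= ge_max ler01 ge_min lexx orbT.
  rewrite !ifF; try (by apply/negbTE; rewrite -ltNge; lra).
  rewrite (_ : 1 - (3 * 1 - 2) = 0); last by lra.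
  rewrite mulr0 addr0 /D; congr de; apply: clamp_realE.
  by rewrite /clamp_real le_max lexx /= ge_max ler01 ge_min lexx orbT.
Qed.

Lemma free_homotopic_concat p p' q q' : free_homotopic p q -> free_homotopic p' q' ->
  free_homotopic (concat p p') (concat q q').
Proof.
move=> [K [cK K0 K1 Kb]] [L [cL L0 L1 Lb]].
exists (fun s t => if 2 * s + 0 <= 1 then K (2 * s + 0) t else L (2 * s + -1) t); split.
- apply: cts_if.
  + exact: cts_affine.
  + apply: (cts_comp2 cK) => //; exact: cts_affine.
  + apply: (cts_comp2 cL) => //; exact: cts_affine.
  + by move=> z; rewrite addr0 => ->; rewrite subrr (Kb _).2 (Lb _).1.
- move=> s /andP[s0 s1]; rewrite ext_concat /join addr0.
  by case: ifP => h; [rewrite K0|rewrite L0] => //; apply/andP; split; lra.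
- move=> s /andP[s0 s1]; rewrite ext_concat /join addr0.
  by case: ifP => h; [rewrite K1|rewrite L1] => //; apply/andP; split; lra.
- move=> t; rewrite mulr0 addr0 ler01 (Kb t).1; split=> //.
  rewrite ifF; last by apply/negbTE; rewrite -ltNge; lra.
  by rewrite (_ : 2 * 1 + -1 = 1) ?(Lb t).2 //; lra.
Qed.

(** The detour back and forth along [de] between the two factors never has to be contracted by hand:
    each conjugated factor is freely homotopic to the factor itself, and free homotopies along one
    path concatenate. *)
Lemma conj_loop_concat p q :
  homotopic (conj_loop (concat p q)) (concat (conj_loop p) (conj_loop q)).
Proof.
have [p' pp' fp] := conj_free_homotopic p; have [q' qq' fq] := conj_free_homotopic q.
apply: (@homotopic_trans _ _ _ (conj_loop (concat p' q'))).
  by apply: conj_loop_homotopic; exact: concat_homotopic.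
by apply/homotopic_sym/free_homotopic_conj/free_homotopic_concat.
Qed.

Lemma const_free_homotopic : free_homotopic (const_loop R x) (const_loop R y).
Proof.
exists (fun _ t => D t); split=> //.
  by apply: c2.
Qed.

End Path.

(** Transport back along the reversed path [ed] recovers [p] up to homotopy. *)
Lemma base_change_injective (x y : T) (de : R -> T) (cde : continuous de)
    (de0 : de 0 = x) (de1 : de 1 = y) (p : loop R y) :
  homotopic (conj_loop cde de0 de1 p) (const_loop R x) -> homotopic p (const_loop R y).
Proof.
move=> px; pose ed (r : R) := de (-1 * r + 1).
have ced : continuous ed by apply: (cts_comp _ cde); apply: cts_affine; exact: cts_idr.
have ed0 : ed 0 = y by rewrite /ed mulr0 add0r.
have ed1 : ed 1 = x by rewrite /ed mulr1 addNr.
have rev u v : free_homotopic de u v -> free_homotopic ed v u.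
  move=> [K [cK K0 K1 Kb]]; exists (fun s t => K s (1 - clamp_real t)); split.
  - apply: (cts_comp2 cK); first by move=> z; exact: cvg_fst.
    apply: cts_addr; first exact: cts_const.
    apply: cts_oppr; apply: cts_comp (@cts_clamp_real R) => z; exact: cvg_snd.
  - by move=> s s01; rewrite clamp_realE ?lexx ?ler01 // subr0 K1.
  - by move=> s s01; rewrite clamp_realE ?lexx ?ler01 // subrr K0.
  - move=> t; have tE : de (clamp_real (1 - clamp_real t)) = ed (clamp_real t).
      have /andP[t0 t1] : 0 <= clamp_real t <= 1.
        by rewrite /clamp_real le_max lexx /= ge_max ler01 ge_min lexx orbT.
      by rewrite clamp_realE /ed; [congr de; lra|apply/andP; split; lra].
    by rewrite -tE (Kb _).1 (Kb _).2.
have [q pq /rev/(free_homotopic_conj ced ed0 ed1) qE] := conj_free_homotopic cde de0 de1 p.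
apply: (homotopic_trans pq); apply: (homotopic_trans qE).
apply: (@homotopic_trans _ _ _ (conj_loop ced ed0 ed1 (const_loop R x))).
  exact: conj_loop_homotopic.
by apply/homotopic_sym/free_homotopic_conj/const_free_homotopic.
Qed.

(** Residual finiteness passes to subgroups, and transport along [de] embeds one group into the
    other. *)
Lemma residually_finite_base_change (x y : T) (de : R -> T) : continuous de ->
  de 0 = x -> de 1 = y ->
  residually_finite (pi1 R x) -> residually_finite (pi1 R y).
Proof.
move=> cde de0 de1 rf g g1.
pose th (a : pi1 R y) : pi1 R x := \pi_(pi1 R x) (conj_loop cde de0 de1 (repr a)).
have thE p : th (\pi_(pi1 R y) p) = \pi_(pi1 R x) (conj_loop cde de0 de1 p).
  by apply: pi1P; apply: conj_loop_homotopic; exact: pi1_repr.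
have thM : {morph th : a b / (a * b)%g}.
  move=> a b; rewrite -[a]reprK -[b]reprK; move: (repr a) (repr b) => p q.
  have -> : (\pi_(pi1 R y) p * \pi_(pi1 R y) q)%g = \pi_(pi1 R y) (concat p q).
    exact: pi1_mulE.
  rewrite !thE; have -> : forall u v : loop R x, (\pi_(pi1 R x) u * \pi_(pi1 R x) v)%g
      = \pi_(pi1 R x) (concat u v) by move=> u v; exact: pi1_mulE.
  by apply: pi1P; exact: conj_loop_concat.
have /rf[gT [f fg]] : th g <> 1%g.
  move=> thg; apply: g1; rewrite -[g]reprK; apply: pi1P.
  apply: (@base_change_injective x y de cde de0 de1).
  by apply/asboolP; move/eqmodP: thg.
pose fth (a : pi1 R y) : gT := f (th a).
have fthM : {morph fth : a b / (a * b)%g} by move=> a b; rewrite /fth thM gmulfM.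
pose F : {multiplicative pi1 R y -> gT} :=
  HB.pack fth (isMultiplicative.Build _ _ fth fthM).
by exists gT, F.
Qed.

End BaseChange.

(** * Edge loops *)

Section SignedInclusionHom.
Context (n m : nat) (s : {ffun 'I_n -> 'I_m}) (e : signs m) (sI : injective s).

Lemma incl_hom_subproof : is_cube_map [ffun a => signed_incl s e a].
Proof. by apply/is_cube_mapP; exists s, e; split=> // a; rewrite ffunE. Qed.

Definition incl_hom : cube_hom n m := CubeHom incl_hom_subproof.

Lemma incl_homE a : val incl_hom a = signed_incl s e a.
Proof. by rewrite /= ffunE. Qed.

(** [signed_incl_real] on bare coordinate functions, in the form that fits [box_pt]. *)
Definition incl_coord (R : realType) (r : 'I_n -> R) (j : 'I_m) : R :=
  if [pick k | s k == j] is Some k then (-1) ^+ e j * r k else (-1) ^+ e j.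

Lemma incl_coord_im (R : realType) (r : 'I_n -> R) k :
  incl_coord r (s k) = (-1) ^+ e (s k) * r k.
Proof.
rewrite /incl_coord; case: pickP => [k' /eqP/sI -> //|/(_ k)].
by rewrite eqxx.
Qed.

Lemma incl_coord_out (R : realType) (r : 'I_n -> R) j :
  (forall k, s k != j) -> incl_coord r j = (-1) ^+ e j.
Proof. by move=> sj; rewrite /incl_coord; case: pickP => // k; rewrite (negPf (sj k)). Qed.

Lemma box_clamp_sign (R : realType) (b : bool) (x : R) :
  box_clamp ((-1) ^+ b * x) = (-1) ^+ b * box_clamp x.
Proof.
case: b; rewrite ?expr0 ?expr1 ?mul1r // !mulN1r.
have [x1|x1] := lerP x (-1).
  by rewrite {2}/box_clamp (min_idPr _) ?(max_idPl _) ?opprK /box_clamp ?(min_idPl _) ?(max_idPr _) //; lra.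
have [x2|x2] := lerP 1 x.
  by rewrite {2}/box_clamp (min_idPl _) ?(max_idPr _) /box_clamp ?(min_idPr _) ?(max_idPl _) //; lra.
by rewrite !box_clampE //; lra.
Qed.

(** Clamping commutes with signs, so the gluing relation holds also for coordinates outside the
    box. *)
Lemma pt_incl (R : realType) (X : cubical_set) (x : X m) (r : 'I_n -> R) :
  pt (face incl_hom x) (box_pt r) = pt x (box_pt (incl_coord r)).
Proof.
apply: (pt_face (s := s) (e := e)) => //; first exact: incl_homE.
apply/rowP => j; rewrite !mxE /= /incl_coord.
case: pickP => [k _|_]; first by rewrite mxE box_clamp_sign.
by rewrite -[(-1) ^+ _]mulr1 box_clamp_sign box_clampE //; lra.
Qed.

End SignedInclusionHom.

Section CornersAndFaces.

Definition corner_incl n : {ffun 'I_0 -> 'I_n} := [ffun k => widen_ord (leq0n n) k].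
Lemma corner_inj n : injective (corner_incl n). Proof. by case. Qed.
Definition corner n (a : signs n) : cube_hom 0 n := incl_hom a (@corner_inj n).

Lemma flip_inj : injective [ffun k : 'I_1 => k].
Proof. by move=> k l; rewrite !ffunE. Qed.
Definition flip : cube_hom 1 1 := incl_hom [ffun=> true] flip_inj.

Lemma flipE b k : val flip b k = ~~ b k.
Proof.
rewrite incl_homE; have := signed_incl_im [ffun=> true] b k flip_inj.
by rewrite !ffunE.
Qed.

(* The edge of the square on which the coordinate other than k has sign b. *)
Definition edge_incl (k : 'I_2) : {ffun 'I_1 -> 'I_2} := [ffun=> k].
Lemma edge_inj k : injective (edge_incl k).
Proof. by move=> i j _; rewrite (ord1 i) (ord1 j). Qed.
Definition edge (k : 'I_2) (b : bool) : cube_hom 1 2 :=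
  incl_hom [ffun j => if j == k then false else b] (@edge_inj k).

Lemma edgeE k b a j : val (edge k b) a j = if j == k then a ord0 else b.
Proof.
rewrite incl_homE; have [->|jk] := eqVneq j k.
  have := signed_incl_im [ffun j => if j == k then false else b] a ord0 (@edge_inj k).
  by rewrite !ffunE eqxx.
rewrite signed_incl_out; first by rewrite ffunE (negPf jk).
by move=> i; rewrite ffunE eq_sym.
Qed.

End CornersAndFaces.

Section EdgeLoops.
Context (R : realType) (X : cubical_set).
Hypothesis one_vertex : forall x y : X 0%N, x = y.
Context (v : X 0%N).

Definition base : realization R X := pt v (box_pt (fun _ => 0)).

Lemma pt0 (x : X 0%N) (t : box_space R 0) : pt x t = base.
Proof. by rewrite (one_vertex x v) /base; congr pt; apply: box_space_eq => -[]. Qed.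

Lemma pt_corner n (x : X n) (a : signs n) (r : 'I_n -> R) :
  (forall k, box_clamp (r k) = (-1) ^+ a k) -> pt x (box_pt r) = base.
Proof.
move=> ra; rewrite -(pt0 (face (corner a) x) (box_pt (fun _ => 0))) pt_incl.
congr pt; apply: box_space_eq => k; rewrite /coord /= !mxE ra incl_coord_out; last by case.
by rewrite -[(-1) ^+ _]mulr1 box_clamp_sign box_clampE //; lra.
Qed.

Lemma path_to_base (b : realization R X) : exists de : R -> realization R X,
  [/\ continuous de, de 0 = b & de 1 = base].
Proof.
have [n [x [t ->]]] := pt_surj b.
exists (fun s => pt x (box_pt (fun k => (1 - s) * coord t k + s))); split.
- apply: cts_comp (@cts_pt R X n x); apply: cts_box_pt => k.
  apply: cts_addr; last exact: cts_idr.
  apply: cts_mulr; last exact: cts_const.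
  by apply: cts_addr; [exact: cts_const|apply: cts_oppr; exact: cts_idr].
- congr pt; apply: box_space_eq => k; rewrite box_ptE subr0 mul1r addr0 //.
  exact: coord_itv.
- apply: (@pt_corner _ _ [ffun=> false]) => k.
  by rewrite subrr mul0r add0r ffunE box_clampE //; lra.
Qed.

(** The sign [false] is the point 1 of the interval, so the path goes from 1 down to -1. *)
Definition edge_path (x : X 1%N) (s : R) : realization R X :=
  pt x (box_pt (fun _ => 1 - 2 * s)).

Lemma edge_path_cts x : continuous (edge_path x).
Proof.
apply: cts_comp (@cts_pt R X 1 x); apply: cts_box_pt => k.
apply: cts_addr; first exact: cts_const.
by apply: cts_oppr; exact: cts_scale2.
Qed.

Lemma edge_path0 x : edge_path x 0 = base.
Proof.
by apply: (@pt_corner _ _ [ffun=> false]) => k; rewrite ffunE mulr0 subr0 box_clampE //; lra.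
Qed.

Lemma edge_path1 x : edge_path x 1 = base.
Proof.
by apply: (@pt_corner _ _ [ffun=> true]) => k; rewrite ffunE mulr1 box_clampE //; lra.
Qed.

Definition edge_loop x : loop R base :=
  mk_loop (@edge_path_cts x) (edge_path0 x) (edge_path1 x).

Definition edge_class x : pi1 R base := \pi_(pi1 R base) (edge_loop x).

Lemma edge_class_flip x : edge_class (face flip x) = (edge_class x)^-1%g.
Proof.
have -> : (edge_class x)^-1%g = \pi_(pi1 R base) (rev_loop (edge_loop x)).
  exact: pi1_invE.
apply/pi1P/homotopic_eq => s; rewrite !mk_loopE ext_mk_loop; last first.
  by have /andP[s0 s1] := val_itv s; apply/andP; split; lra.
rewrite /edge_path pt_incl; congr pt; congr box_pt; apply/funext => k.
have := incl_coord_im [ffun=> true] flip_inj (fun=> 1 - 2 * val s) k.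
by rewrite !ffunE => ->; rewrite expr1; lra.
Qed.

Lemma edge_class_square (x : X 2%N) :
  (edge_class (face (edge ord0 false) x) * edge_class (face (edge ord_max true) x) =
   edge_class (face (edge ord_max false) x) * edge_class (face (edge ord0 true) x))%g.
Proof.
have mulE p q : (\pi_(pi1 R base) p * \pi_(pi1 R base) q)%g
   = \pi_(pi1 R base) (concat p q) by exact: pi1_mulE.
rewrite !mulE; apply: pi1P.
pose F (a b : R) := pt x (box_pt (fun k => if k == ord0 then a else b)).
have edge0 b s : edge_path (face (edge ord0 b) x) s = F (1 - 2 * s) ((-1) ^+ b).
  rewrite /edge_path pt_incl; congr pt; congr box_pt; apply/funext => k.
  case: eqP => [->|/eqP k0].
    have := incl_coord_im [ffun j => if j == ord0 then false else b] (@edge_inj ord0)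
      (fun=> 1 - 2 * s) ord0.
    by rewrite !ffunE eqxx => ->; rewrite expr0 mul1r.
  rewrite incl_coord_out ?ffunE ?(negPf k0) // => j.
  by rewrite ffunE eq_sym.
have edge1 b s : edge_path (face (edge ord_max b) x) s = F ((-1) ^+ b) (1 - 2 * s).
  rewrite /edge_path pt_incl; congr pt; congr box_pt; apply/funext => k.
  have [->|km] := eqVneq k ord_max.
    have := incl_coord_im [ffun j => if j == ord_max then false else b] (@edge_inj ord_max)
      (fun=> 1 - 2 * s) ord0.
    by rewrite !ffunE eqxx => ->; rewrite expr0 mul1r.
  have -> : k == ord0 by case: k km => -[|[|]].
  rewrite incl_coord_out ?ffunE ?(negPf km) // => j.
  by rewrite ffunE eq_sym.
have Fclamp a b a' b' : box_clamp a = box_clamp a' -> box_clamp b = box_clamp b' ->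
    F a b = F a' b'.
  move=> aa bb; congr pt; apply: box_space_eq => k; rewrite /coord /= !mxE.
  by case: ifP.
have c1 y : 1 <= y -> box_clamp y = box_clamp 1.
  by move=> y1; rewrite /box_clamp (min_idPl y1) minxx.
have c2 y : y <= -1 -> box_clamp y = box_clamp (-1).
  by move=> y1; rewrite /box_clamp !(min_idPr _) ?(max_idPl _) ?maxxx //; lra.
(* A pencil of parallel lines of slope 1. After clamping, the line at time 0 runs round one corner
   of the square and the line at time 1 round the opposite corner. *)
exists (fun z => F (1 - 4 * val z.1 + 2 * val z.2) (3 - 4 * val z.1 - 2 * val z.2)); split.
- apply: cts_comp (@cts_pt R X 2 x); apply: cts_box_pt => k.
  have h1 : continuous (fun z : unit_interval R * unit_interval R => 1 - 4 * val z.1 + 2 * val z.2).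
    apply: cts_addr; last by apply: cts_mulr; [exact: cts_const|exact: cts_vsnd].
    apply: cts_addr; first exact: cts_const.
    by apply: cts_oppr; apply: cts_mulr; [exact: cts_const|exact: cts_vfst].
  have h2 : continuous (fun z : unit_interval R * unit_interval R => 3 - 4 * val z.1 - 2 * val z.2).
    apply: cts_addr; last first.
      by apply: cts_oppr; apply: cts_mulr; [exact: cts_const|exact: cts_vsnd].
    apply: cts_addr; first exact: cts_const.
    by apply: cts_oppr; apply: cts_mulr; [exact: cts_const|exact: cts_vfst].
  by case: (k == ord0).
- move=> s; rewrite val0 mk_loopE /join; have /andP[s0 s1] := val_itv s.
  case: ifP => s2; rewrite ext_mk_loop ?edge0 ?edge1; try (by apply/andP; split; lra).
    by apply: Fclamp; [congr box_clamp; lra|rewrite expr0; apply: c1; lra].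
  by apply: Fclamp; [rewrite expr1; apply: c2; lra|congr box_clamp; lra].
- move=> s; rewrite val1 mk_loopE /join; have /andP[s0 s1] := val_itv s.
  case: ifP => s2; rewrite ext_mk_loop ?edge0 ?edge1; try (by apply/andP; split; lra).
    by apply: Fclamp; [rewrite expr0; apply: c1; lra|congr box_clamp; lra].
  by apply: Fclamp; [congr box_clamp; lra|rewrite expr1; apply: c2; lra].
- move=> t; rewrite val0 val1; have /andP[t0 t1] := val_itv t; split.
    apply: (@pt_corner _ _ [ffun=> false]) => k; rewrite ffunE expr0.
    by case: ifP => _; rewrite c1 ?box_clampE //; lra.
  apply: (@pt_corner _ _ [ffun=> true]) => k; rewrite ffunE expr1.
  by case: ifP => _; rewrite c2 ?box_clampE //; lra.
Qed.

End EdgeLoops.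

(** * Parity of edge crossings *)

Section Weights.
Context (R : realType) (d : nat) (P : 'I_d -> eqType).

Definition bump_sign n (k : 'I_n) : signs n := [ffun j => j == k].

(* The i-th coordinate of the point t of a cube with vertices X a, as a measure
   of mass 1 carried by one vertex or by the two ends of an edge. *)
Definition weight n (X : signs n -> forall i, P i) (t : 'I_n -> R) i (x : P i) : R :=
  if [pick k | X (bump_sign k) i != X [ffun=> false] i] is Some k then
    (1 + t k) / 2 * (x == X [ffun=> false] i)%:R
    + (1 - t k) / 2 * (x == X (bump_sign k) i)%:R
  else (x == X [ffun=> false] i)%:R.

Lemma weight_const n (X : signs n -> forall i, P i) t i y :
  (forall a, X a i = y) -> forall x, weight X t x = (x == y)%:R.
Proof.
by move=> Xy x; rewrite /weight; case: pickP => [k|_]; rewrite !Xy ?eqxx.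
Qed.

Lemma weight_dir n (X : signs n -> forall i, P i) t i k (h : bool -> P i) :
  (forall a, X a i = h (a k)) -> forall x, weight X t x =
  (1 + t k) / 2 * (x == h false)%:R + (1 - t k) / 2 * (x == h true)%:R.
Proof.
move=> Xh x; rewrite /weight; case: pickP => [l|noX].
  rewrite !Xh !ffunE; have [->|kl] := eqVneq k l; first by [].
  by rewrite eqxx.
have := noX k; rewrite !Xh !ffunE eqxx => /negbFE/eqP ->.
by case: (x == h true); rewrite ?mulr1 ?mulr0; lra.
Qed.

Definition cubelike n (X : signs n -> forall i, P i) : Prop :=
  forall i, (exists y, forall a, X a i = y) \/
    exists k (h : bool -> P i), forall a, X a i = h (a k).

(** The measure depends on the point and not on the cube that carries it: a direction collapsed by
    the face map has coordinate 1 or -1, where all the mass sits at one end of the edge. *)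
Lemma weight_incl n m (s : {ffun 'I_n -> 'I_m}) (e : signs m) (sI : injective s)
    (X : signs m -> forall i, P i) (r : 'I_n -> R) : cubelike X ->
  forall i x, weight (fun a => X (signed_incl s e a)) r (i := i) x
    = weight X (incl_coord s e r) x.
Proof.
move=> cX i x; have [[y Xy]|[k [h Xh]]] := cX i.
  by rewrite !(@weight_const _ _ _ i y).
rewrite [RHS](weight_dir _ Xh).
have [[l lk]|nk] := pselect (exists l, s l = k).
  rewrite -lk incl_coord_im //.
  rewrite (@weight_dir _ _ _ i l (fun b => h (e k (+) b))); last first.
    by move=> a; rewrite Xh -lk signed_incl_im.
  rewrite lk; case: (e k); rewrite /= ?expr0 ?expr1 ?mul1r // mulN1r opprK.
  by rewrite addrC.
have sk l : s l != k by apply/eqP => lk; apply: nk; exists l.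
rewrite incl_coord_out // (@weight_const _ _ _ i (h (e k))); last first.
  by move=> a; rewrite Xh signed_incl_out.
case: (e k); rewrite ?expr0 ?expr1 /=.
  by case: (x == h true); case: (x == h false); rewrite /= ?mulr1n ?mulr0n; lra.
by case: (x == h true); case: (x == h false); rewrite /= ?mulr1n ?mulr0n; lra.
Qed.

Lemma weight_lip n (X : signs n -> forall i, P i) (t u : 'I_n -> R) (e : R) : 0 <= e ->
  (forall k, `|t k - u k| <= e) ->
  forall i x, `|weight X t (i := i) x - weight X u x| <= e.
Proof.
move=> e0 tu i x; rewrite /weight; case: pickP => [k _|_]; last by rewrite subrr normr0.
have := tu k; rewrite !ler_norml => /andP[h1 h2].
by case: (_ == _); case: (_ == _); rewrite ?mulr0 ?mulr1; apply/andP; split; lra.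
Qed.

Lemma weight_support n (X : signs n -> forall i, P i) (t : 'I_n -> R) i :
  (forall k, -1 <= t k <= 1) ->
  exists x y : P i, exists r : R, [/\ 1 / 2 <= r, r <= 1 &
    forall z, weight X t z = r * (z == x)%:R + (1 - r) * (z == y)%:R].
Proof.
move=> t1; rewrite /weight; case: pickP => [k _|_]; last first.
  exists (X [ffun=> false] i), (X [ffun=> false] i), 1; split=> [||z]; lra.
have /andP[tk0 tk1] := t1 k; have [t0|t0] := lerP 0 (t k).
  exists (X [ffun=> false] i), (X (bump_sign k) i), ((1 + t k) / 2).
  by split=> [||z]; lra.
exists (X (bump_sign k) i), (X [ffun=> false] i), ((1 - t k) / 2).
by split=> [||z]; lra.
Qed.

Definition wtype := forall i, P i -> R.

(** Distance less than [r] in the sup norm. The bound [r'] is uniform and leaves a margin below [r],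
    which makes balls open. *)
Definition near_weights (r : R) (w w' : wtype) : Prop :=
  exists2 r', r' < r & forall i x, `|w i x - w' i x| <= r'.

Lemma near_weights_sym r w w' : near_weights r w w' -> near_weights r w' w.
Proof. by move=> [r' r'r h]; exists r' => // i x; rewrite distrC. Qed.

Lemma near_weights_trans r1 r2 w w' w'' : near_weights r1 w w' ->
  near_weights r2 w' w'' -> near_weights (r1 + r2) w w''.
Proof.
move=> [s1 s1r h1] [s2 s2r h2]; exists (s1 + s2) => [|i x]; first exact: ltrD.
by apply: (le_trans (ler_distD (w' i x) _ _)); exact: lerD.
Qed.

Lemma near_weights_refl r w : 0 < r -> near_weights r w w.
Proof. by move=> r0; exists 0 => // i x; rewrite subrr normr0. Qed.

Lemma near_weights_lt r w w' i x : near_weights r w w' -> `|w i x - w' i x| < r.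
Proof. by move=> [r' r'r h]; exact: le_lt_trans (h i x) r'r. Qed.

End Weights.

(** * The cocycle that counts passages over an edge *)

Section Crossing.
Context (R : realType) (d : nat) (P : 'I_d -> eqType) (j : 'I_d) (e0 e1 : P j).
Hypothesis e01 : e0 != e1.
Local Notation W := (@wtype R d P).

Definition on_edge (w : W) : bool := (0 < w j e0) && (0 < w j e1).
Definition side (w : W) : bool := 1 / 2 <= w j e0.

(* Whether the coordinates of w and w' lie on different halves of the edge
   joining e0 and e1. *)
Definition crossing (w w' : W) : bool :=
  [&& on_edge w, on_edge w' & side w (+) side w'].

(** A condition on arbitrary functions [w] that is satisfied by the measures of points of cubes,
    since these live on at most two vertices. *)
Definition edge_mass (w : W) : Prop := on_edge w -> w j e0 + w j e1 = 1.

Lemma crossingC w w' : crossing w w' = crossing w' w.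
Proof. by rewrite /crossing addbC andbCA. Qed.

Lemma crossing_refl w : crossing w w = false.
Proof. by rewrite /crossing addbb !andbF. Qed.

(** Local additivity, with values in Z/2. Of two crossing weights one has mass at least 1/2 at [e0]
    and the other more than 1/2 at [e1]; a weight at distance less than 1/4 from both therefore
    charges both ends. So as soon as one crossing occurs, all three weights are on the edge, and
    there the sides simply add up. *)
Lemma crossingD w w' w'' : edge_mass w -> edge_mass w' -> edge_mass w'' ->
  near_weights (1 / 4) w w' -> near_weights (1 / 4) w w'' ->
  near_weights (1 / 4) w' w'' ->
  crossing w w' (+) crossing w w'' = crossing w' w''.
Proof.
suff key v v' v'' : edge_mass v' -> edge_mass v'' ->
    near_weights (1 / 4) v v' -> near_weights (1 / 4) v v'' ->
    crossing v' v'' -> on_edge v.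
  move=> m m' m'' n' n'' n.
  have h := key w w' w'' m' m'' n' n''.
  have h' := key w' w w'' m m'' (near_weights_sym n') n.
  have h'' := key w'' w w' m m' (near_weights_sym n'') (near_weights_sym n).
  rewrite /crossing in h h' h'' *.
  move: (on_edge w) (on_edge w') (on_edge w'') (side w) (side w') (side w'') h h' h''.
  by do 6!case=> //=; (move=> h h' h'' || idtac) => //;
    first [by have := h isT|by have := h' isT|by have := h'' isT].
move=> m' m'' n' n'' /and3P[o' o'' s].
have := m' o'; have := m'' o''.
have a0 := near_weights_lt e0 n'; have a1 := near_weights_lt e1 n'.
have b0 := near_weights_lt e0 n''; have b1 := near_weights_lt e1 n''.
move: a0 a1 b0 b1 s; rewrite /side /on_edge !ltr_norml.
move=> /andP[? ?] /andP[? ?] /andP[? ?] /andP[? ?].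
case: (lerP (1 / 2) (v' j e0)) => h1; case: (lerP (1 / 2) (v'' j e0)) => h2 //= _ s1 s2;
  by apply/andP; split; lra.
Qed.

Lemma weight_edge_mass n (X : signs n -> forall i, P i) (t : 'I_n -> R) :
  (forall k, -1 <= t k <= 1) -> edge_mass (weight X t).
Proof.
move=> t1; have [x [y [r [r1 r2 wE]]]] := weight_support X j t1.
rewrite /edge_mass /on_edge !wE.
case: (eqVneq e0 x) => [e0x|_]; case: (eqVneq e0 y) => [e0y|_];
  case: (eqVneq e1 x) => [e1x|_]; case: (eqVneq e1 y) => [e1y|_];
  try (by case/eqP: e01; congruence);
  rewrite /= ?mulr1n ?mulr0n; move=> /andP[? ?]; lra.
Qed.

End Crossing.

(** * A covering of the realization and its double cover along an edge *)

Section PairCover.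
Context (R : realType) (d : nat) (P : 'I_d -> eqType) (D : cubical_set).
Context (rep : forall n, D n -> (signs n -> forall i, P i) -> Prop).
Context (Mo : Type) (mv mvi : Mo -> forall i, P i -> P i).
Hypothesis mvK : forall q i, cancel (@mv q i) (@mvi q i).
Hypothesis mviK : forall q i, cancel (@mvi q i) (@mv q i).
Hypothesis rep_ex : forall n (z : D n), exists X, rep z X.
Hypothesis rep_cube : forall n (z : D n) X, rep z X -> cubelike X.
Hypothesis rep_face : forall n m (f : cube_hom n m) (z : D m) X,
  rep z X -> rep (face f z) (fun a => X (val f a)).
Hypothesis rep_orb : forall n (z : D n) X Y, rep z X -> rep z Y ->
  exists q, forall a i, Y a i = mv q (X a i).
Hypothesis rep_mv : forall n (z : D n) X q, rep z X ->
  rep z (fun a i => mv q (X a i)).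
(* No motion other than the identity stabilises a cell. *)
Hypothesis mv_free : forall q, (forall i, exists x : P i, mv q (mv q x) = x) ->
  forall i (x : P i), mv q x = x.

Local Notation W := (@wtype R d P).

(** Push-forward of measures, hence the inverse motion on the argument. *)
Definition mvw q (w : W) : W := fun i x => w i (mvi q x).

Lemma weight_mv n (X : signs n -> forall i, P i) q (t : 'I_n -> R) :
  weight (fun a i => mv q (X a i)) t = mvw q (weight X t).
Proof.
apply: functional_extensionality_dep => i; apply/funext => x; rewrite /mvw /weight.
have mvE (y z : P i) : (mv q y == mv q z) = (y == z) by exact: (can_eq (@mvK q i)).
have xE y : (x == mv q y) = (mvi q x == y).
  by apply/eqP/eqP => [->|<-]; rewrite ?mvK ?mviK.
rewrite (eq_pick (Q := fun k => X (bump_sign k) i != X [ffun=> false] i)); last first.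
  by move=> k; rewrite mvE.
by case: pickP => [k _|_]; rewrite !xE.
Qed.

Definition orbit_of (c : cells_space R D) : set W := [set w |
  exists2 X, rep (projT2 (projT1 c)) X & w = weight X (coord (projT2 c))].

Lemma orbit_of_glue c c' : glue c c' -> orbit_of c = orbit_of c'.
Proof.
move=> [n [m [f [s [e [x [t [u [sI fE uE -> ->]]]]]]]]].
have wE X : cubelike X -> weight (fun a => X (val f a)) (coord t) = weight X (coord u).
  move=> cX; apply: functional_extensionality_dep => i; apply/funext => y.
  rewrite (_ : (fun a => _) = (fun a => X (signed_incl s e a))); last first.
    by apply/funext => a; rewrite fE.
  rewrite weight_incl //; suff -> : incl_coord s e (coord t) = coord u by [].
  by apply/funext => k; rewrite /coord uE mxE.
apply/seteqP; split=> w [X /= rX ->]; last first.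
  exists (fun a => X (val f a)); first exact: rep_face.
  by rewrite wE //; exact: rep_cube rX.
have [Y rY] := rep_ex x.
have [q YX] := rep_orb (rep_face f rY) rX.
exists (fun a i => mv q (Y a i)); first exact: rep_mv.
rewrite -wE; last by apply: rep_cube; exact: (rep_mv q rY).
by congr weight; apply/funext => a; apply: functional_extensionality_dep => i; rewrite YX.
Qed.

(** Read off on one representative of [b]; by [orbit_of_glue] the choice does not matter. *)
Definition over (b : realization R D) : set W := orbit_of (repr b).

Lemma overE n (z : D n) t : over (pt z t) =
  [set w | exists2 X, rep z X & w = weight X (coord t)].
Proof.
have := gen_quot_ind (r := @glue R D) (f := orbit_of) orbit_of_glue
  (x := repr (pt z t)) (y := cell_point z t).
by rewrite reprK => /(_ erefl).
Qed.

Lemma over_ex b : exists w, over b w.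
Proof.
have [n [z [t ->]]] := pt_surj b; have [X rX] := rep_ex z.
by exists (weight X (coord t)); rewrite overE; exists X.
Qed.

Lemma over_mv b q w : over b w -> over b (mvw q w).
Proof.
have [n [z [t ->]]] := pt_surj b; rewrite overE => -[X rX ->].
by exists (fun a i => mv q (X a i)); [exact: rep_mv|rewrite weight_mv].
Qed.

Lemma over_orb b w w' : over b w -> over b w' -> exists q, w' = mvw q w.
Proof.
have [n [z [t ->]]] := pt_surj b; rewrite overE => -[X rX ->] [Y rY ->].
have [q YX] := rep_orb rX rY; exists q; rewrite -weight_mv.
by congr weight; apply/funext => a; apply: functional_extensionality_dep => i; rewrite YX.
Qed.

Lemma near_mvw r q w w' : near_weights r w w' -> near_weights r (mvw q w) (mvw q w').
Proof. by move=> [r' r'r h]; exists r' => // i x; exact: h. Qed.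

(** The two weights differ by a motion [q]. In each coordinate take a vertex [x] with at least half
    of the mass: [q] and its inverse send it to vertices of positive mass, of which there are at
    most two. So [q] fixes [x] or exchanges the two vertices, and in either case its square fixes
    [x], as [mv_free] asks. *)
Lemma over_near_eq b w w' : over b w -> over b w' -> near_weights (1 / 2) w w' -> w = w'.
Proof.
move=> ow ow'; have [q ->] := over_orb ow ow' => nw.
suff mv1 i (x : P i) : mv q x = x.
  by apply: functional_extensionality_dep => i; apply/funext => x; rewrite /mvw -[in RHS](mv1 i x) mvK.
apply: mv_free => {i x} i.
have [n [z [t bE]]] := pt_surj b; move: ow; rewrite bE overE => -[X rX wE].
have [|x [y [r [r1 r2 sup]]]] := weight_support X (t := coord t) i.
  by move=> k; exact: coord_itv.
have wE' v : w i v = r * (v == x)%:R + (1 - r) * (v == y)%:R by rewrite wE sup.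
have pos v : 0 < w i v -> v = x \/ v = y.
  rewrite wE'; case: eqP => [->|_]; first by left.
  by case: eqP => [->|_]; [right|rewrite !mulr0 addr0 ltxx].
have wx : 1 / 2 <= w i x.
  by rewrite wE' eqxx; case: (x == y); rewrite /= ?mulr1n ?mulr0n; lra.
have hx : mv q x = x \/ mv q x = y.
  apply: pos; have := near_weights_lt (mv q x) nw.
  by rewrite /mvw mvK ltr_norml => /andP[h1 h2]; lra.
have hix : mvi q x = x \/ mvi q x = y.
  apply: pos; have := near_weights_lt x nw.
  by rewrite /mvw ltr_norml => /andP[h1 h2]; lra.
case: hx => hx; first by exists x; rewrite !hx.
case: hix => hix; first by exists x; rewrite -{1}hix mviK -{1}hix mviK.
by exists x; rewrite hx -hix mviK.
Qed.

Definition ball_over (w0 : W) (r : R) : set (realization R D) :=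
  [set b | exists2 w, over b w & near_weights r w0 w].

Lemma open_ball_over w0 r : open (ball_over w0 r).
Proof.
apply: open_realization => n z t [w]; rewrite overE => -[X rX ->] [r' r'r h].
have e0 : 0 < (r - r') / 2 by lra.
have nt := box_coord_near t e0.
apply: filterS nt => u tu; exists (weight X (coord u)).
  by rewrite overE; exists X.
exists (r' + (r - r') / 2) => [|i x]; first lra.
apply: (le_trans (ler_distD (weight X (coord t) x) _ _)).
by apply: lerD => //; apply: weight_lip => [|k]; [exact: ltW|exact: ltW].
Qed.

Context (j : 'I_d) (e0 e1 : P j).
Hypothesis e01 : e0 != e1.

Definition over_signed (b : realization R D) (u : W * bool) : Prop := over b u.1.

(** The sign changes when the midpoint of the edge is passed, which defines the double cover dual to
    that edge. The radius is 1/4 because separating the sheets adds two distances and [over_near_eq]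
    allows a total of 1/2. *)
Definition close_signed (u v : W * bool) : Prop :=
  near_weights (1 / 4) u.1 v.1 /\ v.2 = u.2 (+) crossing e0 e1 u.1 v.1.

Lemma close_signed_sym u v : close_signed u v -> close_signed v u.
Proof.
by move=> [n e]; split; [exact: near_weights_sym|rewrite e crossingC addbK].
Qed.

Lemma close_signed_refl u : close_signed u u.
Proof. by split; [apply: near_weights_refl; lra|rewrite crossing_refl addbF]. Qed.

Lemma over_signed_inj b u v w : over_signed b u -> over_signed b v -> close_signed w u -> close_signed w v -> u = v.
Proof.
case: u v w => [u1 u2] [v1 v2] [w1 w2] ou ov [/= nu ->] [/= nv ->].
suff -> : u1 = v1 by [].
apply: (over_near_eq ou ov); rewrite (_ : 1 / 2 = 1 / 4 + 1 / 4); last by lra.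
by apply: near_weights_trans nv; exact: near_weights_sym.
Qed.

Lemma over_edge_mass b w : over b w -> edge_mass e0 e1 w.
Proof.
have [n [z [t ->]]] := pt_surj b; rewrite overE => -[X rX ->].
by apply: weight_edge_mass => // k; exact: coord_itv.
Qed.

(** In a ball of radius 1/8 any two weights are within 1/4. The prescribed [w1] may lie far from the
    centre [w0], so the chosen weights near [w0] are carried to its sheet by the motion [q]. Their
    sign is the crossing with [w1], and [crossingD] makes these signs compatible with one
    another. *)
Lemma cover_signed b : exists V, [/\ open V, V b & trivializing over_signed close_signed V].
Proof.
have [w0 ow0] := over_ex b.
exists (ball_over w0 (1 / 8)); split.
- exact: open_ball_over.
- by exists w0 => //; apply: near_weights_refl; lra.
move=> b1 [w1 s1] [w1' ow1' n1] ow1; rewrite /over_signed /= in ow1.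
have [q w1E] : exists q, w1 = mvw q w1' := over_orb ow1' ow1.
have /choice[sg sgP] b' : exists w', ball_over w0 (1 / 8) b' ->
    over b' w' /\ near_weights (1 / 8) w0 w'.
  have [[w ow nw]|nb] := pselect (ball_over w0 (1 / 8) b'); last by exists w0.
  by exists w.
have n14 x y : near_weights (1 / 8) w0 x -> near_weights (1 / 8) w0 y ->
    near_weights (1 / 4) x y.
  move=> nx ny; rewrite (_ : 1 / 4 = 1 / 8 + 1 / 8); last by lra.
  by apply: near_weights_trans ny; exact: near_weights_sym.
have n1' b' : ball_over w0 (1 / 8) b' -> near_weights (1 / 4) w1 (mvw q (sg b')).
  by move=> /sgP[_ nw]; rewrite w1E; apply: near_mvw; exact: n14.
exists (fun b' => (mvw q (sg b'), s1 (+) crossing e0 e1 w1 (mvw q (sg b')))); split.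
- have b1V : ball_over w0 (1 / 8) b1 by exists w1'.
  have [osg _] := sgP b1 b1V.
  have -> : mvw q (sg b1) = w1.
    apply/esym; apply: (over_near_eq ow1 (over_mv q osg)).
    have [r' r'r h] := n1' b1 b1V; exists r' => //; lra.
  by rewrite crossing_refl addbF.
- by move=> y /sgP[oy _]; exact: over_mv.
- move=> y z yV zV.
  have [[oy ny] [oz nz]] := (sgP y yV, sgP z zV).
  have nyz : near_weights (1 / 4) (mvw q (sg y)) (mvw q (sg z)).
    by apply: near_mvw; exact: n14.
  split=> //=; rewrite -addbA; congr (_ (+) _).
  rewrite -(crossingD (over_edge_mass ow1) (over_edge_mass (over_mv q oy))
    (over_edge_mass (over_mv q oz)) (n1' y yV) (n1' z zV) nyz).
  by rewrite addbA addbb.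
Qed.

Hypothesis one_vertex : forall x y : D 0%N, x = y.
Context (v : D 0%N).

Definition vertex_weight (x : forall i, P i) : W := fun i y => (y == x i)%:R.

Definition is_edge (x y : P j) : bool :=
  ((x == e0) && (y == e1)) || ((x == e1) && (y == e0)).

Local Notation holonomy := (@hol R (realization R D) (base R v) (W * bool) over_signed close_signed).

Let sf : signs 1 := [ffun=> false].
Let st : signs 1 := [ffun=> true].

Lemma hol_edge (z : D 1%N) X s : rep z X ->
  holonomy (edge_class R one_vertex v z)
    (vertex_weight (X sf), s) (vertex_weight (X st), s (+) is_edge (X sf j) (X st j)).
Proof.
move=> rX; apply: hol_pi.
- exact: close_signed_sym.
- exact: close_signed_refl.
- exact: over_signed_inj.
- exact: cover_signed.
pose w (r : R) : W := weight X (fun _ => 1 - 2 * r).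
have wE r i y : w r i y = (1 - r) * (y == X sf i)%:R + r * (y == X st i)%:R.
  rewrite /w (@weight_dir _ _ _ _ _ _ i ord0 (fun b => X [ffun=> b] i)).
    by congr (_ * _ + _ * _); lra.
  move=> a; suff -> : [ffun=> a ord0] = a by [].
  by apply/ffunP => k; rewrite ffunE (ord1 k).
have half1 : (1 / 2 <= 1 :> R) = true by apply/idP; lra.
have half0 : (1 / 2 <= 0 :> R) = false by apply/negbTE; rewrite -ltNge; lra.
pose E := is_edge (X sf j) (X st j).
(* The lift moves along the edge with speed one; if the edge joins [e0] and [e1], its sign jumps at
   the midpoint, where [side] changes. *)
exists (fun r => (w r, s (+) (E && (side e0 (w r) (+) side e0 (w 0))))).
have on r : on_edge e0 e1 (w r) -> E /\ 0 < r < 1.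
  rewrite /on_edge !wE /E /is_edge => /andP[].
  have ne : ~ (e0 == X sf j /\ e1 == X sf j) by move=> [/eqP h1 /eqP h2]; case/eqP: e01; congruence.
  have ne' : ~ (e0 == X st j /\ e1 == X st j) by move=> [/eqP h1 /eqP h2]; case/eqP: e01; congruence.
  rewrite !(eq_sym (X _ j)).
  case: (e0 == X sf j) ne; case: (e1 == X sf j); case: (e0 == X st j) ne'; case: (e1 == X st j) => //= ne' ne;
    rewrite ?mulr1n ?mulr0n => h1 h2; try (by case: ne); try (by case: ne'); try (exfalso; lra);
    by split=> //; apply/andP; split; lra.
have Eside : E -> (forall r, w r j e0 = 1 - r /\ w r j e1 = r) \/ (forall r, w r j e0 = r /\ w r j e1 = 1 - r).
  rewrite /E /is_edge => /orP[]/andP[/eqP h1 /eqP h2]; [left|right]=> r;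
  by rewrite !wE h1 h2 !eqxx (negPf e01) eq_sym (negPf e01) /= ?mulr1n ?mulr0n; split; lra.
have Eon r : E -> 0 < r < 1 -> on_edge e0 e1 (w r).
  by move=> /Eside[]h /andP[r0 r1]; rewrite /on_edge (h r).1 (h r).2; apply/andP; split; lra.
split.
- move=> r /andP[r0 r1]; split.
    rewrite ext_mk_loop ?r0 //= /over_signed /= overE; exists X => //.
    by congr weight; apply/funext => k; rewrite box_ptE //; apply/andP; split; lra.
  exists (1 / 8) => [|r' /andP[r'0 r'1]]; first lra.
  rewrite ltr_norml => /andP[d1 d2]; split=> /=.
    exists (1 / 8); first lra.
    move=> i y; rewrite !wE; case: (_ == _); case: (_ == _); rewrite /= ?mulr1n ?mulr0n ler_norml;
    by apply/andP; split; lra.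
  rewrite -addbA; congr (_ (+) _); rewrite /crossing.
  case: (boolP E) => [e|ne] /=; last first.
    have /negPf -> : ~~ on_edge e0 e1 (w r) by apply: contra ne => /on[].
    by [].
  case: (boolP (side e0 (w r) (+) side e0 (w r'))) => [sd|/negPf sd]; last first.
    rewrite !andbF; move: sd.
    by case: (side e0 (w r)); case: (side e0 (w r')); case: (side e0 (w 0)).
  have [ra ra'] : 0 < r < 1 /\ 0 < r' < 1.
    move: sd; rewrite /side.
    have [h|h] := Eside e; rewrite !(h _).1.
      case: (lerP (1 / 2) (1 - r)) => h1; case: (lerP (1 / 2) (1 - r')) => h2 //= _;
      by split; apply/andP; split; lra.
    case: (lerP (1 / 2) r) => h1; case: (lerP (1 / 2) r') => h2 //= _;
    by split; apply/andP; split; lra.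
  rewrite !Eon //= ?andbT; move: sd.
  by case: (side e0 (w r)); case: (side e0 (w r')); case: (side e0 (w 0)).
- congr pair; last by rewrite addbb andbF addbF.
  apply: functional_extensionality_dep => i; apply/funext => y.
  by rewrite wE subr0 mul1r mul0r addr0.
- congr pair.
    apply: functional_extensionality_dep => i; apply/funext => y.
    by rewrite wE subrr mul0r mul1r add0r.
  congr (_ (+) _); rewrite -/E; case: (boolP E) => //= e; rewrite /side.
  have [h|h] := Eside e; rewrite !(h _).1 ?subr0 ?subrr.
    by rewrite half1 half0.
  by rewrite half1 half0.
Qed.

End PairCover.

(** * Cells of the double *)

Section DoubleCells.
Context (F : finFieldType) (c : F) (S : {set option F}).
Context (Kv : forall i : 'I_#|S0 S|, completion (place i)).
Context (phi : forall i, local_quat (Kv i) c -> 'M[Kv i]_2).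
Context (p : forall i, bt_tree (Kv i) -> bool).
Context (p_edge : forall i, edge_map (@p i)).
Local Notation U := (global_unit c S).
Local Notation T i := (bt_tree (Kv i)).
Context (act : U -> forall i, T i -> T i).

Definition in_Gamma (u : U) : Prop := Gamma c S (lclass u).

Hypothesis actE : forall u i (x y : T i), tree_act phi u x y <-> y = act u x.
Hypothesis act1 : forall i (x : T i), act 1%g x = x.
Hypothesis actM : forall u v i (x : T i), act (u * v)%g x = act u (act v x).
Hypothesis act_lclass : forall u v i (x : T i), lclass u = lclass v -> act u x = act v x.
Hypothesis act_adj : forall u i (x y : T i), adj x y -> adj (act u x) (act u y).
Hypothesis act_type : forall u i, in_Gamma u ->
  exists s, forall x : T i, p (act u x) = p x (+) s.

Lemma lclassM (u v : U) : lclass (u * v)%g = (lclass u * lclass v)%g.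
Proof. by rewrite -lambda_mulE. Qed.

Lemma lclassV (u : U) : lclass u^-1%g = (lclass u)^-1%g.
Proof. by rewrite -lambda_invE. Qed.

Lemma in_Gamma1 : in_Gamma 1%g.
Proof. by move=> H H1 _ _ _; exact: H1. Qed.

Lemma in_GammaM u v : in_Gamma u -> in_Gamma v -> in_Gamma (u * v)%g.
Proof.
move=> Gu Gv H H1 HM HV AH; rewrite lclassM.
by apply: (HM); [exact: Gu|exact: Gv].
Qed.

Lemma in_GammaV u : in_Gamma u -> in_Gamma u^-1%g.
Proof. by move=> Gu H H1 HM HV AH; rewrite lclassV; apply: (HV); exact: Gu. Qed.

Lemma actVK u i (x : T i) : act u^-1%g (act u x) = x.
Proof. by rewrite -actM mulVg act1. Qed.

Lemma actKV u i (x : T i) : act u (act u^-1%g x) = x.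
Proof. by rewrite -actM mulgV act1. Qed.

Definition type_preserving (u : U) : Prop := forall i (x : T i), p (act u x) = p x.

Lemma Gamma0P u : Gamma0 phi p (lclass u) <-> in_Gamma u /\ type_preserving u.
Proof.
split=> [[Gu up]|[Gu up]]; split=> //.
  by move=> i x; apply: (up u erefl i); apply/actE.
by move=> v vu i x y /actE ->; rewrite (act_lclass x vu) up.
Qed.

Lemma cube_actE u n (x y : tree_product Kv n) :
  cube_act phi u x y <-> forall a i, sval y a i = act u (sval x a i).
Proof. by split=> h a i; apply/actE/h. Qed.

Lemma cube_image_subproof u n (x : tree_product Kv n) :
  is_param_cube (fun a i => act u (sval x a i)).
Proof.
have [s [sI xe xc]] := svalP x; exists s; split=> //.
- move=> k; have [y [z [yz xE]]] := xe k.
  exists (act u y), (act u z); split; first exact: act_adj.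
  by move=> a; rewrite xE; case: (a k).
- by move=> i si; have [y yE] := xc i si; exists (act u y) => a; rewrite yE.
Qed.

Definition cube_image u n (x : tree_product Kv n) : tree_product Kv n :=
  exist _ _ (cube_image_subproof u x).

Definition same_type (u v : U) : Prop :=
  forall i (x : T i), p (act u x) = p (act v x).

(** The fibre product of [Gamma] with itself over the group of types. Dividing pairs of cubes of
    equal type by this group in one step amounts to dividing by [Gamma0] in each factor and then by
    the diagonal. *)
Definition motion : Type :=
  {uv : U * U | [/\ in_Gamma uv.1, in_Gamma uv.2 & same_type uv.1 uv.2]}.

Lemma same_typeP u v : in_Gamma u -> in_Gamma v ->
  same_type u v <-> type_preserving (u^-1 * v)%g.
Proof.
move=> Gu Gv; split=> [uv i x|uv i x].
  have [s sE] := act_type i (in_GammaV Gu); have [s' s'E] := act_type i Gu.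
  have ss : s = s'.
    have := sE (act u x); rewrite actVK s'E => /esym.
    by case: (p x) s s' {sE s'E} => -[] [].
  rewrite actM sE -uv s'E ss -addbA addbb addbF; by [].
by have [s sE] := act_type i Gu; rewrite -[act v x](actKV u) !sE -[act u^-1%g _]actM uv.
Qed.

Lemma same_typeV u v : in_Gamma u -> in_Gamma v -> same_type u v -> same_type u^-1%g v^-1%g.
Proof.
move=> Gu Gv uv.
move=> i t; have [s sE] := act_type i Gu.
have [s' s'E] := act_type i (in_GammaV Gv).
have := uv i (act v^-1%g t); rewrite actKV sE s'E => e.
have [s'' s''E] := act_type i (in_GammaV Gu).
have := s''E (act u t); rewrite actVK sE s''E => e2.
by move: e e2; case: (p t) s s' s'' {sE s'E s''E} => -[] [] [].
Qed.

Definition rep_pair n (z : cube_double phi p_edge n) (x x' : tree_product Kv n) : Prop :=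
  exists zz : fprod (Y_S_type phi p_edge) (Y_S_type phi p_edge) n,
  [/\ z = \pi_(gen_quot (@diagonal_orbit F c S Kv phi p p_edge n)) zz,
      (val zz).1 = \pi_(gen_quot (@Gamma0_orbit F c S Kv phi p n)) x
    & (val zz).2 = \pi_(gen_quot (@Gamma0_orbit F c S Kv phi p n)) x'].

Definition same_types n (x x' : tree_product Kv n) : Prop :=
  forall a i, p (sval x a i) = p (sval x' a i).

Lemma product_map_same n (x x' : tree_product Kv n) :
  product_map p_edge n x = product_map p_edge n x' <-> same_types x x'.
Proof.
split=> [xx a i|xx].
  have /(congr1 (fun f : cube_hom n _ => val f a i)) := xx.
  by rewrite /= !ffunE.
by apply: cube_hom_eq => a; rewrite /= !ffunE; apply/ffunP => i; rewrite !ffunE xx.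
Qed.

Lemma Y_S_type_pi n (x : tree_product Kv n) :
  Y_S_type phi p_edge n (\pi_(gen_quot (@Gamma0_orbit F c S Kv phi p n)) x)
  = product_map p_edge n x.
Proof. exact: (cquot_lift_pi (@Gamma0_type F c S Kv phi p p_edge)). Qed.

Lemma rep_pair_type n (z : cube_double phi p_edge n) x x' :
  rep_pair z x x' -> same_types x x'.
Proof.
move=> [zz [_ zx zx']]; apply/product_map_same.
have /eqP := valP zz; rewrite zx zx'.
by rewrite (Y_S_type_pi x) (Y_S_type_pi x').
Qed.

Lemma rep_pair_mk n (x x' : tree_product Kv n) : same_types x x' ->
  exists z : cube_double phi p_edge n, rep_pair z x x'.
Proof.
move=> /product_map_same xx.
have h : Y_S_type phi p_edge n (\pi_(gen_quot (@Gamma0_orbit F c S Kv phi p n)) x)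
  == Y_S_type phi p_edge n (\pi_(gen_quot (@Gamma0_orbit F c S Kv phi p n)) x').
  by apply/eqP; rewrite (Y_S_type_pi x) (Y_S_type_pi x').
pose zz : fprod (Y_S_type phi p_edge) (Y_S_type phi p_edge) n := exist _ (_, _) h.
by exists (\pi_(gen_quot (@diagonal_orbit F c S Kv phi p p_edge n)) zz), zz.
Qed.

Lemma rep_pair_ex n (z : cube_double phi p_edge n) : exists x x', rep_pair z x x'.
Proof.
exists (repr (val (repr z)).1), (repr (val (repr z)).2), (repr z).
by rewrite !reprK.
Qed.

Lemma rep_pair_uniq n (z z' : cube_double phi p_edge n) x x' :
  rep_pair z x x' -> rep_pair z' x x' -> z = z'.
Proof.
move=> [zz [-> zx zx']] [yy [-> yx yx']]; congr (\pi_ _ _); apply: val_inj.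
by move: zx zx' yx yx'; case: (val zz) (val yy) => [? ?] [? ?] /= -> -> -> ->.
Qed.

Lemma rep_pair_face n m (f : cube_hom n m) (z : cube_double phi p_edge m) x x' :
  rep_pair z x x' -> rep_pair (face f z) (face f x) (face f x').
Proof.
move=> [zz [-> zx zx']]; exists (face f zz); split.
- exact: (cquot_face_pi (@diagonal_orbit_face F c S Kv phi p p_edge)).
- by rewrite /= zx; exact: (cquot_face_pi (@Gamma0_orbit_face F c S Kv phi p)).
- by rewrite /= zx'; exact: (cquot_face_pi (@Gamma0_orbit_face F c S Kv phi p)).
Qed.

Lemma Gamma0_orbitP n (x y : tree_product Kv n) :
  \pi_(gen_quot (@Gamma0_orbit F c S Kv phi p n)) x =
  \pi_(gen_quot (@Gamma0_orbit F c S Kv phi p n)) y <->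
  exists u, [/\ in_Gamma u, type_preserving u & forall a i, sval y a i = act u (sval x a i)].
Proof.
split=> [/gen_quotP|[u [Gu up xy]]]; last first.
  by apply: gen_quot_rel; exists u; [exact/Gamma0P|exact/cube_actE].
elim=> {x y} [x y [u /Gamma0P[Gu up] /cube_actE xy]|x|x y _ [u [Gu up xy]]|x y z _ [u [Gu up xy]] _ [v [Gv vp yz]]].
- by exists u.
- by exists 1%g; split=> [|i y|a i]; rewrite ?act1 //; exact: in_Gamma1.
- exists u^-1%g; split=> [|i z|a i]; first exact: in_GammaV.
    by rewrite -{2}(actKV u z) up.
  by rewrite xy actVK.
- exists (v * u)%g; split=> [|i w|a i]; first exact: in_GammaM.
    by rewrite actM vp up.
  by rewrite actM yz xy.
Qed.

(** Induction on the generated equivalence. A diagonal step by [u] is surrounded by independent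
    elements of [Gamma0] in the two factors, which do not change types, so both products have the
    type of [u]. *)
Lemma rep_pair_orb n (z : cube_double phi p_edge n) x x' y y' :
  rep_pair z x x' -> rep_pair z y y' -> exists q : motion,
  forall a i, sval y a i = act (sval q).1 (sval x a i) /\
    sval y' a i = act (sval q).2 (sval x' a i).
Proof.
move=> [zz [-> zx zx']] [yy [/gen_quotP zy yx yx']].
pose lk n (zz : fprod (Y_S_type phi p_edge) (Y_S_type phi p_edge) n) x x' :=
  (val zz).1 = \pi_(gen_quot (@Gamma0_orbit F c S Kv phi p n)) x /\
  (val zz).2 = \pi_(gen_quot (@Gamma0_orbit F c S Kv phi p n)) x'.
suff key : forall x x' y y', lk n zz x x' -> lk n yy y y' -> exists q : motion,
    forall a i, sval y a i = act (sval q).1 (sval x a i) /\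
    sval y' a i = act (sval q).2 (sval x' a i) by exact: key.
move: x x' y y' zx zx' yx yx' => _ _ _ _ _ _ _ _.
elim: zy => {zz yy} [z1 z2 [u [Gu u1 u2]]|z1|z1 z2 _ IH|z1 z2 z3 _ IH1 _ IH2] x x' y y' [x1 x1'] [y1 y1'].
- have [w [w' [/cube_actE ww' wE w'E]]] := u1.
  have [v [v' [/cube_actE vv' vE v'E]]] := u2.
  have /Gamma0_orbitP[g1 [G1 t1 e1]] := etrans (esym x1) wE.
  have /Gamma0_orbitP[g2 [G2 t2 e2]] := etrans (esym w'E) y1.
  have /Gamma0_orbitP[h1 [H1 s1 f1]] := etrans (esym x1') vE.
  have /Gamma0_orbitP[h2 [H2 s2 f2]] := etrans (esym v'E) y1'.
  unshelve eexists (exist _ (g2 * (u * g1), h2 * (u * h1))%g _).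
    split=> /=; [by do ?apply: in_GammaM..|] => i t.
    rewrite !actM t2 s2; have [s sE] := act_type i Gu.
    by rewrite !sE t1 s1.
  by move=> a i /=; rewrite !actM e2 ww' e1 f2 vv' f1.
- have /Gamma0_orbitP[g [G t e]] := etrans (esym x1) y1.
  have /Gamma0_orbitP[h [H s f]] := etrans (esym x1') y1'.
  unshelve eexists (exist _ (g, h) _); first by split=> //= i w; rewrite t s.
  by move=> a i /=; rewrite e f.
- have [[[u v] /= [Gu Gv uv]] /= h] := IH y y' x x' (conj y1 y1') (conj x1 x1').
  unshelve eexists (exist _ (u^-1, v^-1)%g _).
    by split=> /=; [exact: in_GammaV..|exact: same_typeV].
  by move=> a i /=; have [-> ->] := h a i; rewrite !actVK.
- pose w := repr (val z2).1; pose w' := repr (val z2).2.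
  have ww : lk n z2 w w' by split; rewrite reprK.
  have [[[u v] /= [Gu Gv uv]] /= h] := IH1 x x' w w' (conj x1 x1') ww.
  have [[[u2 v2] /= [Gu2 Gv2 uv2]] /= h2] := IH2 w w' y y' ww (conj y1 y1').
  unshelve eexists (exist _ (u2 * u, v2 * v)%g _).
    split=> /=; [exact: in_GammaM..|] => i t.
    rewrite !actM uv2; have [s sE] := act_type i Gv2.
    by rewrite !sE uv.
  by move=> a i /=; have [-> ->] := h2 a i; have [-> ->] := h a i; rewrite !actM.
Qed.

(** The motion [(u, v)] is the element [u^-1 * v] of [Gamma0] on the second cube followed by the
    diagonal action of [u]. *)
Lemma rep_pair_mv n (z : cube_double phi p_edge n) x x' y y' (q : motion) :
  rep_pair z x x' ->
  (forall a i, sval y a i = act (sval q).1 (sval x a i)) ->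
  (forall a i, sval y' a i = act (sval q).2 (sval x' a i)) -> rep_pair z y y'.
Proof.
case: q => [[u v] /= [Gu Gv uv]] zxx yx yx'.
have yy : same_types y y'.
  move=> a i; rewrite yx yx' -uv; have [s sE] := act_type i Gu.
  by rewrite !sE (rep_pair_type zxx).
have [z' [zz' [z'E z'y z'y']]] := rep_pair_mk yy.
suff -> : z = z' by exists zz'.
move: zxx => [zz [-> zx zx']]; rewrite z'E.
apply: gen_quot_rel; exists u; split=> //.
  by exists x, y; split=> //; exact/cube_actE.
pose w := cube_image (u^-1 * v)%g x'.
exists w, y'; split.
- by apply/cube_actE => a i; rewrite yx' /= actM actKV.
- rewrite zx'; apply/Gamma0_orbitP; exists (u^-1 * v)%g; split=> //.
    by apply: in_GammaM => //; exact: in_GammaV.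
  exact/same_typeP.
- exact: z'y'.
Qed.

Local Notation PP := (fun i => (T i * T i)%type : eqType).

Definition double_rep n (z : cube_double phi p_edge n) (X : signs n -> forall i, PP i) : Prop :=
  exists x x', rep_pair z x x' /\ forall a i, X a i = (sval x a i, sval x' a i).

Definition pair_mv (q : motion) i (x : PP i) : PP i :=
  (act (sval q).1 x.1, act (sval q).2 x.2).

Definition pair_mvi (q : motion) i (x : PP i) : PP i :=
  (act (sval q).1^-1%g x.1, act (sval q).2^-1%g x.2).

Lemma pair_mvK q i : cancel (@pair_mv q i) (@pair_mvi q i).
Proof. by case=> x y; rewrite /pair_mv /pair_mvi /= !actVK. Qed.

Lemma pair_mviK q i : cancel (@pair_mvi q i) (@pair_mv q i).
Proof. by case=> x y; rewrite /pair_mv /pair_mvi /= !actKV. Qed.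

Lemma double_rep_ex n (z : cube_double phi p_edge n) : exists X, double_rep z X.
Proof.
have [x [x' xx]] := rep_pair_ex z.
by exists (fun a i => (sval x a i, sval x' a i)), x, x'.
Qed.

Lemma double_rep_face n m (f : cube_hom n m) (z : cube_double phi p_edge m) X :
  double_rep z X -> double_rep (face f z) (fun a => X (val f a)).
Proof.
move=> [x [x' [zx XE]]]; exists (face f x), (face f x'); split.
  exact: rep_pair_face.
by move=> a i; rewrite XE.
Qed.

Lemma double_rep_orb n (z : cube_double phi p_edge n) X Y :
  double_rep z X -> double_rep z Y ->
  exists q : motion, forall a i, Y a i = pair_mv q (X a i).
Proof.
move=> [x [x' [zx XE]]] [y [y' [zy YE]]].
have [q qE] := rep_pair_orb zx zy; exists q => a i.
by rewrite YE XE /pair_mv /=; have [-> ->] := qE a i.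
Qed.

Lemma double_rep_mv n (z : cube_double phi p_edge n) X (q : motion) :
  double_rep z X -> double_rep z (fun a i => pair_mv q (X a i)).
Proof.
move=> [x [x' [zx XE]]].
exists (cube_image (sval q).1 x), (cube_image (sval q).2 x'); split.
  exact: (rep_pair_mv (q := q) zx).
by move=> a i; rewrite XE.
Qed.

(** Types alternate along edges, so two cubes of equal type move their i-th coordinates along the
    same parameter, or both leave it fixed. *)
Lemma double_rep_cube n (z : cube_double phi p_edge n) X : double_rep z X -> cubelike X.
Proof.
move=> [x [x' [zx XE]]] i; have xx := rep_pair_type zx.
have [s [sI xe xc]] := svalP x; have [s' [s'I xe' xc']] := svalP x'.
have dir (y : tree_product Kv n) k (w w' : T i) :
    adj w w' -> (forall a, sval y a i = if a k then w' else w) ->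
    forall a, p (sval y a i) = p w (+) a k.
  by move=> ww yE a; rewrite yE; case: (a k); rewrite ?(p_edge ww) ?addbT ?addbF.
have [[k ki]|nk] := pselect (exists k, s k = i); last first.
  have [w wE] : exists w, forall a, sval x a i = w.
    by apply: xc => k ki; apply: nk; exists k.
  have [[k' ki']|nk'] := pselect (exists k, s' k = i); last first.
    have [w' w'E] : exists w, forall a, sval x' a i = w.
      by apply: xc' => k ki; apply: nk'; exists k.
    by left; exists (w, w') => a; rewrite XE wE w'E.
  exfalso; have := xe' k'; rewrite ki' => -[y [y' [yy yE]]].
  have h := dir x' k' y y' yy yE.
  have := xx [ffun=> true] i; have := xx [ffun=> false] i.
  by rewrite !h !wE !ffunE addbT addbF => -> /esym; case: (p y).
right; have := xe k; rewrite ki => -[y [y' [yy yE]]].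
have [[k' ki']|nk'] := pselect (exists k, s' k = i); last first.
  have [w' w'E] : exists w, forall a, sval x' a i = w.
    by apply: xc' => k1 ki1; apply: nk'; exists k1.
  exfalso; have h := dir x k y y' yy yE.
  have := xx [ffun=> true] i; have := xx [ffun=> false] i.
  by rewrite !h !w'E !ffunE addbT addbF => -> ; case: (p w').
have := xe' k'; rewrite ki' => -[w [w' [ww wE]]].
have kk : k = k'.
  have h := dir x k y y' yy yE; have h' := dir x' k' w w' ww wE.
  have := xx [ffun=> false] i; have := xx [ffun j => j == k] i.
  rewrite !h !h' !ffunE eqxx addbT !addbF => + e; rewrite e.
  by case: eqP => [->//|_]; rewrite addbF; case: (p w).
subst k'; exists k, (fun b => if b then (y', w') else (y, w)) => a.
by rewrite XE yE wE; case: (a k).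
Qed.

Hypothesis act_free : forall u, in_Gamma u ->
  (forall i, exists x : T i, act u (act u x) = x) -> forall i (x : T i), act u x = x.

Lemma pair_mv_free (q : motion) :
  (forall i, exists x : PP i, pair_mv q (pair_mv q x) = x) ->
  forall i (x : PP i), pair_mv q x = x.
Proof.
case: q => [[u v] [Gu Gv uv]] /= qf i [x y].
rewrite /pair_mv /=; congr (_, _).
  by apply: act_free => // k; have [[w w'] [e _]] := qf k; exists w.
by apply: act_free => // k; have [[w w'] [_ e]] := qf k; exists w'.
Qed.

Context (star : forall i, T i).
Hypothesis act_trans : forall x : forall i, T i,
  exists2 u, in_Gamma u & forall i, x i = act u (star i).

(** Elements of [Gamma] that carry the stars to two vertices of equal type have equal type
    themselves, hence form a motion. *)
Lemma double_one_vertex (z z' : cube_double phi p_edge 0) : z = z'.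
Proof.
have const0 : is_param_cube (fun _ : signs 0 => star).
  exists (fun k : 'I_0 => False_rect _ (notF (ltn_ord k))).
  by split=> [[]//|[]//|i _]; exists (star i).
pose st : tree_product Kv 0 := exist _ _ const0.
suff key (y : cube_double phi p_edge 0) : rep_pair y st st.
  exact: rep_pair_uniq (key z) (key z').
have [x [x' yx]] := rep_pair_ex y.
have a0E (a : signs 0) : a = [ffun=> false] by apply/ffunP => -[].
have [u Gu uE] := act_trans (sval x [ffun=> false]).
have [v Gv vE] := act_trans (sval x' [ffun=> false]).
have uv : same_type u v.
  move=> i t; have [s sE] := act_type i Gu; have [s' s'E] := act_type i Gv.
  have := rep_pair_type yx [ffun=> false] i; rewrite uE vE !sE !s'E.
  by case: (p t); case: (p (star i)) s s' {sE s'E} => -[] [].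
have Gu' := in_GammaV Gu; have Gv' := in_GammaV Gv.
have uv' := same_typeV Gu Gv uv.
apply: (rep_pair_mv (q := exist _ (u^-1, v^-1)%g (And3 Gu' Gv' uv')) yx) => a i /=.
  by rewrite (a0E a) uE actVK.
by rewrite (a0E a) vE actVK.
Qed.

End DoubleCells.

(** * Valuations and residues *)

Lemma fraction_split (A : idomainType) (k : {fraction A}) :
  exists a b : A, b != 0 /\ k = tofrac a / tofrac b.
Proof.
elim/quotW: k => x; exists (frac x).1, (frac x).2; split; first exact: denom_ratioP.
have d0 : tofrac (frac x).2 != 0 :> {fraction A} by rewrite tofrac_eq0 denom_ratioP.
apply: (mulIf d0); rewrite divfK //.
have mE : forall u v : {fraction A}, u * v = FracField.mul u v by [].
rewrite mE -[FracField.tofrac _]/(FracField.tofrac _) !piE; apply/eqmodP.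
rewrite /= FracField.equivfE /FracField.mulf !numden_Ratio ?mulf_neq0 ?oner_eq0 ?denom_ratioP //.
by rewrite !mulr1 mulrC.
Qed.

Section Valuation.
Context (F : finFieldType) (tau : F) (Kv : completion tau).
Local Notation O := (@val_ge Kv (@cval _ _ Kv) 0).
Local Notation m := (@val_ge Kv (@cval _ _ Kv) 1).
Local Notation v := (@cval _ _ Kv).
Implicit Types x y : Kv.

Definition cconst (a : F) : Kv := cemb Kv (kconst a).

Lemma val_one : v 1 = 0.
Proof.
have := cvalM (oner_neq0 Kv) (oner_neq0 Kv); rewrite mulr1 => e.
by apply: (addrI (v 1)); rewrite -e addr0.
Qed.

Lemma val_opp1 : v (-1) = 0.
Proof.
have n1 : (-1 : Kv) != 0 by rewrite oppr_eq0 oner_neq0.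
have := cvalM n1 n1; rewrite mulrNN mulr1 val_one => e.
by lia.
Qed.

Lemma valV x : x != 0 -> v x^-1 = - v x.
Proof.
move=> x0; have xV0 : x^-1 != 0 by rewrite invr_eq0.
have := cvalM x0 xV0; rewrite mulfV // val_one => e.
by apply/eqP; rewrite -addr_eq0 addrC -e.
Qed.

Lemma val_geM a b x y : val_ge v a x -> val_ge v b y -> val_ge v (a + b) (x * y).
Proof.
move=> [->|ax]; first by left; rewrite mul0r.
move=> [->|bY]; first by left; rewrite mulr0.
have [->|x0] := eqVneq x 0; first by left; rewrite mul0r.
have [->|y0] := eqVneq y 0; first by left; rewrite mulr0.
by right; rewrite cvalM // lerD.
Qed.

Lemma val_geN a x : val_ge v a x -> val_ge v a (- x).
Proof.
move=> ax; rewrite -mulN1r -[a]add0r; apply: val_geM => //.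
by right; rewrite val_opp1.
Qed.

Lemma val_geB a x y : val_ge v a x -> val_ge v a y -> val_ge v a (x - y).
Proof. by move=> ax ay; apply: cvalD => //; exact: val_geN. Qed.

Lemma val_ge0 a : val_ge v a 0. Proof. by left. Qed.

Lemma val_ge_le a b x : a <= b -> val_ge v b x -> val_ge v a x.
Proof. by move=> ab [->|bx]; [left|right; exact: le_trans bx]. Qed.

Lemma int1 : O 1. Proof. by right; rewrite val_one. Qed.

Lemma intM x y : O x -> O y -> O (x * y).
Proof. by move=> Ox Oy; have := val_geM Ox Oy; rewrite addr0. Qed.

Lemma maxMl x y : m x -> O y -> m (x * y).
Proof. by move=> mx Oy; have := val_geM mx Oy; rewrite addr0. Qed.

Lemma maxMr x y : O x -> m y -> m (x * y).
Proof. by move=> Ox my; rewrite mulrC; exact: maxMl. Qed.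

Lemma max_int x : m x -> O x. Proof. exact: val_ge_le. Qed.

Lemma val_ge_all x : (forall n : nat, val_ge v n%:Z x) -> x = 0.
Proof.
move=> xn; have [->//|x0] := eqVneq x 0.
have [//|h] := xn `|v x|.+1.
by exfalso; lia.
Qed.

Lemma unit_intV x : O x -> ~ m x -> x != 0 /\ O x^-1.
Proof.
move=> [->|x0] nmx; first by case: nmx; left.
have xn0 : x != 0 by apply/eqP => x00; apply: nmx; left.
split=> //; right; rewrite valV //.
by have [h|h] := lerP 1 (v x); [case: nmx; right|lia].
Qed.

Lemma not_max_mul1 x y : O x -> x * y = 1 -> O y -> ~ m x.
Proof.
move=> Ox xy Oy mx; have := maxMl mx Oy; rewrite xy => -[/eqP|].
  by rewrite oner_eq0.
by rewrite val_one.
Qed.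

Lemma val_tofrac (a : {poly F}) : a != 0 -> v (cemb Kv (tofrac a)) = (mup tau a)%:Z.
Proof. exact: cval_emb. Qed.

Lemma int_tofrac (a : {poly F}) : O (cemb Kv (tofrac a)).
Proof.
have [->|a0] := eqVneq a 0; first by left; rewrite tofrac0 rmorph0.
by right; rewrite val_tofrac.
Qed.

Lemma max_tofrac (a : {poly F}) : m (cemb Kv (tofrac a)) <-> root a tau.
Proof.
have [->|a0] := eqVneq a 0.
  by split=> [_|_]; [rewrite root0|left; rewrite tofrac0 rmorph0].
split=> [[/eqP|]|ra].
- by rewrite fmorph_eq0 tofrac_eq0 (negPf a0).
- by rewrite val_tofrac // -dvdp_XsubCl XsubC_dvd.
- by right; rewrite val_tofrac // lez_nat -XsubC_dvd // dvdp_XsubCl.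
Qed.

Lemma int_cconst a : O (cconst a). Proof. exact: int_tofrac. Qed.

Lemma max_cconst a : m (cconst a) <-> a = 0.
Proof. by rewrite /cconst /kconst max_tofrac /root hornerC; split=> [/eqP|->]. Qed.

Local Notation pi := (uniformizer Kv).

Lemma val_uniformizer : v pi = 1.
Proof.
rewrite val_tofrac ?polyXsubC_eq0 //; have := mup_XsubCX 1 tau tau.
by rewrite expr1 eqxx => ->.
Qed.

Lemma max_divP x : m x -> O (x / pi).
Proof.
move=> mx; rewrite (_ : 0 = 1 + -1) //; apply: val_geM => //.
by right; rewrite valV ?uniformizer_neq0 // val_uniformizer.
Qed.

(** The place is rational, so the residue field is [F]. By density [x] may be replaced by a rational
    function; integrality lets the powers of ['X - tau] be cancelled from its denominator, and its
    value at [tau] is then the residue. *)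
Lemma residue_ex x : exists r, O x -> m (x - cconst r).
Proof.
have [Ox|nOx] := pselect (O x); last by exists 0.
have [k xk] := cemb_dense x 1.
have [a [b [b0 kE]]] := fraction_split k.
have Ok : O (cemb Kv k).
  by rewrite -[cemb Kv k](subKr x); apply: val_geB => //; exact: max_int.
suff [r kr] : exists r, m (cemb Kv k - cconst r).
  by exists r => _; rewrite -(subrK (cemb Kv k) x) -addrA; exact: cvalD.
have [a0|a0] := eqVneq a 0.
  by exists 0; left; rewrite kE a0 /cconst /kconst polyC0 tofrac0 mul0r rmorph0 subrr.
have [n [a' na' aE]] := multiplicity_XsubC a tau.
have [n' [b' nb' bE]] := multiplicity_XsubC b tau.
rewrite a0 b0 /= in na' nb'.
have a'0 : a' != 0 by apply: contraNneq na' => ->; rewrite root0.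
have b'0 : b' != 0 by apply: contraNneq nb' => ->; rewrite root0.
have X0 j : ('X - tau%:P) ^+ j != 0 :> {poly F} by rewrite expf_neq0 // polyXsubC_eq0.
have vE : v (cemb Kv k) = n%:Z - n'%:Z.
  have c0 (q : {poly F}) : q != 0 -> cemb Kv (tofrac q) != 0.
    by rewrite fmorph_eq0 tofrac_eq0.
  rewrite kE fmorph_div cvalM ?valV ?invr_eq0 ?c0 // !val_tofrac //.
  by rewrite aE bE !mupMr // !mup_XsubCX eqxx.
have nn' : (n' <= n)%N.
  case: Ok => [/eqP|]; last by rewrite vE; lia.
  by rewrite fmorph_eq0 kE mulf_eq0 invr_eq0 !tofrac_eq0 (negPf a0) (negPf b0).
have tb' : tofrac b' != 0 :> {fraction {poly F}} by rewrite tofrac_eq0.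
have kE' : k = tofrac (('X - tau%:P) ^+ (n - n') * a') / tofrac b'.
  apply/eqP; rewrite kE eqr_div ?tofrac_eq0 // -!tofracM tofrac_eq {1}aE {1}bE.
  rewrite -{1}(subnK nn') exprD; apply/eqP; ring.
pose a2 := ('X - tau%:P) ^+ (n - n') * a'.
pose r := a2.[tau] / b'.[tau]; exists r.
have Ob' : O (cemb Kv (tofrac b'))^-1.
  by have [/max_tofrac|] := unit_intV (int_tofrac b'); first exact/negP.
rewrite kE' -/a2 fmorph_div.
have -> : cemb Kv (tofrac a2) / cemb Kv (tofrac b') - cconst r
  = cemb Kv (tofrac (a2 - r%:P * b')) / cemb Kv (tofrac b').
  rewrite tofracB (tofracM r%:P b') rmorphB (rmorphM (cemb Kv) (tofrac r%:P)) mulrBl.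
  by rewrite mulfK // fmorph_eq0.
apply: maxMl => //; apply/max_tofrac; rewrite /root hornerD hornerN (hornerM r%:P) hornerC.
by rewrite /r divfK ?subrr // -/(root b' tau).
Qed.

(** Reduction modulo the maximal ideal; the value is arbitrary outside the valuation ring. *)
Definition red x : F := sval (cid (residue_ex x)).

Lemma redP x : O x -> m (x - cconst (red x)).
Proof. exact: (svalP (cid (residue_ex x))). Qed.

Lemma red_eq x r : O x -> m (x - cconst r) -> red x = r.
Proof.
move=> Ox xr; apply/eqP; rewrite -subr_eq0; apply/eqP/max_cconst.
have := val_geB xr (redP Ox).
rewrite opprB addrC addrA subrK /cconst /kconst.
by rewrite -rmorphB -tofracB -polyCB.
Qed.

Lemma redD x y : O x -> O y -> red (x + y) = red x + red y.
Proof.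
move=> Ox Oy; apply: red_eq; first exact: cvalD.
rewrite /cconst /kconst polyCD tofracD rmorphD opprD addrACA.
by apply: cvalD; exact: redP.
Qed.

Lemma red_const r : red (cconst r) = r.
Proof. by apply: red_eq; [exact: int_cconst|rewrite subrr; left]. Qed.

Lemma redM x y : O x -> O y -> red (x * y) = red x * red y.
Proof.
move=> Ox Oy; apply: red_eq; first exact: intM.
rewrite /cconst /kconst polyCM tofracM rmorphM -/(kconst _) -/(kconst _) -/(cconst _) -/(cconst _).
rewrite (_ : _ - _ = (x - cconst (red x)) * y + cconst (red x) * (y - cconst (red y))); last by ring.
by apply: cvalD; [apply: maxMl => //; exact: redP|apply: maxMr; [exact: int_cconst|exact: redP]].
Qed.

Lemma red0 : red 0 = 0.
Proof. by rewrite -[0 in LHS](rmorph0 (cemb Kv)) -tofrac0 -polyC0 -/(kconst 0) -/(cconst 0) red_const. Qed.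

Lemma red1 : red 1 = 1.
Proof. by rewrite -[1 in LHS](rmorph1 (cemb Kv)) -tofrac1 -polyC1 -/(kconst 1) -/(cconst 1) red_const. Qed.

Lemma redN x : O x -> red (- x) = - red x.
Proof.
move=> Ox; have ON := val_geN Ox; apply/eqP; rewrite -addr_eq0 -redD // addNr.
by rewrite red0.
Qed.

Lemma red_eq0 x : O x -> red x = 0 <-> m x.
Proof.
move=> Ox; split=> [r0|mx].
  by have := redP Ox; rewrite r0 /cconst /kconst polyC0 tofrac0 rmorph0 subr0.
by apply: red_eq => //; rewrite /cconst /kconst polyC0 tofrac0 rmorph0 subr0.
Qed.

Lemma red_tofrac (a : {poly F}) : red (cemb Kv (tofrac a)) = a.[tau].
Proof.
apply: red_eq; first exact: int_tofrac.
rewrite /cconst /kconst -rmorphB -tofracB; apply/max_tofrac.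
by rewrite /root hornerD hornerN hornerC subrr.
Qed.

End Valuation.

(** * Lattices *)

Section TwoByTwo.
Context (A : comNzRingType).

Lemma ord2P (i : 'I_2) : i = 0 \/ i = 1.
Proof. by case: i => -[|[|//]] p; [left|right]; apply: val_inj. Qed.

Lemma mulmx2E n p (M : 'M[A]_(n, 2)) (N : 'M[A]_(2, p)) i j :
  (M *m N) i j = M i 0 * N 0 j + M i 1 * N 1 j.
Proof. by rewrite mxE !big_ord_recl big_ord0 addr0; congr (_ * N _ _ + M _ _ * N _ _); apply: val_inj. Qed.

Lemma det2 (M : 'M[A]_2) : \det M = M 0 0 * M 1 1 - M 0 1 * M 1 0.
Proof.
rewrite (expand_det_row _ 0) !big_ord_recl big_ord0 addr0 /cofactor !det_mx11 !mxE.
have -> : lift 0 0 = 1 :> 'I_2 by apply: val_inj.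
have -> : lift 1 0 = 0 :> 'I_2 by apply: val_inj.
by rewrite /= /bump /= expr0 expr1 mul1r mulN1r mulrN.
Qed.

Lemma matrix2P (M N : 'M[A]_2) : M 0 0 = N 0 0 -> M 0 1 = N 0 1 ->
  M 1 0 = N 1 0 -> M 1 1 = N 1 1 -> M = N.
Proof.
move=> h1 h2 h3 h4; apply/matrixP => i j.
by case: (ord2P i) => ->; case: (ord2P j) => ->.
Qed.

End TwoByTwo.

Lemma invmxM (K : comUnitRingType) n (M N : 'M[K]_n) : M \in unitmx -> N \in unitmx ->
  invmx (M *m N) = invmx N *m invmx M.
Proof.
move=> uM uN; have uMN : M *m N \in unitmx by rewrite unitmx_mul uM.
by apply: (can_inj (mulKmx uMN)); rewrite mulmxV // -mulmxA mulKVmx // mulmxV.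
Qed.

Section Lattices.
Context (F : finFieldType) (tau : F) (Kv : completion tau).
Local Notation O := (@val_ge Kv (@cval _ _ Kv) 0).
Local Notation m := (@val_ge Kv (@cval _ _ Kv) 1).
Local Notation v := (@cval _ _ Kv).
Local Notation pi := (uniformizer Kv).
Implicit Types M N U : 'M[Kv]_2.

Definition imx p q (M : 'M[Kv]_(p, q)) : Prop := forall i j, O (M i j).

Lemma imxM p q (M : 'M[Kv]_(p, 2)) (N : 'M[Kv]_(2, q)) : imx M -> imx N -> imx (M *m N).
Proof. by move=> iM iN i j; rewrite mulmx2E; apply: cvalD; apply: intM. Qed.

Lemma imxD M N : imx M -> imx N -> imx (M + N).
Proof. by move=> iM iN i j; rewrite mxE; exact: cvalD. Qed.

Lemma imxZ a M : O a -> imx M -> imx (a *: M).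
Proof. by move=> Oa iM i j; rewrite mxE; exact: intM. Qed.

Lemma imx1 : imx (1%:M : 'M[Kv]_2).
Proof. by move=> i j; rewrite mxE; case: (_ == _); [exact: int1|exact: val_ge0]. Qed.

Definition redm p q (M : 'M[Kv]_(p, q)) : 'M[F]_(p, q) := map_mx (@red _ _ Kv) M.

Lemma redmM p q (M : 'M[Kv]_(p, 2)) (N : 'M[Kv]_(2, q)) : imx M -> imx N ->
  redm (M *m N) = redm M *m redm N.
Proof.
move=> iM iN; apply/matrixP => i j; rewrite mxE !mulmx2E !mxE redD ?redM //; exact: intM.
Qed.

Lemma redmD M N : imx M -> imx N -> redm (M + N) = redm M + redm N.
Proof. by move=> iM iN; apply/matrixP => i j; rewrite !mxE redD. Qed.

Lemma redmN M : imx M -> redm (- M) = - redm M.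
Proof. by move=> iM; apply/matrixP => i j; rewrite !mxE redN. Qed.

Lemma redmZ a M : O a -> imx M -> redm (a *: M) = red a *: redm M.
Proof. by move=> Oa iM; apply/matrixP => i j; rewrite !mxE redM. Qed.

Lemma redm1 : redm (1%:M : 'M[Kv]_2) = 1%:M.
Proof. by apply/matrixP => i j; rewrite !mxE; case: (_ == _); rewrite ?red1 ?red0. Qed.

Lemma redm_eq0 M : imx M -> redm M = 0 -> imx (pi^-1 *: M).
Proof.
move=> iM /matrixP rM i j; rewrite mxE mulrC; apply: max_divP.
by apply/red_eq0 => //; have := rM i j; rewrite !mxE.
Qed.

Lemma int_det M : imx M -> O (\det M).
Proof. by move=> iM; rewrite det2; apply: val_geB; apply: intM. Qed.

Lemma red_det M : imx M -> red (\det M) = \det (redm M).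
Proof.
move=> iM; have Oe i j k l : O (M i j * M k l) by exact: intM.
by rewrite !det2 !mxE redD ?redN ?redM //; exact: val_geN.
Qed.

Lemma imx_adj M : imx M -> imx (\adj M).
Proof.
move=> iM i j; rewrite mxE /cofactor det_mx11 !mxE.
have h : O (M (lift j 0) (lift i 0)) by [].
elim: (_ + _)%N => [|n IH]; first by rewrite expr0 mul1r.
by rewrite exprS mulN1r mulNr; exact: val_geN.
Qed.

(** Membership in [GL_2] of the valuation ring. *)
Definition iunit U : Prop := [/\ U \in unitmx, imx U & imx (invmx U)].

Lemma iunitP M : imx M -> ~ m (\det M) -> iunit M.
Proof.
move=> iM nmd; have [d0 Od] := unit_intV (int_det iM) nmd.
have uM : M \in unitmx by rewrite unitmxE unitfE.
by split=> //; rewrite /invmx uM; apply: imxZ => //; exact: imx_adj.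
Qed.

Lemma iunit_det U : iunit U -> O (\det U) /\ ~ m (\det U).
Proof.
move=> [uU iU iV]; split; first exact: int_det.
apply: (@not_max_mul1 _ _ _ _ (\det (invmx U))); try exact: int_det.
by rewrite -det_mulmx mulmxV // det1.
Qed.

Lemma iunitV U : iunit U -> iunit (invmx U).
Proof. by move=> [uU iU iV]; split=> //; rewrite ?unitmx_inv ?invmxK. Qed.

Lemma iunit_red U : iunit U -> redm U <> 0.
Proof.
move=> [uU iU iV] r0; have := redmM iU iV.
rewrite mulmxV // redm1 r0 mul0mx => /matrixP/(_ 0 0); rewrite !mxE eqxx => /eqP.
by rewrite oner_eq0.
Qed.

Definition lat M : set 'cV[Kv]_2 := [set M *m x | x in [set x : 'cV[Kv]_2 | imx x]].

Lemma latticeP (L : set 'cV[Kv]_2) : lattice L <-> exists2 M, M \in unitmx & L = lat M.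
Proof.
have E M : lat M = [set M *m x | x in [set x : 'cV[Kv]_2 | forall i, local_integers (x i ord0)]].
  apply/seteqP; split=> _ [x /= ix <-]; exists x => //; first by move=> i; exact: ix.
  by move=> i j; rewrite (ord1 j); exact: ix.
by split=> -[M uM ->]; exists M; rewrite ?E.
Qed.

Lemma lat_subP M N : N \in unitmx -> lat M `<=` lat N <-> imx (invmx N *m M).
Proof.
move=> uN; split=> [MN i j|iNM _ [x ix <-]]; last first.
  by exists (invmx N *m M *m x); [exact: imxM|rewrite -mulmxA mulKVmx].
have /MN[y iy yE] : lat M (M *m delta_mx j 0).
  by exists (delta_mx j 0) => // k l; rewrite mxE; case: (_ && _); [exact: int1|exact: val_ge0].
have -> : (invmx N *m M) i j = (invmx N *m (M *m (delta_mx j 0 : 'cV_2))) i 0.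
  by rewrite mulmxA -colE [RHS]mxE.
by rewrite -yE mulKmx.
Qed.

Lemma lat_eqP M N : M \in unitmx -> N \in unitmx ->
  lat M = lat N <-> iunit (invmx N *m M).
Proof.
move=> uM uN; split=> [MN|[_ i1 i2]].
  split; first by rewrite unitmx_mul unitmx_inv uN.
    by apply/lat_subP => //; rewrite MN.
  rewrite invmxM ?unitmx_inv // invmxK.
  by apply/lat_subP => //; rewrite MN.
apply/seteqP; split; first exact/lat_subP.
apply/lat_subP => //; move: i2.
by rewrite invmxM ?unitmx_inv // invmxK.
Qed.

Lemma lat_scale a M : lattice_scale a (lat M) = lat (a *: M).
Proof.
apply/seteqP; split=> [_ [_ [x ix <-] <-]|_ [x ix <-]].
  by exists x => //; rewrite scalemxAl.
by exists (M *m x); [exists x|rewrite scalemxAl].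
Qed.

Lemma lat_image g M : [set g *m x | x in lat M] = lat (g *m M).
Proof.
apply/seteqP; split=> [_ [_ [x ix <-] <-]|_ [x ix <-]].
  by exists x => //; rewrite mulmxA.
by exists (M *m x); [exists x|rewrite mulmxA].
Qed.

Lemma scale_unitmx a M : a != 0 -> M \in unitmx -> a *: M \in unitmx.
Proof. by move=> a0; rewrite !unitmxE detZ unitrM unitrX ?unitfE. Qed.

Implicit Types x y : bt_tree Kv.

(** Matrices serve as coordinates for vertices: the columns of [M] span a lattice of the class [x],
    and [M] is determined up to a scalar and an [iunit] on the right. *)
Definition vtx M x : Prop := M \in unitmx /\ sval x = homothety_class (lat M).

Lemma vtx_ex x : exists M, vtx M x.
Proof.
have [L /latticeP[M uM LE] CE] := svalP x.
by exists M; split=> //; rewrite CE LE.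
Qed.

Lemma vtx_mk M : M \in unitmx -> exists x, vtx M x.
Proof.
move=> uM; have h : exists2 L, lattice L & homothety_class (lat M) = homothety_class L.
  by exists (lat M) => //; apply/latticeP; exists M.
by exists (exist _ (homothety_class (lat M)) h).
Qed.

Lemma vtx_inj M x y : vtx M x -> vtx M y -> x = y.
Proof.
case: x y => [C hC] [C' hC'] [_ /= e] [_ /= e'].
by move: hC'; rewrite e' -e => hC'; rewrite (Prop_irrelevance hC hC').
Qed.

Lemma homothety_classP M L : homothety_class (lat M) L <-> exists2 a, a != 0 & L = lat (a *: M).
Proof.
by split=> [[a /= a0 <-]|[a a0 ->]]; exists a; rewrite // lat_scale.
Qed.

Lemma vtx_eqP M N x : vtx M x -> vtx N x <->
  N \in unitmx /\ exists2 a, a != 0 & iunit (a *: (invmx M *m N)).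
Proof.
move=> [uM xM]; split=> [[uN xN]|[uN [a a0 aMN]]].
  split=> //; have : homothety_class (lat M) (lat N).
    by rewrite -xM xN; apply/homothety_classP; exists 1; rewrite ?oner_neq0 ?scale1r.
  move=> /homothety_classP[a a0 /lat_eqP]; rewrite scale_unitmx // => /(_ uN isT).
  by rewrite invmxZ ?scale_unitmx // -scalemxAl => h; exists a^-1; rewrite // invr_eq0.
split=> //; rewrite xM.
have NM : lat (a *: N) = lat M.
  by apply/lat_eqP; rewrite ?scale_unitmx // -scalemxAr.
apply/seteqP; split=> L /homothety_classP[b b0 ->]; apply/homothety_classP.
  exists (b * a); first by rewrite mulf_neq0.
  by rewrite -scalerA -[RHS]lat_scale NM lat_scale.
exists (b / a); first by rewrite mulf_neq0 // invr_eq0.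
by rewrite -[RHS]lat_scale -NM lat_scale scalerA divfK.
Qed.

Lemma vtxZ M x a : a != 0 -> vtx M x -> vtx (a *: M) x.
Proof.
move=> a0 xM; have [uM _] := xM; apply/(vtx_eqP _ xM); split; first exact: scale_unitmx.
exists a^-1; rewrite ?invr_eq0 // -scalemxAr scalerA mulVf // mulVmx // scale1r.
by split; rewrite ?unitmx1 ?invmx1; [|exact: imx1|exact: imx1].
Qed.

Lemma bt_image_vtx g M x y : g \in unitmx -> vtx M x -> bt_image g x y <-> vtx (g *m M) y.
Proof.
move=> ug [uM xM]; rewrite /bt_image /vtx unitmx_mul ug uM xM.
suff -> : [set [set g *m v | v in L] | L in homothety_class (lat M)]
   = homothety_class (lat (g *m M)) by split=> [->|[]].
apply/seteqP; split=> [_ [L /homothety_classP[a a0 ->] <-]|L /homothety_classP[a a0 ->]].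
  by apply/homothety_classP; exists a => //; rewrite lat_image scalemxAr.
exists (lat (a *: M)); first by apply/homothety_classP; exists a.
by rewrite lat_image scalemxAr.
Qed.

Lemma bt_image_ex g x : g \in unitmx -> exists y, bt_image g x y.
Proof.
move=> ug; have [M xM] := vtx_ex x; have [uM _] := xM.
have [y yM] : exists y, vtx (g *m M) y by apply: vtx_mk; rewrite unitmx_mul ug.
by exists y; apply/(bt_image_vtx y ug xM).
Qed.

Lemma bt_image_fun g x y z : bt_image g x y -> bt_image g x z -> y = z.
Proof.
case: y z => [C hC] [C' hC'] /= e e'; rewrite /bt_image /= in e e'.
by move: hC'; rewrite e' -e => hC'; rewrite (Prop_irrelevance hC hC').
Qed.

Lemma bt_adj_vtx x y : adj x y <-> exists M N, [/\ vtx M x, vtx N y,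
  imx (invmx M *m N) /\ imx (pi *: (invmx N *m M)), ~ iunit (invmx M *m N)
  & ~ iunit (pi *: (invmx N *m M))].
Proof.
have pi0 := uniformizer_neq0 Kv.
have lift_rep z L : sval z L -> exists M, vtx M z /\ L = lat M.
  move=> zL; have [M zM] := vtx_ex z; move: zL; have [uM ->] := zM.
  move=> /homothety_classP[a a0 ->]; exists (a *: M); split=> //.
  exact: vtxZ.
have rep z M : vtx M z -> sval z (lat M).
  by move=> [uM ->]; apply/homothety_classP; exists 1; rewrite ?oner_neq0 ?scale1r.
split=> [[L [L' [xL yL' [s1 n1] [s2 n2]]]]|[M [N [xM yN [i1 i2] n1 n2]]]].
  have [M [xM LE]] := lift_rep _ _ xL; have [N [yN L'E]] := lift_rep _ _ yL'.
  have [[uM _] [uN _]] := (xM, yN); subst L L'.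
  exists M, N; rewrite lat_scale in s1 n1; split=> //.
  - by split; [exact/lat_subP|rewrite scalemxAr; apply/lat_subP].
  - by move=> /(lat_eqP uN uM) e; apply: n2; rewrite e.
  - rewrite scalemxAr => /(lat_eqP (scale_unitmx pi0 uM) uN) e.
    by apply: n1; rewrite e.
have [[uM _] [uN _]] := (xM, yN).
exists (lat M), (lat N); split; [exact: rep|exact: rep|rewrite lat_scale|].
  split; first by apply/lat_subP => //; rewrite -scalemxAr.
  move=> s; apply: n2; rewrite scalemxAr; apply/lat_eqP => //; first exact: scale_unitmx.
  by apply/seteqP; split=> //; apply/lat_subP => //; rewrite -scalemxAr.
split; first exact/lat_subP.
move=> s; apply: n1; apply/lat_eqP => //.
by apply/seteqP; split=> //; exact/lat_subP.
Qed.

Lemma bt_image_adj g x y x' y' : g \in unitmx ->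
  bt_image g x x' -> bt_image g y y' -> adj x y -> adj x' y'.
Proof.
move=> ug gx gy /bt_adj_vtx[M [N [xM yN [i1 i2] n1 n2]]].
have [[uM _] [uN _]] := (xM, yN).
apply/bt_adj_vtx; exists (g *m M), (g *m N).
have E A B : A \in unitmx -> invmx (g *m A) *m (g *m B) = invmx A *m B.
  by move=> uA; rewrite invmxM // -mulmxA mulKmx.
rewrite !E //; split=> //; first exact/(bt_image_vtx _ ug xM).
exact/(bt_image_vtx _ ug yN).
Qed.

(* Conjugating by diag(1, pi^n) for all n shows that the off-diagonal entries of
   a matrix fixing all vertices are divisible by every power of pi. *)
Lemma fix_all_corner g : g \in unitmx -> (forall x, bt_image g x x) -> g 1 0 = 0.
Proof.
move=> ug gx; apply: val_ge_all => n.
(* A scalar [a] that brings a conjugate of [g] into [GL_2] of the valuation ring satisfies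
   [2 v(a) = - v(det g)], so it can spoil the divisibility of the entry by at most [k]; hence the
   exponent [n + k] below. *)
pose k := `|v (\det g)|%N.
pose D (j : nat) : 'M[Kv]_2 := \matrix_(i, l) (if i == l then (if i == 0 then 1 else pi ^+ j) else 0).
have pi0 := uniformizer_neq0 Kv.
have vX j : v (pi ^+ j) = j%:Z.
  elim: j => [|j IH]; first by rewrite expr0 val_one.
  by rewrite exprS cvalM ?expf_neq0 // IH val_uniformizer; lia.
have uD j : D j \in unitmx.
  by rewrite unitmxE unitfE det2 !mxE /= mul1r mul0r subr0 expf_neq0.
have VD j : invmx (D j) *m g *m D j 
  = \matrix_(i, l) (g i l * (if l == 0 then 1 else pi ^+ j) / (if i == 0 then 1 else pi ^+ j)).
  apply: (can_inj (mulKmx (uD j))); rewrite !mulmxA mulmxV // mul1mx.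
  have pj : pi ^+ j != 0 by rewrite expf_neq0.
  by apply: matrix2P; rewrite !mulmx2E !mxE /=; field; rewrite pj oner_neq0.
pose j := (n + k)%N.
have [x xD] := vtx_mk (uD j).
have /(bt_image_vtx _ ug xD)/(vtx_eqP _ xD)[_ [a a0]] := gx x.
rewrite mulmxA VD => aU.
have [_ iU _] := aU; have [Od nmd] := iunit_det aU.
have dE : v (\det g) + v a + v a = 0.
  have d0 : \det g != 0 by rewrite -unitfE -unitmxE.
  have : v (a * a * \det g) = 0.
    move: Od nmd; rewrite detZ.
    have -> : \det (\matrix_(i, l) (g i l * (if l == 0 then 1 else pi ^+ j) / (if i == 0 then 1 else pi ^+ j)))
      = \det g by rewrite -VD !det_mulmx mulrAC -det_mulmx mulVmx // det1 mul1r.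
    rewrite expr2 => -[/eqP z|h] h'; first by move: z; rewrite !mulf_eq0 (negPf a0) (negPf d0).
    have /negP : ~ (1 <= v (a * a * \det g)) by move=> h1; apply: h'; right.
    by rewrite -ltNge; move: h; move: (v _) => z; lia.
  by rewrite !cvalM ?mulf_neq0 //; lia.
have := iU 1 0; rewrite !mxE /= mulr1 => h.
have [->|g0] := eqVneq (g 1 0) 0; first by left.
right; case: h => [/eqP|].
  by rewrite !mulf_eq0 invr_eq0 expf_eq0 (negPf a0) (negPf g0) (negPf pi0) andbF.
rewrite cvalM ?cvalM ?valV ?vX ?mulf_neq0 ?invr_eq0 ?expf_neq0 //.
rewrite /j /k; lia.
Qed.

Lemma fix_all_conj g N : g \in unitmx -> N \in unitmx -> (forall x, bt_image g x x) ->
  forall x, bt_image (invmx N *m g *m N) x x.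
Proof.
move=> ug uN gx x; have [M xM] := vtx_ex x; have [uM _] := xM.
have uC : invmx N *m g *m N \in unitmx by rewrite !unitmx_mul unitmx_inv uN ug.
apply/(bt_image_vtx _ uC xM)/(vtx_eqP _ xM); split; first by rewrite unitmx_mul uC.
have uNM : N *m M \in unitmx by rewrite unitmx_mul uN.
have [y yN] := vtx_mk uNM.
have /(bt_image_vtx _ ug yN)/(vtx_eqP _ yN)[_ [a a0]] := gx y.
by rewrite invmxM // -!mulmxA => h; exists a.
Qed.

(** Conjugates of [g] fix all vertices too. The permutation matrix [N] brings the entry (0, 1) into
    the corner treated above, and the unipotent [L] then brings the difference of the diagonal
    entries there. *)
Lemma fix_all_scalar g : g \in unitmx -> (forall x, bt_image g x x) -> exists a, g = a%:M.
Proof.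
move=> ug gx; have g10 := fix_all_corner ug gx.
pose N : 'M[Kv]_2 := \matrix_(i, l) (if i == l then 0 else 1).
have NN : N *m N = 1%:M.
  by apply: matrix2P; rewrite mulmx2E !mxE /= ?mulr1 ?mulr0 ?add0r ?addr0.
have [uN VN] := mulmx1_unit NN.
have NV : invmx N = N by rewrite -[RHS](mulKmx uN) NN mulmx1.
have g01 : g 0 1 = 0.
  have := fix_all_corner _ (fix_all_conj ug uN gx).
  rewrite !unitmx_mul unitmx_inv uN ug => /(_ isT).
  by rewrite NV !mulmx2E !mxE /= !mul0r !mul1r !mulr1 !mulr0 !addr0 add0r.
pose L : 'M[Kv]_2 := \matrix_(i, l) (if (i == 0) && (l == 1) then 0 else 1).
pose L' : 'M[Kv]_2 := \matrix_(i, l) (if (i == 0) && (l == 1) then 0 else if i == l then 1 else -1).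
have LL : L *m L' = 1%:M.
  by apply: matrix2P; rewrite mulmx2E !mxE /=; ring.
have [uL _] := mulmx1_unit LL.
have LV : invmx L = L' by rewrite -[RHS](mulKmx uL) LL mulmx1.
have g11 : g 1 1 = g 0 0.
  have := fix_all_corner _ (fix_all_conj ug uL gx).
  rewrite !unitmx_mul unitmx_inv uL ug => /(_ isT).
  rewrite LV !mulmx2E !mxE /= g10 g01 => e.
  by apply/eqP; rewrite -subr_eq0 -e; apply/eqP; ring.
by exists (g 0 0); apply: matrix2P; rewrite !mxE /= ?mulr1n ?mulr0n ?g10 ?g01 ?g11.
Qed.

End Lattices.

(** * Quaternions at one place *)

(** Shifting the sum of all elements of [F] by 1 shows that [#|F|] copies of 1 add up to 0; if 2
    were 0, an odd number of copies would add up to 1. *)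
Lemma odd_card_two (F : finFieldType) : odd #|F| -> (2 : F) != 0.
Proof.
move=> oF; apply/eqP => two0.
have : (1 : F) *+ #|F| = 0.
  have := reindex_inj (R := F) (op := +%R) (x := 0) (P := xpredT) (F := id) (@addIr F 1).
  rewrite big_split /= sumr_const => /eqP.
  by rewrite -[X in X == _]addr0 eq_sym (inj_eq (addrI _)) => /eqP.
rewrite -(odd_double_half #|F|) oF add1n mulrS -muln2 mulnC mulrnA two0 mul0rn addr0.
by apply/eqP; exact: oner_neq0.
Qed.

Lemma int_eq0 (z : int) : 0 <= z -> ~~ (1 <= z) -> z = 0.
Proof. by lia. Qed.

Lemma int_double_eq0 (z : int) : 0 <= - (z + z + 0) -> 0 <= z + z + 0 -> z = 0.
Proof. by lia. Qed.

Lemma int_neg (z : int) : z < 0 -> 1 <= - z.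
Proof. by lia. Qed.

Section QuaternionNorm.
Context (A : comNzRingType) (c t : A).
Implicit Types x y : quat c t.

Definition qnorm x : A :=
  qx0 x ^+ 2 - c * qx1 x ^+ 2 - t * qx2 x ^+ 2 + t * c * qx3 x ^+ 2.

Definition qconj x : quat c t := Quat c t (qx0 x) (- qx1 x) (- qx2 x) (- qx3 x).

Definition qscalar (a : A) : quat c t := Quat c t a 0 0 0.

Lemma quat_mulE x y : x * y = quat_mul x y. Proof. by []. Qed.

Lemma qnormM x y : qnorm (x * y) = qnorm x * qnorm y.
Proof.
by rewrite quat_mulE; case: x y => [? ? ? ?] [? ? ? ?]; rewrite /qnorm /quat_mul /=; ring.
Qed.

Lemma mul_qconj x : x * qconj x = qscalar (qnorm x).
Proof.
rewrite quat_mulE; case: x => [? ? ? ?]; rewrite /qnorm /quat_mul /qscalar /=.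
by congr Quat; ring.
Qed.

Lemma qscalarE a : qscalar a = a%:A.
Proof. by change (qscalar a = quat_scale a (quat_one c t)); rewrite /quat_scale /= mulr1 mulr0. Qed.

Lemma quatZE a x : a *: x = quat_scale a x. Proof. by []. Qed.

End QuaternionNorm.

(** * The quaternion algebra over the residue field *)

Section ResidueAlgebra.
Context (F : fieldType) (c tau : F) (Z Y : 'M[F]_2).
Hypothesis two : (2 : F) != 0.
Hypothesis c_nonsquare : forall x : F, x ^+ 2 <> c.
Hypothesis tau0 : tau != 0.
Hypothesis ZZ : Z *m Z = c%:M.
Hypothesis YY : Y *m Y = tau%:M.
Hypothesis YZ : Y *m Z = - (Z *m Y).

Lemma nonsquare_anisotropic (a b : F) : a ^+ 2 - c * b ^+ 2 = 0 -> a = 0 /\ b = 0.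
Proof.
move=> /eqP; rewrite subr_eq0 => /eqP ab.
have [b0|b0] := eqVneq b 0; last first.
  case: (c_nonsquare (x := a / b)); rewrite expr_div_n ab mulfK //.
  by rewrite expf_neq0.
by move: ab; rewrite b0 expr0n mulr0 => /eqP; rewrite expf_eq0 => /eqP.
Qed.

Definition zmx (a b : F) : 'M[F]_2 := a%:M + b *: Z.

Lemma zmx_mul a b : zmx a (- b) *m zmx a b = (a ^+ 2 - c * b ^+ 2)%:M.
Proof.
rewrite /zmx mulmxDl !mulmxDr -!scalemxAl -!scalemxAr ZZ !mul_scalar_mx mul_mx_scalar.
apply/matrixP => i j; rewrite !mxE; case: (i == j); rewrite ?mulr1n ?mulr0n; ring.
Qed.

Lemma zmxC a b : Y *m zmx a b = zmx a (- b) *m Y.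
Proof.
rewrite /zmx mulmxDl mulmxDr -scalemxAl -scalemxAr YZ mul_scalar_mx mul_mx_scalar.
by rewrite scalerN scaleNr.
Qed.

Lemma zmx_free a b p (w : 'M[F]_(2, p)) : w != 0 -> zmx a b *m w = 0 -> a = 0 /\ b = 0.
Proof.
move=> w0 zw; apply: nonsquare_anisotropic; apply/eqP; apply: contraNT w0 => n0.
have := congr1 (mulmx (zmx a (- b))) zw.
rewrite mulmxA zmx_mul mulmx0 mul_scalar_mx => /eqP.
by rewrite scaler_eq0 (negPf n0).
Qed.

Lemma mx1_neq0 : (1%:M : 'M[F]_2) != 0.
Proof. by apply/eqP => /matrixP/(_ 0 0); rewrite !mxE eqxx => /eqP; rewrite oner_eq0. Qed.

Lemma zmx_eq0 a b : zmx a b = 0 -> a = 0 /\ b = 0.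
Proof. by move=> z; apply: (@zmx_free a b 2 1%:M mx1_neq0); rewrite mulmx1. Qed.

Lemma double_eq0 (M : 'M[F]_2) : M + M = 0 -> M = 0.
Proof.
move=> MM; have : 2 *: M = 0 by rewrite -MM; apply/matrixP => i j; rewrite !mxE; ring.
by move/eqP; rewrite scaler_eq0 (negPf two) => /eqP.
Qed.

Lemma Z_unit : Z \in unitmx.
Proof.
have c0 : c != 0 by apply/eqP => c0; case: (c_nonsquare (x := 0)); rewrite c0 expr0n.
have : Z *m (c^-1 *: Z) = 1%:M by rewrite -scalemxAr ZZ scale_scalar_mx mulVf.
by move=> /mulmx1_unit[].
Qed.

Lemma Y_unit : Y \in unitmx.
Proof.
have : Y *m (tau^-1 *: Y) = 1%:M by rewrite -scalemxAr YY scale_scalar_mx mulVf.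
by move=> /mulmx1_unit[].
Qed.

(** [Z] commutes with the first summand and anticommutes past [Y], so the difference of the two
    summands vanishes along with their sum; 2 is invertible and [F[Z]] is a field. *)
Lemma residue_free x0 x1 x2 x3 : zmx x0 x1 + Y *m zmx x2 x3 = 0 ->
  [/\ x0 = 0, x1 = 0, x2 = 0 & x3 = 0].
Proof.
move=> e.
have ZzC a b : Z *m zmx a b = zmx a b *m Z.
  by rewrite /zmx mulmxDr mulmxDl -scalemxAl -scalemxAr mul_scalar_mx mul_mx_scalar.
have e2 : (zmx x0 x1 - Y *m zmx x2 x3) *m Z = 0.
  rewrite mulmxBl -ZzC -mulmxA -ZzC mulmxA YZ mulNmx opprK -mulmxA -mulmxDr e.
  by rewrite mulmx0.
have {}e2 : zmx x0 x1 - Y *m zmx x2 x3 = 0.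
  by rewrite -(mulmxK Z_unit (_ - _)) e2 mul0mx.
have e3 : zmx x0 x1 = 0.
  apply: double_eq0.
  have -> : zmx x0 x1 + zmx x0 x1
    = (zmx x0 x1 + Y *m zmx x2 x3) + (zmx x0 x1 - Y *m zmx x2 x3).
    by rewrite [RHS]addrACA subrr addr0.
  by rewrite e e2 addr0.
have [-> ->] := zmx_eq0 e3.
have : zmx x2 x3 = 0.
  by apply: (can_inj (mulKmx Y_unit)); rewrite mulmx0; move: e; rewrite e3 add0r.
by move/zmx_eq0 => [-> ->].
Qed.

(** The plane is a line over the field [F[Z]], with basis vector [Y w], so some [zmx a b] takes
    [Y w] to [w]. The square of [zmx a b *m Y] is the scalar norm times [tau]; as it fixes [w], the
    norm is [tau^-1]. *)
Lemma letter_of_vector (w : 'cV[F]_2) : w != 0 ->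
  exists a b, a ^+ 2 - c * b ^+ 2 = tau^-1 /\ zmx a b *m Y *m w = w.
Proof.
move=> w0; pose u := Y *m w.
have u0 : u != 0.
  apply: contraNneq w0 => u0.
  by rewrite -(mulKmx Y_unit w) -/u u0 mulmx0.
pose B : 'M[F]_2 := \matrix_(i, j) if j == 0 then u i 0 else (Z *m u) i 0.
have BE (z : 'cV[F]_2) : B *m z = zmx (z 0 0) (z 1 0) *m u.
  rewrite /zmx mulmxDl mul_scalar_mx -scalemxAl; apply/matrixP => i j.
  rewrite (ord1 j) mulmx2E !mxE /=; ring.
have uB : B \in unitmx.
  rewrite unitmxE unitfE -det_tr; apply/negP => /det0P[y y0].
  move=> /(congr1 trmx); rewrite trmx_mul trmxK trmx0 BE => /(zmx_free u0)[h0 h1].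
  move: y0; suff -> : y = 0 by rewrite eqxx.
  apply/matrixP => i j; rewrite (ord1 i) [RHS]mxE; rewrite !mxE in h0 h1.
  by case: (ord2P j) => ->.
pose z := invmx B *m w; exists (z 0 0), (z 1 0).
have zw : zmx (z 0 0) (z 1 0) *m Y *m w = w.
  by rewrite -mulmxA -/u -BE /z mulKVmx.
split=> //; set a := z 0 0 in zw *; set b := z 1 0 in zw *.
have : (a ^+ 2 - c * b ^+ 2) * tau = 1.
  have e : ((a ^+ 2 - c * b ^+ 2) * tau) *: w = w.
    rewrite -[RHS]zw -{2}zw !mulmxA -(mulmxA (zmx a b) Y (zmx a b)) zmxC !mulmxA.
    rewrite -(mulmxA _ Y Y) YY.
    have -> : zmx a b *m zmx a (- b) = (a ^+ 2 - c * b ^+ 2)%:M.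
      by rewrite -{1}(opprK b) zmx_mul sqrrN.
    by rewrite -scalar_mxM mul_scalar_mx.
  apply/eqP; rewrite -subr_eq0; apply: contraNT w0 => n0.
  have : ((a ^+ 2 - c * b ^+ 2) * tau - 1) *: w = 0 by rewrite scalerBl e scale1r subrr.
  by move/eqP; rewrite scaler_eq0 (negPf n0).
by move=> e; apply: (mulIf tau0); rewrite e mulVf.
Qed.

Section Letter.
Context (a b : F).
Hypothesis ab : a ^+ 2 - c * b ^+ 2 = tau^-1.
Let X := zmx a b *m Y.

Lemma letter_sq : X *m X = 1%:M.
Proof.
rewrite /X !mulmxA -(mulmxA (zmx a b) Y (zmx a b)) zmxC !mulmxA -(mulmxA _ Y Y) YY.
have -> : zmx a b *m zmx a (- b) = (a ^+ 2 - c * b ^+ 2)%:M.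
  by rewrite -{1}(opprK b) zmx_mul sqrrN.
by rewrite ab -scalar_mxM mulVf.
Qed.

Lemma letter_anticomm : X *m Z = - (Z *m X).
Proof.
rewrite /X -mulmxA YZ mulmxN !mulmxA; congr (- (_ *m _)).
by rewrite /zmx mulmxDr mulmxDl -scalemxAl -scalemxAr mul_scalar_mx mul_mx_scalar.
Qed.

Lemma letter_neq s : X <> s%:M.
Proof.
move=> Xs; have := letter_anticomm; rewrite Xs mul_scalar_mx mul_mx_scalar => e.
have : s *: Z = 0 by apply: double_eq0; rewrite {1}e addNr.
move/eqP; rewrite scaler_eq0 => /orP[/eqP s0|/eqP Z0].
  have := letter_sq; rewrite Xs s0 mul_scalar_mx scale0r => /eqP.
  by rewrite eq_sym (negPf mx1_neq0).
by have := Z_unit; rewrite Z0 unitmxE det0 unitr0.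
Qed.

(** [X] is an involution and, anticommuting with [Z], is not the identity, so it has the eigenvalue
    -1. *)
Lemma letter_det : \det (1%:M + X) = 0.
Proof.
apply/eqP; apply: contraT => d0.
have u : 1%:M + X \in unitmx by rewrite unitmxE unitfE.
case: (letter_neq (s := 1)).
have : (1%:M + X) *m (1%:M - X) = 0.
  by rewrite mulmxDl !mulmxBr !mulmx1 !mul1mx letter_sq addrA subrK subrr.
move=> /(congr1 (mulmx (invmx (1%:M + X)))); rewrite mulKmx // mulmx0.
by move/eqP; rewrite subr_eq0 => /eqP.
Qed.

End Letter.

(* A matrix of rank at most 1 killed by M on one nonzero column is killed by M. *)
Lemma kill_columns (M N : 'M[F]_2) j : \det N = 0 -> col j N != 0 ->
  M *m col j N = 0 -> M *m N = 0.
Proof.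
move=> dN Nj MNj; apply/matrixP => i k; rewrite mulmx2E [RHS]mxE.
have := congr1 (fun A : 'cV_2 => A i 0) MNj; rewrite mulmx2E !mxE => e.
rewrite det2 in dN.
have kj : N 0 j * N 1 k = N 1 j * N 0 k.
  move: dN; case: (ord2P j) => ->; case: (ord2P k) => -> h; try ring.
    by apply/eqP; rewrite -subr_eq0 [N 1 0 * _]mulrC h.
  apply/eqP; rewrite -subr_eq0; apply/eqP.
  by transitivity (- (N 0 0 * N 1 1 - N 0 1 * N 1 0)); [ring|rewrite h oppr0].
have [e0|e1] : N 0 j != 0 \/ N 1 j != 0.
  apply/orP; rewrite -negb_and; apply: contraNN Nj => /andP[/eqP h0 /eqP h1].
  by apply/eqP/matrixP => x y; rewrite !mxE; case: (ord2P x) => ->.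
- apply: (mulfI e0); rewrite mulr0.
  transitivity (N 0 k * (M i 0 * N 0 j + M i 1 * N 1 j)); last by rewrite e mulr0.
  apply/eqP; rewrite -subr_eq0; apply/eqP.
  by transitivity (M i 1 * (N 0 j * N 1 k - N 1 j * N 0 k)); [ring|rewrite kj subrr mulr0].
- apply: (mulfI e1); rewrite mulr0.
  transitivity (N 1 k * (M i 0 * N 0 j + M i 1 * N 1 j)); last by rewrite e mulr0.
  apply/eqP; rewrite -subr_eq0; apply/eqP.
  by transitivity (M i 0 * (N 1 j * N 0 k - N 0 j * N 1 k)); [ring|rewrite kj subrr mulr0].
Qed.

End ResidueAlgebra.

Section LocalQuaternions.
Context (F : finFieldType) (c tau : F) (Kv : completion tau).
Local Notation O := (@val_ge Kv (@cval _ _ Kv) 0).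
Local Notation m := (@val_ge Kv (@cval _ _ Kv) 1).
Local Notation pi := (uniformizer Kv).
Local Notation cv := (cemb Kv (kconst c)).
Local Notation tv := (cemb Kv (kt F)).
Local Notation Q := (quat cv tv).
Context (phi : {lrmorphism local_quat Kv c -> 'M[Kv]_2}).
Context (star : bt_tree Kv).
Hypothesis two : (2 : F) != 0.
Hypothesis c_nonsquare : forall x : F, x ^+ 2 <> c.
Hypothesis tau0 : tau != 0.
Hypothesis star_fixed : forall w w' : local_quat Kv c,
  quat_order (local_integers (Kv := Kv)) w -> quat_order (local_integers (Kv := Kv)) w' ->
  w * w' = 1 -> w' * w = 1 -> bt_image (phi w) star star.

Lemma phiM (w w' : Q) : phi (w * w' : Q) = phi w *m phi w'.
Proof. exact: (rmorphM phi). Qed.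

Lemma phi_scalar a : phi (qscalar cv tv a) = a%:M.
Proof.
have e : phi (a *: (1 : Q) : Q) = a *: phi (1 : Q) := linearZZ phi a (1 : Q).
by rewrite qscalarE e (rmorph1 phi : phi (1 : Q) = 1) -scalemx1.
Qed.

Lemma phi_qconj (w : Q) : phi w *m phi (qconj w) = (qnorm w)%:M.
Proof. by rewrite -phiM mul_qconj phi_scalar. Qed.

Lemma phi_unit (w : Q) : qnorm w != 0 -> phi w \in unitmx.
Proof.
move=> n0; have : phi w *m ((qnorm w)^-1 *: phi (qconj w)) = 1%:M.
  by rewrite -scalemxAr phi_qconj scale_scalar_mx mulVf.
by move=> /mulmx1_unit[].
Qed.

Context (M0 : 'M[Kv]_2).
Hypothesis star_M0 : vtx M0 star.

(** [phi] written in a basis of the lattice of [star], so that the order becomes integral. *)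
Definition psi (w : Q) : 'M[Kv]_2 := invmx M0 *m phi w *m M0.

Let uM0 : M0 \in unitmx. Proof. by case: star_M0. Qed.

Lemma psiM w w' : psi (w * w') = psi w *m psi w'.
Proof. by rewrite /psi phiM !mulmxA mulmxK. Qed.

Lemma psi_scalar a : psi (qscalar cv tv a) = a%:M.
Proof. by rewrite /psi phi_scalar mul_mx_scalar -scalemxAl mulVmx // scalemx1. Qed.

Lemma psiD w w' : psi (w + w') = psi w + psi w'.
Proof.
have e : phi (w + w' : Q) = phi w + phi w' := raddfD phi w w'.
by rewrite /psi e mulmxDr mulmxDl.
Qed.

Lemma psiZ a w : psi (a *: w) = a *: psi w.
Proof.
have e : phi (a *: w : Q) = a *: phi w := linearZZ phi a w.
by rewrite /psi e -scalemxAr -scalemxAl.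
Qed.

Lemma M0_psi w : M0 *m psi w = phi w *m M0.
Proof. by rewrite /psi -mulmxA mulKVmx. Qed.

Lemma star_image w : phi w \in unitmx -> bt_image (phi w) star star ->
  exists2 a, a != 0 & iunit (a *: psi w).
Proof.
move=> uw /(bt_image_vtx _ uw star_M0)/(vtx_eqP _ star_M0)[_ [a a0 h]].
by exists a => //; rewrite /psi -mulmxA.
Qed.

(** [star_fixed] yields integrality only up to a scalar [a]. Squaring removes the ambiguity:
    [a * a * s] is a unit and [s] is one, hence so is [a]. This applies to [Z] and [F], whose
    squares [c] and [t] are units at [tau]. *)
Lemma psi_integral (w w' : Q) s : quat_order O w -> quat_order O w' ->
  w * w' = 1 -> w' * w = 1 -> w * w = qscalar cv tv s -> O s -> ~ m s -> imx (psi w).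
Proof.
move=> iw iw' ww' w'w ws Os ms.
have uw : phi w \in unitmx.
  have : phi w *m phi w' = 1%:M by rewrite -phiM ww'; exact: (rmorph1 phi).
  by move=> /mulmx1_unit[].
have [a a0 [uU iU iV]] := star_image uw (star_fixed iw iw' ww' w'w).
have [s0 OsV] := unit_intV Os ms.
have UU : (a *: psi w) *m (a *: psi w) = (a * a * s)%:M.
  by rewrite -scalemxAl -scalemxAr scalerA -psiM ws psi_scalar scale_scalar_mx.
have O1 : O (a * a * s) by have := imxM iU iU 0 0; rewrite UU mxE eqxx.
have O2 : O (a * a * s)^-1.
  have : invmx ((a * a * s)%:M) = invmx (a *: psi w) *m invmx (a *: psi w).
    by rewrite -UU invmxM.
  rewrite invmx_scalar => e; have := imxM iV iV 0 0.
  by rewrite -e mxE eqxx.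
have va : cval a = 0.
  have as0 : a * a * s != 0 by rewrite !mulf_neq0.
  have vs : cval s = 0.
    case: Os => [z|h]; first by rewrite z eqxx in s0.
    by apply: int_eq0 => //; apply/negP => h1; apply: ms; right.
  case: O1 => [/eqP|]; first by rewrite (negPf as0).
  case: O2 => [/eqP|]; first by rewrite invr_eq0 (negPf as0).
  rewrite valV // !cvalM ?mulf_neq0 // vs.
  exact: int_double_eq0.
have OaV : O a^-1 by right; rewrite valV // va.
by have := imxZ OaV iU; rewrite scalerA mulVf // scale1r.
Qed.

Lemma c_neq0 : c != 0.
Proof. by apply/eqP => c0; case: (c_nonsquare (x := 0)); rewrite c0 expr0n. Qed.

Lemma int_c : O cv /\ O cv^-1.
Proof.
split; first exact: int_cconst.
have [|//] := unit_intV (int_cconst Kv c); first by move/max_cconst/eqP; rewrite (negPf c_neq0).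
Qed.

Lemma int_t : O tv /\ ~ m tv.
Proof.
split; first exact: int_tofrac.
by move/max_tofrac; rewrite /root hornerX; apply/negP.
Qed.

Definition qZ : Q := quat_Z cv tv.
Definition qF : Q := quat_F cv tv.

Lemma quat1E : (1 : Q) = Quat cv tv 1 0 0 0. Proof. by []. Qed.

Lemma imx_psiZ : imx (psi qZ).
Proof.
have [Oc OcV] := int_c; have [c0 _] : cv != 0 /\ True.
  by split=> //; rewrite fmorph_eq0 tofrac_eq0 polyC_eq0 c_neq0.
apply: (@psi_integral _ (Quat cv tv 0 cv^-1 0 0) cv) => //.
- by split=> /=; do ?[exact: int1|exact: val_ge0].
- by split=> /=; do ?[exact: val_ge0].
- rewrite quat_mulE quat1E /qZ /quat_mul /=; congr Quat; rewrite ?(mulr0, mul0r, addr0, subr0, oppr0, add0r, mulr1) //.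
  by rewrite mulfV.
- rewrite quat_mulE quat1E /qZ /quat_mul /=; congr Quat; rewrite ?(mulr0, mul0r, addr0, subr0, oppr0, add0r, mulr1) //.
  by rewrite mulfV.
- rewrite quat_mulE /qscalar /qZ /quat_mul /=; congr Quat; ring.
- by move/max_cconst/eqP; rewrite (negPf c_neq0).
Qed.

Lemma imx_psiF : imx (psi qF).
Proof.
have [Ot mt] := int_t; have [t0 OtV] := unit_intV Ot mt.
apply: (@psi_integral _ (Quat cv tv 0 0 tv^-1 0) tv) => //.
- by split=> /=; do ?[exact: int1|exact: val_ge0].
- by split=> /=; do ?[exact: val_ge0].
- rewrite quat_mulE quat1E /qF /quat_mul /=; congr Quat; rewrite ?(mulr0, mul0r, addr0, subr0, oppr0, add0r, mulr1) //.
  by rewrite mulfV.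
- rewrite quat_mulE quat1E /qF /quat_mul /=; congr Quat; rewrite ?(mulr0, mul0r, addr0, subr0, oppr0, add0r, mulr1) //.
  by rewrite mulfV.
- rewrite quat_mulE /qscalar /qF /quat_mul /=; congr Quat; ring.
Qed.

Lemma psiE (w : Q) : psi w = (qx0 w)%:M + qx1 w *: psi qZ + qx2 w *: psi qF
  + qx3 w *: (psi qF *m psi qZ).
Proof.
have p1 : psi 1 = 1%:M by rewrite -(psi_scalar 1).
by rewrite {1}(quatE w) !psiD !psiZ psiM p1 scalemx1.
Qed.

Lemma imx_scalar a : O a -> imx (a%:M : 'M[Kv]_2).
Proof. by move=> Oa i j; rewrite mxE; case: (_ == _) => //; exact: val_ge0. Qed.

Lemma imx_psi (w : Q) : quat_order O w -> imx (psi w).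
Proof.
move=> [O0 O1 O2 O3]; rewrite psiE.
apply: imxD; last by apply: imxZ => //; apply: imxM; [exact: imx_psiF|exact: imx_psiZ].
apply: imxD; last by apply: imxZ => //; exact: imx_psiF.
by apply: imxD; [exact: imx_scalar|apply: imxZ => //; exact: imx_psiZ].
Qed.

Let rZ := redm (psi qZ).
Let rF := redm (psi qF).

Lemma redm_scalar a : redm (a%:M : 'M[Kv]_2) = (red a)%:M.
Proof. by apply/matrixP => i j; rewrite !mxE; case: (_ == _); rewrite ?mulr1n ?mulr0n ?red0. Qed.

Lemma rZZ : rZ *m rZ = c%:M.
Proof.
rewrite -redmM; try exact: imx_psiZ.
by rewrite -psiM quat_ZZ -qscalarE psi_scalar redm_scalar red_const.
Qed.

Lemma rFF : rF *m rF = tau%:M.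
Proof.
rewrite -redmM; try exact: imx_psiF.
by rewrite -psiM quat_FF -qscalarE psi_scalar redm_scalar red_tofrac hornerX.
Qed.

Lemma rFZ : rF *m rZ = - (rZ *m rF).
Proof.
have iF := imx_psiF; have iZ := imx_psiZ.
rewrite -!redmM // -redmN; last exact: imxM.
by congr redm; rewrite -!psiM quat_FZ -scaleN1r psiZ scaleN1r.
Qed.

Lemma redm_psi (w : Q) : quat_order O w -> redm (psi w) =
  zmx rZ (red (qx0 w)) (red (qx1 w)) + rF *m zmx rZ (red (qx2 w)) (red (qx3 w)).
Proof.
have iF := imx_psiF; have iZ := imx_psiZ.
move=> [O0 O1 O2 O3]; rewrite psiE.
have i1 : imx ((qx0 w)%:M + qx1 w *: psi qZ) by apply: imxD; [exact: imx_scalar|exact: imxZ].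
have i2 : imx (qx2 w *: psi qF) by exact: imxZ.
have i3 : imx (psi qF *m psi qZ) by exact: imxM.
have i4 : imx ((qx0 w)%:M + qx1 w *: psi qZ + qx2 w *: psi qF) by exact: imxD.
have i5 : imx (qx3 w *: (psi qF *m psi qZ)) by exact: imxZ.
rewrite redmD // redmD // redmD ?redm_scalar ?redmZ //; first last.
- exact: imxZ.
- exact: imx_scalar.
by rewrite redmM // /zmx mulmxDr mul_mx_scalar -scalemxAr addrA.
Qed.

(* The order is a maximal order at v: it embeds in M_2 modulo the maximal ideal. *)
Lemma psi_primitive (w : Q) : quat_order O w -> redm (psi w) = 0 ->
  [/\ m (qx0 w), m (qx1 w), m (qx2 w) & m (qx3 w)].
Proof.
move=> ow; have [O0 O1 O2 O3] := ow; rewrite redm_psi //.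
move=> /(residue_free two c_nonsquare tau0 rZZ rFF rFZ)[h0 h1 h2 h3].
by split; apply/red_eq0.
Qed.

Lemma qconj_order (w : Q) : quat_order O w -> quat_order O (qconj w).
Proof. by move=> [O0 O1 O2 O3]; split=> //=; exact: val_geN. Qed.

(** Otherwise [psi w] is not zero modulo the uniformizer, so the scalar [a] that makes it invertible
    is a unit. Then the conjugate, which is the norm times the inverse of [w], vanishes modulo the
    uniformizer, and [w] with it. *)
Lemma fixed_norm_unit (w : Q) : quat_order O w -> qnorm w != 0 ->
  bt_image (phi w) star star -> m (qnorm w) ->
  [/\ m (qx0 w), m (qx1 w), m (qx2 w) & m (qx3 w)].
Proof.
move=> ow n0 fw mn; apply: contrapT => prim.
have uw := phi_unit n0; have iw := imx_psi ow.
have [a a0 U] := star_image uw fw; have [uU iU iV] := U.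
have r0 : redm (psi w) <> 0 by move=> r0; apply: prim; exact: psi_primitive.
have mred x (M : 'M[Kv]_2) : m x -> imx M -> redm (x *: M) = 0.
  move=> mx iM; apply/matrixP => i j; rewrite !mxE; apply/red_eq0; last exact: maxMl.
  by apply: intM => //; exact: max_int.
have oa : ~ m a by move=> ma; apply: (iunit_red U); exact: mred.
have oaV : ~ m a^-1.
  by move=> ma; apply: r0; rewrite -[psi w]scale1r -(mulVf a0) -scalerA; exact: mred.
have Oa : O a.
  have [h|h] := lerP 0 (cval a); first by right.
  by case: oaV; right; rewrite valV //; exact: int_neg.
have e : psi (qconj w) = (qnorm w * a) *: invmx (a *: psi w).
  apply: (can_inj (mulKmx uU)); rewrite -scalemxAr mulmxV // scalemx1.
  by rewrite -scalemxAl -psiM mul_qconj psi_scalar scale_scalar_mx mulrC.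
have [] := psi_primitive (qconj_order ow).
  by rewrite e; apply: mred => //; exact: maxMl.
rewrite /= => m0 m1 m2 m3; apply: prim.
by split=> //; [rewrite -[qx1 w]opprK|rewrite -[qx2 w]opprK|rewrite -[qx3 w]opprK]; exact: val_geN.
Qed.

(** The element [1 + (a + b Z) F]; the sign in the last coordinate comes from [Z F = - F Z]. *)
Definition lam (a b : F) : Q := Quat cv tv 1 0 (cconst Kv a) (- cconst Kv b).

Definition is_letter (a b : F) : Prop := a ^+ 2 - c * b ^+ 2 = tau^-1.

Lemma cconstN a : cconst Kv (- a) = - cconst Kv a.
Proof. by rewrite /cconst /kconst polyCN tofracN rmorphN. Qed.

Lemma cconstM a b : cconst Kv (a * b) = cconst Kv a * cconst Kv b.
Proof. by rewrite /cconst /kconst polyCM tofracM rmorphM. Qed.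

Lemma cconstB a b : cconst Kv (a - b) = cconst Kv a - cconst Kv b.
Proof. by rewrite /cconst /kconst polyCB tofracB rmorphB. Qed.

Lemma cconst1 : cconst Kv 1 = 1.
Proof. by rewrite /cconst /kconst polyC1 tofrac1 rmorph1. Qed.

Lemma qconj_lam a b : qconj (lam a b) = lam (- a) (- b).
Proof. by rewrite /qconj /lam /= !cconstN oppr0. Qed.

Lemma lam_order a b : quat_order O (lam a b).
Proof.
split=> /=; [exact: int1|exact: val_ge0|exact: int_cconst|].
by apply: val_geN; exact: int_cconst.
Qed.

Lemma qnorm_lam a b : is_letter a b -> qnorm (lam a b) = cconst Kv (- tau^-1) * pi.
Proof.
move=> ab; rewrite /qnorm /=.
have -> : pi = tv - cconst Kv tau by rewrite /uniformizer tofracB rmorphB.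
transitivity (1 - tv * (cconst Kv a * cconst Kv a - cv * (cconst Kv b * cconst Kv b))).
  by ring.
rewrite -[cv]/(cconst Kv c) -!cconstM -cconstB -!expr2 ab cconstN mulrBr !mulNr -cconstM mulVf //.
by rewrite cconst1 opprK addrC mulrC.
Qed.

Lemma qnorm_lam_neq0 a b : is_letter a b -> qnorm (lam a b) != 0.
Proof.
move=> ab; rewrite qnorm_lam // mulf_neq0 ?uniformizer_neq0 //.
by rewrite fmorph_eq0 tofrac_eq0 polyC_eq0 oppr_eq0 invr_eq0.
Qed.

Lemma is_letterN a b : is_letter a b -> is_letter (- a) (- b).
Proof. by rewrite /is_letter !sqrrN. Qed.

Lemma redm_lam a b : redm (psi (lam a b)) = 1%:M + zmx rZ a b *m rF.
Proof.
rewrite redm_psi; last exact: lam_order.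
rewrite /= red1 red0 redN ?red_const; last exact: int_cconst.
by rewrite (zmxC rFZ) opprK /zmx scale0r addr0.
Qed.

Lemma imx_lam a b : imx (psi (lam a b)).
Proof. by apply: imx_psi; exact: lam_order. Qed.

Lemma det_lam a b : is_letter a b -> m (\det (psi (lam a b))).
Proof.
move=> ab; apply/red_eq0; first by apply: int_det; exact: imx_lam.
rewrite red_det; last exact: imx_lam.
by rewrite redm_lam (letter_det two c_nonsquare tau0 rZZ rFF rFZ ab).
Qed.

Lemma psi_lam_conj a b : is_letter a b ->
  psi (lam a b) *m psi (qconj (lam a b)) = (cconst Kv (- tau^-1) * pi)%:M.
Proof. by move=> ab; rewrite -psiM mul_qconj psi_scalar qnorm_lam. Qed.

(** The reduction of [M] has rank one. The letter is chosen so that its involution [X] fixes a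
    non-zero column; then [1 - X], the reduction of the conjugate of the letter, kills all of [M].
    Hence the conjugate times [M] is divisible by [pi], and the letter times its conjugate is [pi]
    up to a unit. *)
Lemma lam_division (M : 'M[Kv]_2) : imx M -> m (\det M) -> redm M <> 0 ->
  exists a b, is_letter a b /\ exists2 M', imx M' & M = psi (lam a b) *m M'.
Proof.
move=> iM dM rM.
have dr : \det (redm M) = 0 by rewrite -red_det //; apply/red_eq0 => //; exact: int_det.
have [j Mj] : exists j, col j (redm M) != 0.
  have /matrix0Pn[i [j Mij]] : redm M != 0 by apply/eqP.
  by exists j; apply/matrix0Pn; exists i, 0; rewrite mxE.
have [a [b [ab e]]] := letter_of_vector c_nonsquare tau0 rZZ rFF rFZ Mj.
exists a, b; split; first exact: ab.
have k : (1%:M - zmx rZ a b *m rF) *m redm M = 0.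
  by apply: (kill_columns dr Mj); rewrite mulmxBl mul1mx e subrr.
have iC : imx (psi (qconj (lam a b))) by rewrite qconj_lam; exact: imx_lam.
have k' : redm (psi (qconj (lam a b)) *m M) = 0.
  rewrite redmM // qconj_lam redm_lam -[RHS]k; congr (_ *m _); congr (_ + _).
  rewrite -mulNmx; congr (_ *m _); rewrite /zmx opprD scaleNr; congr (_ + _).
  by rewrite raddfN.
have iN := redm_eq0 (imxM iC iM) k'.
exists (cconst Kv (- tau) *: (pi^-1 *: (psi (qconj (lam a b)) *m M))).
  by apply: imxZ => //; exact: int_cconst.
rewrite -!scalemxAr mulmxA psi_lam_conj // mul_scalar_mx !scalerA.
rewrite (_ : _ * _ = 1) ?scale1r //.
have pi0 := uniformizer_neq0 Kv.
have -> : cconst Kv (- tau) * pi^-1 * (cconst Kv (- tau^-1) * pi)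
  = cconst Kv (- tau) * cconst Kv (- tau^-1) * (pi^-1 * pi) by ring.
by rewrite mulVf // mulr1 -cconstM mulrNN mulfV // cconst1.
Qed.

Lemma lam_adj a b y : is_letter a b -> bt_image (phi (lam a b)) star y -> adj star y.
Proof.
move=> ab sy; have ul := phi_unit (qnorm_lam_neq0 ab).
have yl : vtx (phi (lam a b) *m M0) y by apply/(bt_image_vtx _ ul star_M0).
have upsi : psi (lam a b) \in unitmx by rewrite /psi !unitmx_mul unitmx_inv uM0 ul.
have E : pi *: invmx (psi (lam a b)) = cconst Kv (- tau) *: psi (qconj (lam a b)).
  apply: (can_inj (mulKmx upsi)); rewrite -!scalemxAr mulmxV // psi_lam_conj //.
  by rewrite [RHS]scale_scalar_mx mulrA -cconstM mulrNN mulfV // cconst1 mul1r scalemx1.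
have ct : ~ m (cconst Kv (- tau)) by move/max_cconst/eqP; rewrite oppr_eq0; apply/negP.
apply/bt_adj_vtx; exists M0, (phi (lam a b) *m M0).
have -> : invmx M0 *m (phi (lam a b) *m M0) = psi (lam a b) by rewrite /psi mulmxA.
have -> : invmx (phi (lam a b) *m M0) *m M0 = invmx (psi (lam a b)).
  by rewrite /psi -mulmxA [RHS]invmxM ?unitmx_inv ?unitmx_mul ?ul // invmxK.
rewrite E; split=> //.
- split; first exact: imx_lam.
  by rewrite qconj_lam; apply: imxZ; [exact: int_cconst|exact: imx_lam].
- by move=> /iunit_det[_]; apply; exact: det_lam.
- move=> /iunit_det[_]; apply; rewrite detZ qconj_lam.
  apply: maxMr; last by apply: det_lam; exact: is_letterN.
  by rewrite expr2; apply: intM; exact: int_cconst.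
Qed.

Lemma adj_lam y : adj star y -> exists a b, is_letter a b /\ bt_image (phi (lam a b)) star y.
Proof.
move=> /bt_adj_vtx[M [N [sM yN [i1 i2] n1 n2]]].
have [[uM _] [uN _]] := (sM, yN).
have [_ [a a0 U]] := (vtx_eqP M star_M0).1 sM.
have [uU iU iV] := U; pose B := a *: (invmx M0 *m N).
have BE : B = (a *: (invmx M0 *m M)) *m (invmx M *m N).
  by rewrite /B -scalemxAl -mulmxA mulKVmx.
have uB : B \in unitmx by rewrite BE !unitmx_mul uU unitmx_inv uM uN.
have BV : pi *: invmx B = (pi *: (invmx N *m M)) *m invmx (a *: (invmx M0 *m M)).
  by rewrite BE invmxM // ?unitmx_mul ?unitmx_inv ?uM // invmxM ?unitmx_inv // invmxK -scalemxAl.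
have iB : imx B by rewrite BE; exact: imxM.
have iBV : imx (pi *: invmx B) by rewrite BV; exact: imxM.
have nB : ~ iunit B.
  move=> [_ _ BV']; apply: n1; split=> //; first by rewrite unitmx_mul unitmx_inv uM.
  rewrite invmxM ?unitmx_inv // invmxK.
  have -> : invmx N *m M = invmx B *m (a *: (invmx M0 *m M)).
    by rewrite BE invmxM // ?unitmx_mul ?unitmx_inv ?uM // invmxM ?unitmx_inv // invmxK mulmxKV.
  exact: imxM.
have nBV : ~ iunit (pi *: invmx B).
  move=> [uBV _ iBVV]; apply: n2.
  have E : pi *: (invmx N *m M) = (pi *: invmx B) *m (a *: (invmx M0 *m M)).
    by rewrite BV mulmxKV.
  rewrite E; split; [by rewrite unitmx_mul uBV|exact: imxM|].
  by rewrite invmxM //; exact: imxM.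
have dB : m (\det B) by apply: contrapT => h; apply: nB; exact: iunitP.
have pi0 := uniformizer_neq0 Kv.
have upB : pi *: invmx B \in unitmx by rewrite scale_unitmx ?unitmx_inv.
have rB : redm B <> 0.
  move=> rB; apply: nBV; split=> //.
  by rewrite invmxZ // invmxK; exact: redm_eq0.
have [x [b [xb [B' iB' BE']]]] := lam_division iB dB rB.
exists x, b; split=> //.
have dBB : \det (pi *: invmx B) * \det B = pi * pi.
  by rewrite detZ det_inv divfK -?expr2 // -unitfE -unitmxE.
(* If the determinant of [B'] were not a unit, that of [B] would have valuation at least 2; the
   determinant of [pi *: invmx B] has valuation at least 1, but the two valuations add up to 2. *)
have U' : iunit B'.
  apply: iunitP => // dB'; apply: nBV; apply: iunitP => // mB.
  have m2 : val_ge (@cval _ _ Kv) (1 + 1) (\det B).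
    by rewrite BE' det_mulmx; apply: val_geM => //; exact: det_lam.
  have := val_geM mB m2; rewrite dBB => -[/eqP|].
    by rewrite mulf_eq0 (negPf pi0).
  by rewrite cvalM // val_uniformizer.
have ul := phi_unit (qnorm_lam_neq0 xb).
apply/(bt_image_vtx _ ul star_M0).
have yB : vtx (M0 *m B) y.
  by rewrite /B -scalemxAr mulKVmx //; exact: vtxZ.
apply/(vtx_eqP _ yB); split; first by rewrite unitmx_mul ul.
exists 1; rewrite ?oner_neq0 // scale1r BE' mulmxA M0_psi.
have [uB' _ _] := U'.
rewrite invmxM ?unitmx_mul ?ul // mulmxKV ?unitmx_mul ?ul //.
exact: iunitV.
Qed.

Lemma bt_image_comp (g h : 'M[Kv]_2) x y z : g \in unitmx -> h \in unitmx ->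
  bt_image g x y -> bt_image h y z -> bt_image (h *m g) x z.
Proof.
move=> ug uh gy hz; have [M xM] := vtx_ex x.
have uhg : h *m g \in unitmx by rewrite unitmx_mul uh.
apply/(bt_image_vtx _ uhg xM); rewrite -mulmxA.
by apply/(bt_image_vtx _ uh)/hz; apply/(bt_image_vtx _ ug xM).
Qed.

Lemma bt_image1 x : bt_image (1%:M : 'M[Kv]_2) x x.
Proof.
have [M xM] := vtx_ex x; have [uM _] := xM.
by apply/(bt_image_vtx _ (unitmx1 _ _) xM); rewrite mul1mx.
Qed.

Lemma imx_pi_power (B : 'M[Kv]_2) : exists k : nat, imx (pi ^+ k *: B).
Proof.
have vX k : cval (pi ^+ k) = k%:Z.
  elim: k => [|k IH]; first by rewrite expr0 val_one.
  rewrite exprS cvalM ?uniformizer_neq0 ?expf_neq0 ?uniformizer_neq0 //.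
  by rewrite IH val_uniformizer -PoszD.
pose k := (\sum_(ij : 'I_2 * 'I_2) `|cval (B ij.1 ij.2)|)%N.
exists k => i j; rewrite mxE.
have [->|b0] := eqVneq (B i j) 0; first by rewrite mulr0; exact: val_ge0.
right; rewrite cvalM ?expf_neq0 ?uniformizer_neq0 // vX.
have : (`|cval (B i j)| <= k)%N by rewrite /k (bigD1 (i, j)) //= leq_addr.
by move: (cval _) (k) => z n; lia.
Qed.

Definition lam_prod (s : seq (F * F)) : Q := foldr (fun l q => lam l.1 l.2 * q) 1 s.

Lemma qnorm_lam_prod s : (forall l, l \in s -> is_letter l.1 l.2) -> qnorm (lam_prod s) != 0.
Proof.
elim: s => [|l s IH] ls /=.
  by rewrite /qnorm /= !expr0n expr1n !mulr0 !subr0 addr0 oner_neq0.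
rewrite qnormM mulf_neq0 //; first by apply: qnorm_lam_neq0; apply: ls; rewrite mem_head.
by apply: IH => k ks; apply: ls; rewrite inE ks orbT.
Qed.

(** Descent on the valuation of the determinant of an integral [M] with [M0 *m M] representing the
    vertex. A unit determinant means [star]; otherwise [M] is divided by [pi], which keeps the
    vertex, or by a letter. *)
Lemma star_reach x : exists s, (forall l, l \in s -> is_letter l.1 l.2) /\
  bt_image (phi (lam_prod s)) star x.
Proof.
have pi0 := uniformizer_neq0 Kv.
suff key n M y : imx M -> M \in unitmx -> cval (\det M) < n%:Z -> vtx (M0 *m M) y ->
    exists s, (forall l, l \in s -> is_letter l.1 l.2) /\ bt_image (phi (lam_prod s)) star y.
  have [N xN] := vtx_ex x; have [uN _] := xN.
  have [k iB] := imx_pi_power (invmx M0 *m N).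
  have uB : pi ^+ k *: (invmx M0 *m N) \in unitmx.
    by rewrite scale_unitmx ?expf_neq0 // unitmx_mul unitmx_inv uM0.
  apply: (key `|cval (\det (pi ^+ k *: (invmx M0 *m N)))|.+1 _ _ iB uB).
    by move: (cval _) => z; lia.
  by rewrite -scalemxAr mulKVmx //; apply: vtxZ => //; rewrite expf_neq0.
elim: n M y => [|n IH] M y iM uM vM yM.
  have [/eqP|h] := int_det iM; last by move: vM; rewrite ltNge h.
  by move: uM; rewrite unitmxE unitfE => /negPf ->.
have d0 : \det M != 0 by rewrite -unitfE -unitmxE.
have [dM|dM] := pselect (m (\det M)); last first.
  exists [::]; split=> //=.
  have -> : phi 1 = 1%:M := rmorph1 phi.
  suff -> : y = star by exact: bt_image1.
  apply: (vtx_inj yM); apply/(vtx_eqP _ star_M0); split; first by rewrite unitmx_mul uM0.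
  by exists 1; rewrite ?oner_neq0 // scale1r mulKmx //; exact: iunitP.
have [rM|rM] := pselect (redm M = 0).
  have iM' := redm_eq0 iM rM.
  apply: (IH (pi^-1 *: M) y iM').
  - by rewrite scale_unitmx // invr_eq0.
  - rewrite detZ cvalM ?expf_neq0 ?invr_eq0 // expr2 cvalM ?invr_eq0 //.
    rewrite valV // val_uniformizer; move: vM; move: (cval _) => z; lia.
  - by rewrite -scalemxAr; apply: vtxZ; rewrite ?invr_eq0.
have [a [b [ab [M' iM' ME]]]] := lam_division iM dM rM.
have ul := phi_unit (qnorm_lam_neq0 ab).
have dME : \det M = \det (psi (lam a b)) * \det M' by rewrite ME det_mulmx.
have [l0 d'0] : \det (psi (lam a b)) != 0 /\ \det M' != 0.
  by move: d0; rewrite dME mulf_eq0 negb_or => /andP[].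
have uM' : M' \in unitmx by rewrite unitmxE unitfE.
have [y' y'M] : exists y', vtx (M0 *m M') y' by apply: vtx_mk; rewrite unitmx_mul uM0.
have [|s [ls sy]] := IH M' y' iM' uM' _ y'M.
  move: vM; rewrite dME cvalM //; case: (det_lam ab) => [/eqP|]; first by rewrite (negPf l0).
  by move: (cval _) (cval _) => z z'; clear; lia.
exists ((a, b) :: s); split.
  by move=> l; rewrite inE => /predU1P[->|/ls].
have e : phi (lam_prod ((a, b) :: s) : Q) = phi (lam a b) *m phi (lam_prod s) := phiM _ _.
rewrite e; apply: bt_image_comp sy _ => //; first exact: phi_unit (qnorm_lam_prod ls).
apply/(bt_image_vtx _ ul y'M).
by rewrite mulmxA -M0_psi -mulmxA -ME.
Qed.

Lemma letter_ex : exists a b, is_letter a b.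
Proof.
have w0 : (\col_(i < 2) 1 : 'cV[F]_2) != 0.
  by apply/matrix0Pn; exists 0, 0; rewrite mxE oner_neq0.
have [a [b [ab _]]] := letter_of_vector c_nonsquare tau0 rZZ rFF rFZ w0.
by exists a, b.
Qed.

End LocalQuaternions.

(** * Quaternions over the polynomial ring *)

Section PolynomialQuaternions.
Context (F : finFieldType) (c : F).
Hypothesis c_nonsquare : forall x : F, x ^+ 2 <> c.
Local Notation QP := (quat (c%:P : {poly F}) 'X).

Lemma anisotropic (a b : F) : a ^+ 2 - c * b ^+ 2 = 0 -> a = 0 /\ b = 0.
Proof.
move=> /eqP; rewrite subr_eq0 => /eqP e; have [b0|b0] := eqVneq b 0.
  by split=> //; apply/eqP; rewrite -sqrf_eq0 e b0 expr0n mulr0.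
by case: (@c_nonsquare (a / b)); rewrite exprMn e exprVn mulfK // sqrf_eq0.
Qed.

Lemma size_square (z : {poly F}) : z != 0 ->
  size (z ^+ 2) = (2 * size z).-1%N /\ (0 < size z)%N.
Proof. by move=> z0; rewrite expr2 size_mul // mul2n addnn size_poly_gt0. Qed.

(** The leading terms cannot cancel because [c] is not a square. When both polynomials vanish, the
    truncated predecessor gives the size 0. *)
Lemma size_anisotropic (x y : {poly F}) :
  size (x ^+ 2 - c%:P * y ^+ 2) = (2 * maxn (size x) (size y)).-1%N.
Proof.
pose n := maxn (size x) (size y); rewrite -/n.
have sx : (size x <= n)%N by rewrite leq_maxl.
have sy : (size y <= n)%N by rewrite leq_maxr.
have le (z : {poly F}) : (size z <= n)%N -> (size (z ^+ 2)%R <= (2 * n).-1)%N.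
  move=> sz; have [->|z0] := eqVneq z 0; first by rewrite expr0n size_poly0.
  by have [-> h] := size_square z0; move: sz h; clear; lia.
have [n0|n0] := posnP n.
  have x0 : x = 0 by apply/eqP; rewrite -size_poly_leq0 -n0.
  have y0 : y = 0 by apply/eqP; rewrite -size_poly_leq0 -n0.
  by rewrite x0 y0 !expr0n /= mulr0 subr0 size_poly0 n0.
have co (z : {poly F}) : (size z <= n)%N -> (z ^+ 2)`_(2 * n).-2%N = z`_n.-1 ^+ 2.
  move=> sz; have [e|e] := eqVneq (size z) n.
    have h := lead_coefM z z; rewrite /lead_coef -!expr2 e in h; rewrite -h; congr (_`_ _).
    have z0 : z != 0 by rewrite -size_poly_gt0 e.
    by have [-> _] := size_square z0; rewrite e.
  have s1 : (size z <= n.-1)%N by move: sz e n0; clear; lia.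
  rewrite (nth_default _ s1) expr0n /= nth_default //.
  have [->|z0] := eqVneq z 0; first by rewrite expr0n size_poly0.
  by have [-> h] := size_square z0; move: s1 n0 h; clear; lia.
apply/eqP; rewrite eqn_leq; apply/andP; split.
  apply: (leq_trans (size_polyD _ _)); rewrite size_polyN geq_max le //=.
  by rewrite mul_polyC; apply: (leq_trans (size_scale_leq _ _)); exact: le.
rewrite leqNgt; apply/negP => lt.
have : (x ^+ 2 - c%:P * y ^+ 2)`_((2 * n).-2)%N = 0.
  apply: nth_default.
  have h : (size (x ^+ 2 - c%:P * y ^+ 2)%R <= (2 * n).-2)%N by move: lt n0; clear; lia.
  exact: h.
rewrite coefB coefCM !co // => /anisotropic[xn yn].
have nl (z : {poly F}) : size z = n -> z`_n.-1 != 0.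
  by move=> e; rewrite -e -/(lead_coef z) lead_coef_eq0 -size_poly_gt0 e.
have : n = size x \/ n = size y by rewrite /n /maxn; case: ifP; [right|left].
by case=> /esym/nl; rewrite ?xn ?yn eqxx.
Qed.

(** The norm is [u - v * 'X], where a non-zero [u] has odd size and a non-zero [v * 'X] has even
    size. So no cancellation occurs, and size 1 forces [v = 0]. *)
Lemma qnorm_size_one (w : QP) : size (qnorm w) = 1%N ->
  [/\ qx2 w = 0, qx3 w = 0 & (size (qx1 w) <= 1)%N].
Proof.
pose u : {poly F} := qx0 w ^+ 2 - c%:P * qx1 w ^+ 2.
pose v : {poly F} := qx2 w ^+ 2 - c%:P * qx3 w ^+ 2.
have -> : qnorm w = u - v * 'X by rewrite /qnorm /u /v; ring.
move=> s1.
have v0 : v = 0.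
  apply: contraTeq isT => v0; have su := size_anisotropic (qx0 w) (qx1 w).
  have sv := size_anisotropic (qx2 w) (qx3 w).
  rewrite -/u in su; rewrite -/v in sv.
  have sX : size (v * 'X) = (size v).+1 by rewrite size_mulX.
  have v1 : (0 < size v)%N by rewrite size_poly_gt0.
  have [lt|lt|e] := ltngtP (size u) (size (v * 'X)).
  - move: s1; rewrite addrC size_polyDl ?size_polyN // sX => -[e].
    by rewrite e in v1.
  - move: s1; rewrite size_polyDl ?size_polyN // => e.
    by rewrite sX e in lt.
  - by move: v1 e; rewrite sX su sv; clear; lia.
have m0 : maxn (size (qx2 w)) (size (qx3 w)) = 0%N.
  by have := size_anisotropic (qx2 w) (qx3 w); rewrite -/v v0 size_poly0; clear; lia.
split.
- by apply/eqP; rewrite -size_poly_leq0 -m0 leq_maxl.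
- by apply/eqP; rewrite -size_poly_leq0 -m0 leq_maxr.
move: s1; rewrite v0 mul0r subr0 size_anisotropic; clear; lia.
Qed.

Definition plam (l : F * F) : QP := Quat _ _ 1 0 l.1%:P (- l.2%:P).

(* The components of plam l ^+ n are X_n, 0, l.1 Y_n and - l.2 Y_n. *)
Fixpoint lam_power (tau : F) (n : nat) : {poly F} * {poly F} :=
  if n is n'.+1 then
    let xy := lam_power tau n' in (xy.1 + tau^-1%:P * 'X * xy.2, xy.1 + xy.2)
  else (1, 0).

Lemma plam_power tau (l : F * F) n : is_letter c tau l.1 l.2 ->
  plam l ^+ n = Quat _ _ (lam_power tau n).1 0
    (l.1%:P * (lam_power tau n).2) (- l.2%:P * (lam_power tau n).2).
Proof.
rewrite /is_letter => lt; elim: n => [|n IH].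
  rewrite expr0; change (quat_one (c%:P : {poly F}) 'X = Quat _ _ 1 0 (l.1%:P * 0) (- l.2%:P * 0)).
  by rewrite !mulr0.
rewrite exprS IH quat_mulE [lam_power _ n.+1]/=; case: (lam_power tau n) => x y /=.
rewrite /quat_mul /plam -lt !expr2 polyCB !polyCM /=.
by congr Quat; ring.
Qed.

(** At ['X = tau] the recursion replaces both terms by their sum. In odd characteristic the second
    term is therefore non-zero, and no positive power of a letter is scalar. *)
Lemma lam_power_eval tau n : tau != 0 ->
  (lam_power tau n.+1).1.[tau] = 2 ^+ n /\ (lam_power tau n.+1).2.[tau] = 2 ^+ n.
Proof.
move=> t0; elim: n => [|n [h1 h2]].
  by rewrite /= mulr0 !addr0 !hornerE.
have -> : lam_power tau n.+2 = ((lam_power tau n.+1).1 + tau^-1%:P * 'X * (lam_power tau n.+1).2,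
  (lam_power tau n.+1).1 + (lam_power tau n.+1).2) by [].
move: (lam_power tau n.+1) h1 h2 => [x y] /= h1 h2.
by rewrite !hornerE h1 h2 mulVf // mul1r exprS mulrDl mul1r.
Qed.

End PolynomialQuaternions.

Section QuaternionMaps.
Context (A B : comNzRingType) (f : {rmorphism A -> B}) (c t : A).
Implicit Types x y : quat c t.

Lemma qnorm_map x : qnorm (quat_map f x) = f (qnorm x).
Proof. by rewrite /qnorm !expr2 !(rmorphD, rmorphN, rmorphM). Qed.

Lemma qscalar_map a : qscalar (f c) (f t) (f a) = quat_map f (qscalar c t a).
Proof. by rewrite /qscalar /quat_map /= !rmorph0. Qed.

Lemma quat_mapZ a x : quat_map f (a *: x) = f a *: quat_map f x.
Proof. by rewrite !quatZE /quat_map /quat_scale /= !rmorphM. Qed.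

Lemma quat_scaleAr a x y : x * (a *: y) = a *: (x * y).
Proof.
rewrite !quatZE !quat_mulE; case: x y => [????] [????].
by rewrite /quat_mul /quat_scale /=; congr Quat; ring.
Qed.

Lemma mulr_qscalar a x : x * qscalar c t a = a *: x.
Proof.
by rewrite quatZE quat_mulE; case: x => *; rewrite /quat_mul /quat_scale /=; congr Quat; ring.
Qed.
End QuaternionMaps.

(** * Polynomial representatives of the elements of Gamma *)

Section GlobalArithmetic.
Context (F : finFieldType) (c : F) (S : {set option F}).
Local Notation K := {fraction {poly F}}.
Local Notation D := (quat (kconst c) (kt F)).
Local Notation QP := (quat (c%:P : {poly F}) 'X).
Local Notation U := (global_unit c S).
Local Notation I := 'I_#|S0 S|.

Definition frac_quat (w : QP) : D := quat_map (@tofrac {poly F}) w.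

Lemma frac_quatM (w w' : QP) : frac_quat (w * w') = frac_quat w * frac_quat w'.
Proof. exact: (quat_mapM (@tofrac {poly F})). Qed.

Lemma place_in (i : I) : place i \in S0 S.
Proof. exact: enum_valP. Qed.

Lemma place_neq0 (i : I) : place i != 0.
Proof. by have := place_in i; rewrite inE => /andP[]. Qed.

Lemma place_inS (i : I) : Some (place i) \in S.
Proof. by have := place_in i; rewrite inE => /andP[]. Qed.

Lemma place_ex tau : tau \in S0 S -> exists i : I, place i = tau.
Proof. by move=> tS; exists (enum_rank_in tS tau); rewrite /place enum_rankK_in. Qed.

Lemma place_inj : injective (@place F S).
Proof. exact: enum_val_inj. Qed.

Definition place_poly : {poly F} := \prod_(tau in S0 S) ('X - tau%:P).

Lemma place_poly_neq0 : place_poly != 0.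
Proof. by apply/prodf_neq0 => tau _; rewrite polyXsubC_eq0. Qed.

(** At [t = 0] the quaternions reduce, modulo the generator [F], to the field [F_q[Z]]; the first
    two conditions put the reduced value into the non-zero constants. Letters reduce to 1. This
    excludes constants [a + b Z] with [b] non-zero, which fix every star without being scalar. *)
Definition good (w : QP) : Prop :=
  [/\ (qx0 w).[0] != 0, (qx1 w).[0] = 0 & exists k, qnorm w %| place_poly ^+ k].

Lemma good_norm w : good w -> qnorm w != 0.
Proof.
move=> [_ _ [k]]; apply: contraTneq => ->.
by rewrite dvd0p expf_neq0 // place_poly_neq0.
Qed.

Lemma good1 : good 1.
Proof.
split; [by rewrite /= hornerC oner_neq0|by rewrite /= horner0|exists 0%N].
by rewrite /qnorm /= !expr0n expr1n /= !mulr0 !subr0 addr0.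
Qed.

Lemma goodM w w' : good w -> good w' -> good (w * w').
Proof.
move=> [a0 a1 [k ak]] [b0 b1 [l bl]]; split; last first.
- by exists (k + l)%N; rewrite qnormM exprD dvdp_mul.
- rewrite quat_mulE; case: w w' a0 a1 b0 b1 {ak bl} => [????] [????] /= a0 a1 b0 b1.
  by rewrite !hornerE a1 b1; ring.
- rewrite quat_mulE; case: w w' a0 a1 b0 b1 {ak bl} => [x ???] [y ???] /= a0 a1 b0 b1.
  by have := mulf_neq0 a0 b0; congr (_ != 0); rewrite !hornerE a1 b1; ring.
Qed.

Lemma good_conj w : good w -> good (qconj w).
Proof.
move=> [a0 a1 ak]; split=> //=; first by rewrite hornerN a1 oppr0.
by rewrite /qnorm /= !sqrrN.
Qed.

Definition letter (i : I) : pred (F * F) :=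
  [pred l : F * F | l.1 ^+ 2 - c * l.2 ^+ 2 == (place i)^-1].

Lemma letterP i l : reflect (is_letter c (place i) l.1 l.2) (letter i l).
Proof. exact: eqP. Qed.

Lemma qnorm_plam i l : letter i l ->
  qnorm (plam c l) = (- (place i)^-1)%:P * ('X - (place i)%:P).
Proof.
move=> /eqP le; rewrite /qnorm /=.
transitivity (1 - 'X * (l.1%:P * l.1%:P - c%:P * (l.2%:P * l.2%:P)) : {poly F}); first by ring.
rewrite -!polyCM -polyCB -!expr2 le mulrBr -polyCM mulNr mulVf ?place_neq0 // !polyCN polyC1.
by ring.
Qed.

Lemma good_plam i l : letter i l -> good (plam c l).
Proof.
move=> le; split; [by rewrite /= hornerC oner_neq0|by rewrite /= horner0|exists 1%N].
rewrite (qnorm_plam le) mul_polyC dvdpZl ?oppr_eq0 ?invr_eq0 ?place_neq0 // expr1.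
by rewrite /place_poly (bigD1 (place i)) ?place_in //= dvdp_mulr.
Qed.

Definition poly_form (u : U) : Prop :=
  exists s w, [/\ s != 0, good w & frac_quat w = s *: gu_val u].

Lemma poly_form_scalar u v : scalar_equiv u v -> poly_form u -> poly_form v.
Proof.
move=> [r [r0 _ _ uv]] [s [w [s0 gw wE]]]; exists (s * r), w; split; [exact: (mulf_neq0 s0 r0)|exact: gw|].
by rewrite wE uv scalerA.
Qed.

Lemma poly_formM u v : poly_form u -> poly_form v -> poly_form (u * v)%g.
Proof.
move=> [s [w [s0 gw wE]]] [r [w' [r0 gw' wE']]]; exists (s * r), (w * w'); split.
- exact: (mulf_neq0 s0 r0).
- exact: goodM.
- by rewrite frac_quatM wE wE' scale_quatM.
Qed.

Lemma poly_formV u : poly_form u -> poly_form u^-1%g.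
Proof.
move=> [s [w [s0 gw wE]]]; have n0 := good_norm gw.
have tn0 : tofrac (qnorm w) != 0 :> K by rewrite tofrac_eq0.
have sV0 := invr_neq0 s0.
exists (s^-1 * tofrac (qnorm w)), (qconj w); split.
- exact: (mulf_neq0 sV0 tn0).
- exact: good_conj.
have e : frac_quat w * frac_quat (qconj w) = qscalar _ _ (tofrac (qnorm w)).
  by rewrite -frac_quatM mul_qconj /frac_quat -qscalar_map.
have {}e : s *: (gu_inv u * (gu_val u * frac_quat (qconj w))) = tofrac (qnorm w) *: gu_inv u.
  rewrite wE -scalerAl in e.
  have := congr1 (fun z => gu_inv u * z) e.
  rewrite mulr_qscalar => <-.
  by rewrite quat_scaleAr.
rewrite mulrA gu_Vmul mul1r in e.
change (frac_quat (qconj w) = (s^-1 * tofrac (qnorm w)) *: gu_inv u).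
by rewrite -[RHS](scalerA s^-1) -e [RHS](scalerA s^-1) (mulVf s0) scale1r.
Qed.

Definition glam (l : F * F) : D := frac_quat (plam c l).

(** Up to a constant the norm is ['X - place i], and that place belongs to [S]. *)
Lemma s_integers_normV i l : letter i l -> s_integers S (tofrac (qnorm (plam c l)))^-1.
Proof.
move=> le pi [pi1 pi_irr] piS; exists 1, (qnorm (plam c l)); split.
  by rewrite tofrac1 div1r.
rewrite (qnorm_plam le) mul_polyC dvdpZr ?oppr_eq0 ?invr_eq0 ?place_neq0 //.
apply/negP => pid; have := piS _ (place_inS i).
have : pi %= 'X - (place i)%:P.
  rewrite -(dvdp_size_eqp pid) size_XsubC eqn_leq pi1 andbT.
  by rewrite -(size_XsubC (place i)) dvdp_leq // polyXsubC_eq0.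
by move=> /eqp_root ->; rewrite root_XsubC eqxx.
Qed.

Lemma glam_order (w : QP) : global_order S (frac_quat w).
Proof. by split; exact: s_integers_poly. Qed.

Lemma global_orderZ s (x : D) : s_integers S s -> global_order S x -> global_order S (s *: x).
Proof. by move=> sS [x0 x1 x2 x3]; split; exact: s_integersM. Qed.

Lemma plam_conjV l : qconj (plam c l) * plam c l = qscalar _ _ (qnorm (plam c l)).
Proof.
have -> : qconj (plam c l) * plam c l = plam c l * qconj (plam c l); last exact: mul_qconj.
by rewrite !quat_mulE /qconj /quat_mul /=; congr Quat; ring.
Qed.

Definition letters (i : I) : finType := {l : F * F | letter i l}.

Section LetterUnit.
Context (i : I) (l : letters i).
Let n := qnorm (plam c (val l)).
Let nV : D := (tofrac n)^-1 *: frac_quat (qconj (plam c (val l))).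

Let n0 : tofrac n != 0.
Proof. by rewrite tofrac_eq0; apply: good_norm; exact: good_plam (valP l). Qed.

Let nVP : global_order S nV.
Proof. by apply: global_orderZ; [exact: s_integers_normV (valP l)|exact: glam_order]. Qed.

Let mulV : glam (val l) * nV = 1.
Proof.
rewrite /nV quat_scaleAr /glam -frac_quatM mul_qconj /frac_quat -qscalar_map -/n qscalarE.
by rewrite [LHS]scalerA (mulVf n0) scale1r.
Qed.

Let Vmul : nV * glam (val l) = 1.
Proof.
rewrite /nV -scalerAl /glam -frac_quatM plam_conjV /frac_quat -qscalar_map -/n qscalarE.
by rewrite [LHS]scalerA (mulVf n0) scale1r.
Qed.

Definition letter_unit : U := GlobalUnit (glam_order _) nVP mulV Vmul.
End LetterUnit.

Lemma fz_glam l : 1 + fz c l.1 l.2 * quat_F (kconst c) (kt F) = glam l.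
Proof.
have -> : fz c l.1 l.2 = Quat _ _ (kconst l.1) (kconst l.2) 0 0.
  change (quat_add (quat_scale (kconst l.1) (quat_one _ _))
    (quat_scale (kconst l.2) (quat_Z _ _)) = Quat (kconst c) (kt F) (kconst l.1) (kconst l.2) 0 0).
  by rewrite /quat_add /quat_scale /=; congr Quat; ring.
change (quat_add (quat_one _ _) (quat_mul (Quat (kconst c) (kt F) (kconst l.1) (kconst l.2) 0 0)
  (quat_F _ _)) = quat_map (@tofrac {poly F}) (plam c l)).
rewrite /quat_add /quat_mul /quat_map /plam /= tofrac1 tofrac0 tofracN.
by congr Quat; rewrite /kconst; ring.
Qed.

Lemma letter_Gamma i (l : letters i) : in_Gamma (letter_unit l).
Proof.
move=> H _ _ _; apply; exists (place i); first exact: place_in.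
exists (val l).1, (val l).2, (letter_unit l); split=> //; first exact/eqP/(valP l).
by rewrite fz_glam.
Qed.

(** [gen_subgroup] is an intersection of subgroups, and it is tested here on the classes that have a
    good representative. *)
Lemma in_Gamma_poly u : in_Gamma u -> poly_form u.
Proof.
move=> Gu; pose H : set (Lambda c S) := [set g | exists2 u, g = lclass u & poly_form u].
suff [v /lclassP uv pv] : H (lclass u).
  by apply: poly_form_scalar pv; apply/lclassP/esym/lclassP.
have tq1 : frac_quat 1 = 1 :> D := quat_map1 (@tofrac {poly F}) _ _.
have k10 : (1 : K) != 0 := oner_neq0 _.
apply: Gu.
- exists 1%g => //; exists 1, 1; split; [exact: k10|exact: good1|].
  by rewrite scale1r.
- move=> x y [v -> pv] [w -> pw]; exists (v * w)%g; first by rewrite lclassM.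
  exact: poly_formM.
- by move=> x [v -> pv]; exists v^-1%g; [rewrite lclassV|exact: poly_formV].
- move=> g [tau tS [a [b [v [ab vE ->]]]]]; exists v => //.
  have [i it] := place_ex tS.
  exists 1, (plam c (a, b)); split; first exact: k10.
    by apply: (@good_plam i); apply/letterP; rewrite it; exact: ab.
  by rewrite scale1r vE; exact: esym (fz_glam (a, b)).
Qed.

End GlobalArithmetic.

(** * The action on the product of trees *)

Lemma bt_imageZ (F : finFieldType) (tau : F) (Kv : completion tau) (g : 'M[Kv]_2) a x y :
  g \in unitmx -> a != 0 -> bt_image g x y -> bt_image (a *: g) x y.
Proof.
move=> ug a0 gxy; have [M xM] := vtx_ex x.
have uag : a *: g \in unitmx by rewrite scale_unitmx.
apply/(bt_image_vtx _ uag xM); rewrite -scalemxAl; apply: vtxZ => //.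
exact/(bt_image_vtx _ ug xM).
Qed.

Section TreeAction.
Context (F : finFieldType) (c : F) (S : {set option F}).
Hypothesis two : (2 : F) != 0.
Hypothesis c_nonsquare : forall x : F, x ^+ 2 <> c.
Context (Kv : forall i : 'I_#|S0 S|, completion (place i)).
Context (phi : forall i, {lrmorphism local_quat (Kv i) c -> 'M[Kv i]_2}).
Hypothesis phi_bij : forall i, bijective (phi i).
Context (star : forall i, bt_tree (Kv i)).
Hypothesis star_fixed : forall i (w w' : local_quat (Kv i) c),
  quat_order (local_integers (Kv := Kv i)) w ->
  quat_order (local_integers (Kv := Kv i)) w' ->
  w * w' = 1 -> w' * w = 1 -> bt_image (phi i w) (star i) (star i).
Context (p : forall i, bt_tree (Kv i) -> bool).
Hypothesis p_edge : forall i, edge_map (@p i).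
Local Notation K := {fraction {poly F}}.
Local Notation D := (quat (kconst c) (kt F)).
Local Notation QP := (quat (c%:P : {poly F}) 'X).
Local Notation U := (global_unit c S).
Local Notation I := 'I_#|S0 S|.
Local Notation T i := (bt_tree (Kv i)).

Definition loc i (x : D) : local_quat (Kv i) c := quat_map (cemb (Kv i)) x.

Lemma locM i (x y : D) : loc i (x * y) = loc i x * loc i y.
Proof. exact: (quat_mapM (cemb (Kv i))). Qed.

Lemma loc1 i : loc i 1 = 1.
Proof. exact: (quat_map1 (cemb (Kv i))). Qed.

Lemma loc_glam i l : loc i (glam c l) = lam c (Kv i) l.1 l.2.
Proof.
rewrite /loc /glam /frac_quat /quat_map /lam /=.
by congr Quat; rewrite ?tofrac1 ?tofrac0 ?tofracN ?rmorph1 ?rmorph0 ?rmorphN.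
Qed.

Definition mat i (u : U) : 'M[Kv i]_2 := phi i (loc i (gu_val u)).

Lemma matM i (u v : U) : mat i (u * v)%g = mat i u *m mat i v.
Proof. by rewrite /mat -phiM -locM. Qed.

Lemma mat1 i : mat i 1%g = 1%:M.
Proof. by rewrite /mat loc1; exact: rmorph1. Qed.

Lemma mat_unit i (u : U) : mat i u \in unitmx.
Proof.
have : mat i u *m mat i u^-1%g = 1%:M by rewrite -matM mulgV mat1.
by move=> /mulmx1_unit[].
Qed.

Definition act (u : U) i (x : T i) : T i := sval (cid (bt_image_ex x (mat_unit i u))).

Lemma act_image u i (x : T i) : bt_image (mat i u) x (act u x).
Proof. exact: svalP (cid _). Qed.

Lemma actE u i (x y : T i) : tree_act (fun i => phi i) u x y <-> y = act u x.
Proof.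
split=> [uxy|->]; last exact: act_image.
exact: (bt_image_fun uxy (act_image u x)).
Qed.

Lemma act1 i (x : T i) : act 1%g x = x.
Proof. by apply/esym/actE; rewrite /tree_act -/(mat i 1%g) mat1; exact: bt_image1. Qed.

Lemma actM u v i (x : T i) : act (u * v)%g x = act u (act v x).
Proof.
apply/esym/actE; rewrite /tree_act -/(mat i (u * v)%g) matM.
by apply: bt_image_comp (act_image v x) (act_image u _); exact: mat_unit.
Qed.

Lemma act_scalar_equiv u v i (x : T i) : scalar_equiv u v -> act u x = act v x.
Proof.
move=> [s [s0 _ _ uv]]; apply/esym/actE; rewrite /tree_act uv.
have -> : quat_map (cemb (Kv i)) (s *: gu_val v) = cemb (Kv i) s *: loc i (gu_val v).
  exact: (quat_mapZ (cemb (Kv i))).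
rewrite linearZ; apply: bt_imageZ; [exact: mat_unit| |exact: act_image].
by rewrite fmorph_eq0.
Qed.

Lemma act_lclass u v i (x : T i) : lclass u = lclass v -> act u x = act v x.
Proof. by move=> /lclassP; exact: act_scalar_equiv. Qed.

Lemma act_adj u i (x y : T i) : adj x y -> adj (act u x) (act u y).
Proof. by apply: bt_image_adj; [exact: mat_unit|exact: act_image..]. Qed.

Definition wprod i (s : seq (letters c i)) : U := foldr (fun l u => letter_unit l * u)%g 1%g s.

Lemma wprod_Gamma i (s : seq (letters c i)) : in_Gamma (wprod s).
Proof.
elim: s => [|l s IH] /=; first exact: in_Gamma1.
by apply: in_GammaM => //; exact: letter_Gamma.
Qed.

Lemma reach i (x : T i) : exists s : seq (letters c i), x = act (wprod s) (star i).
Proof.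
have [M sM] := vtx_ex (star i).
have [s [ls sx]] := star_reach two c_nonsquare (place_neq0 i) (@star_fixed i) sM x.
have [s' s'E] : exists s' : seq (letters c i), s = map val s'.
  elim: s ls {sx} => [|l s IH] ls; first by exists [::].
  have [k ks|s' ->] := IH; first by apply: ls; rewrite inE ks orbT.
  have /letterP ll := ls l (mem_head _ _).
  by exists (exist _ l ll :: s').
exists s'; apply/actE; rewrite /tree_act; move: sx; rewrite s'E.
suff -> : lam_prod c (Kv i) (map val s') = loc i (gu_val (wprod s')) by [].
elim: s' {s'E} => [|l s' IH] /=; first exact: esym (loc1 i).
by rewrite IH -loc_glam; exact: esym (locM i _ _).
Qed.

Lemma letter_adj i (l : letters c i) : adj (star i) (act (letter_unit l) (star i)).
Proof.
have [M sM] := vtx_ex (star i).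
have /letterP ll := valP l.
apply: (lam_adj two c_nonsquare (place_neq0 i) (@star_fixed i) sM ll).
by rewrite -loc_glam; exact: act_image.
Qed.

Lemma adj_letter i (y : T i) : adj (star i) y -> exists l : letters c i, y = act (letter_unit l) (star i).
Proof.
have [M sM] := vtx_ex (star i) => sy.
have [a [b [ab aby]]] := adj_lam two c_nonsquare (place_neq0 i) (@star_fixed i) sM sy.
have ll : letter c i (a, b) by exact/letterP.
by exists (exist _ (a, b) ll); apply/actE; rewrite /tree_act /= -/(loc _ _) loc_glam.
Qed.

Lemma exists_letter (i : I) : exists l : letters c i, True.
Proof.
have [M sM] := vtx_ex (star i).
have [a [b ab]] := letter_ex c_nonsquare (place_neq0 i) (@star_fixed i) sM.
have ll : letter c i (a, b) by exact/letterP.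
by exists (exist _ (a, b) ll).
Qed.

(** Away from its own place the norm of the letter is a unit, so the letter and its inverse both lie
    in the local order. *)
Lemma letter_other i (l : letters c i) k : k != i -> act (letter_unit l) (star k) = star k.
Proof.
move=> ki; apply/esym/actE; rewrite /tree_act -/(loc k _).
apply: (@star_fixed k _ (loc k (gu_inv (letter_unit l)))).
- by split; exact: int_tofrac.
- pose n := cemb (Kv k) (tofrac (qnorm (plam c (val l)))).
  have [_ nO] : n != 0 /\ local_integers n^-1.
    apply: unit_intV; first exact: int_tofrac.
    move=> /max_tofrac; rewrite (qnorm_plam (valP l)) rootM rootC root_XsubC.
    rewrite oppr_eq0 invr_eq0 (negPf (place_neq0 i)) /= => /eqP /place_inj /eqP.
    by rewrite (negPf ki).
  have h w : local_integers (cemb (Kv k) ((tofrac (qnorm (plam c (val l))))^-1 * tofrac w)).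
    by rewrite rmorphM fmorphV; apply: intM => //; exact: int_tofrac.
  by split; exact: h.
- by rewrite -locM gu_mulV loc1.
- by rewrite -locM gu_Vmul loc1.
Qed.

Lemma wprod_other i (s : seq (letters c i)) k : k != i -> act (wprod s) (star k) = star k.
Proof.
by move=> ki; elim: s => [|l s IH] /=; rewrite ?act1 // actM IH letter_other.
Qed.

(** The places are corrected one at a time: a word at the place [k], multiplied on the right, does
    not disturb the stars of the others. *)
Lemma act_trans (x : forall i, T i) : exists2 u, in_Gamma u & forall i, x i = act u (star i).
Proof.
suff key (s : seq I) : uniq s -> exists2 u, in_Gamma u & forall i, i \in s -> x i = act u (star i).
  by have [u Gu uE] := key _ (enum_uniq I); exists u => // i; apply: uE; rewrite mem_enum.
elim: s => [|k s IH] /=; first by exists 1%g => //; exact: in_Gamma1.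
move=> /andP[ks /IH[u Gu uE]]; have [w wE] := reach (act u^-1%g (x k)).
exists (u * wprod w)%g; first by apply: in_GammaM => //; exact: wprod_Gamma.
move=> i; rewrite inE actM => /predU1P[->|is_].
  by rewrite -wE -actM mulgV act1.
rewrite wprod_other; first exact: uE.
by apply: contraNneq ks => <-.
Qed.

Lemma tree_connected i (P : T i -> Prop) :
  P (star i) -> (forall x y, adj x y -> P x -> P y) -> forall x, P x.
Proof.
move=> P0 Padj x; have [s ->] := reach x.
suff key u : P (act u (star i)) -> P (act u (act (wprod s) (star i))).
  by rewrite -[act _ _]act1; apply: key; rewrite act1.
elim: s u => [|l s IH] u Pu /=; first by rewrite act1.
rewrite actM -actM; apply: IH; rewrite actM.
by apply: Padj Pu; apply: act_adj; exact: letter_adj.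
Qed.

(** Types alternate along edges and the tree is connected, so the change observed at [star i] is the
    change everywhere. *)
Lemma act_type u i : exists s, forall x : T i, p (act u x) = p x (+) s.
Proof.
exists (p (act u (star i)) (+) p (star i)); apply: tree_connected.
  by rewrite addbCA addbb addbF.
by move=> x y xy h; rewrite (p_edge (act_adj u xy)) h (p_edge xy) addNb.
Qed.

Lemma qnorm_loc i w : qnorm (loc i (frac_quat w)) = cemb (Kv i) (tofrac (qnorm w)).
Proof.
by rewrite /loc (qnorm_map (cemb (Kv i))) /frac_quat (qnorm_map (@tofrac {poly F})).
Qed.

Lemma qnorm_loc_neq0 i w : good S w -> qnorm (loc i (frac_quat w)) != 0.
Proof. by move=> gw; rewrite qnorm_loc fmorph_eq0 tofrac_eq0; exact: good_norm gw. Qed.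

Lemma good_divide (i : I) (w : QP) : good S w -> root (qx0 w) (place i) -> root (qx1 w) (place i) ->
  root (qx2 w) (place i) -> root (qx3 w) (place i) ->
  exists w' : QP, [/\ w = ('X - (place i)%:P) *: w', good S w' &
    qnorm w = ('X - (place i)%:P) ^+ 2 * qnorm w'].
Proof.
move=> [w0 w1 [k wk]] /factor_theorem[q0 e0] /factor_theorem[q1 e1].
move=> /factor_theorem[q2 e2] /factor_theorem[q3 e3].
have e : w = ('X - (place i)%:P) *: (Quat _ _ q0 q1 q2 q3 : QP).
  rewrite quatZE /quat_scale /= ![_ * q0]mulrC ![_ * q1]mulrC ![_ * q2]mulrC ![_ * q3]mulrC.
  by rewrite -e0 -e1 -e2 -e3; case: (w).
have n : qnorm w = ('X - (place i)%:P) ^+ 2 * qnorm (Quat _ _ q0 q1 q2 q3 : QP).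
  by rewrite /qnorm e0 e1 e2 e3 /=; ring.
exists (Quat _ _ q0 q1 q2 q3); split=> //; split=> /=.
- by apply: contra_neq w0; rewrite e0 hornerM => ->; rewrite mul0r.
- move: w1; rewrite e1 hornerM hornerXsubC sub0r => /eqP.
  by rewrite mulf_eq0 oppr_eq0 (negPf (place_neq0 i)) orbF => /eqP.
- by exists k; apply: dvdp_trans wk; rewrite n dvdp_mull.
Qed.

(** Descent on the degree of the norm. At a root of the norm [fixed_norm_unit] makes [w] divisible
    by the linear factor, and the quotient acts in the same way. A norm without such roots is
    constant; then [w] is a constant in [F_q[Z]] up to its first coordinate, and the condition at 0
    in [good] removes the [Z] part. *)
Lemma fixed_scalar (w : QP) : good S w ->
  (forall i, bt_image (phi i (loc i (frac_quat w))) (star i) (star i)) ->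
  [/\ qx1 w = 0, qx2 w = 0 & qx3 w = 0].
Proof.
elim: {w}_.+1 {-2}w (ltnSn (size (qnorm w))) => // n IH w wn gw fw.
have [[i ri]|nr] := pselect (exists i : I, root (qnorm w) (place i)); last first.
  have : size (qnorm w) = 1%N.
    have [_ _ [k wk]] := gw; apply/eqP; rewrite size_poly_eq1.
    have : coprimep (qnorm w) (place_poly S ^+ k).
      apply: coprimep_expr; apply: (big_ind (fun q => coprimep (qnorm w) q)).
      - exact: coprimep1.
      - by move=> x y wx wy; rewrite coprimepMr wx.
      - move=> tau /place_ex[i it]; rewrite coprimep_XsubC -it.
        by apply/negP => ri; apply: nr; exists i.
    by move=> /coprimepP; apply.
  move=> /(qnorm_size_one c_nonsquare)[-> -> s1]; split=> //.
  have [_ w1 _] := gw; move: w1; rewrite (size1_polyC s1) hornerC => ->.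
  by rewrite polyC0.
have [M sM] := vtx_ex (star i).
have ow : quat_order (local_integers (Kv := Kv i)) (loc i (frac_quat w)).
  by split; exact: int_tofrac.
have [] := fixed_norm_unit two c_nonsquare (place_neq0 i) (@star_fixed i) sM ow
  (qnorm_loc_neq0 i gw) (fw i).
  by rewrite qnorm_loc; apply/max_tofrac.
move=> /max_tofrac r0 /max_tofrac r1 /max_tofrac r2 /max_tofrac r3.
have [w' [we gw' ne]] := good_divide gw r0 r1 r2 r3.
have X0 : 'X - (place i)%:P != 0 by rewrite polyXsubC_eq0.
have [] := IH w' _ gw'.
- move: wn; rewrite ne size_mul ?expf_neq0 ?(good_norm gw') // size_exp_XsubC /=.
  by rewrite !addSn add0n /= ltnS; exact: leq_trans.
- move=> k; pose a := cemb (Kv k) (tofrac ('X - (place i)%:P)).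
  have a0 : a != 0 by rewrite fmorph_eq0 tofrac_eq0.
  have e : loc k (frac_quat w) = a *: loc k (frac_quat w').
    rewrite we /frac_quat /loc (quat_mapZ (@tofrac {poly F})); exact: (quat_mapZ (cemb (Kv k))).
  have -> : phi k (loc k (frac_quat w')) = a^-1 *: phi k (loc k (frac_quat w)).
    by rewrite e linearZ /= scalerA mulVf // scale1r.
  apply: bt_imageZ => //; last by rewrite invr_eq0.
  by apply: phi_unit; exact: qnorm_loc_neq0.
by move=> h1 h2 h3; rewrite we /= h1 h2 h3 !mulr0.
Qed.

Lemma act_poly u s (w : QP) : s != 0 -> frac_quat w = s *: gu_val u ->
  forall i (x y : T i), bt_image (phi i (loc i (frac_quat w))) x y <-> y = act u x.
Proof.
move=> s0 wE i x y; have s'0 : cemb (Kv i) s != 0 by rewrite fmorph_eq0.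
have e : phi i (loc i (frac_quat w)) = cemb (Kv i) s *: mat i u.
  rewrite wE; have -> : loc i (s *: gu_val u) = cemb (Kv i) s *: loc i (gu_val u).
    exact: (quat_mapZ (cemb (Kv i))).
  by rewrite linearZ.
have ime : bt_image (phi i (loc i (frac_quat w))) x (act u x).
  by rewrite e; apply: bt_imageZ => //; [exact: mat_unit|exact: act_image].
by split=> [h|-> //]; exact: (bt_image_fun h ime).
Qed.

Lemma scalar_act (w : QP) : good S w -> [/\ qx1 w = 0, qx2 w = 0 & qx3 w = 0] ->
  forall i (x : T i), bt_image (phi i (loc i (frac_quat w))) x x.
Proof.
move=> gw [h1 h2 h3] i x; have n0 := qnorm_loc_neq0 i gw.
have e : loc i (frac_quat w) = qscalar _ _ (cemb (Kv i) (tofrac (qx0 w))).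
  by rewrite /loc /frac_quat /quat_map /= h1 h2 h3 !tofrac0 !rmorph0.
have a0 : cemb (Kv i) (tofrac (qx0 w)) != 0.
  have [w0 _ _] := gw; rewrite fmorph_eq0 tofrac_eq0.
  by apply: contra_neq w0 => ->; rewrite horner0.
rewrite e phi_scalar -scalemx1.
by apply: bt_imageZ => //; [exact: unitmx1|exact: bt_image1].
Qed.

Lemma act_free_star u : in_Gamma u -> (forall i, act u (star i) = star i) ->
  forall i (x : T i), act u x = x.
Proof.
move=> /in_Gamma_poly[s [w [s0 gw wE]]] uf i x.
apply/esym/(act_poly s0 wE); apply: scalar_act => //; apply: fixed_scalar => // k.
by apply/(act_poly s0 wE).
Qed.

(** The non-scalar coordinates of [w * w] are [2 * qx0 w] times those of [w], and [qx0 w] is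
    non-zero because [w] is good. This rules out elements that invert edges. *)
Lemma act_square u : in_Gamma u -> (forall i (x : T i), act u (act u x) = x) ->
  forall i (x : T i), act u x = x.
Proof.
move=> Gu uf i x; have [s [w [s0 gw wE]]] := in_Gamma_poly Gu.
apply/esym/(act_poly s0 wE); apply: scalar_act => //.
have gww := goodM gw gw.
have e : frac_quat (w * w) = (s * s) *: gu_val (u * u)%g by rewrite frac_quatM wE scale_quatM.
have [] : [/\ qx1 (w * w) = 0, qx2 (w * w) = 0 & qx3 (w * w) = 0].
  apply: fixed_scalar => // k; apply/(act_poly (mulf_neq0 s0 s0) e).
  by rewrite actM uf.
have w0 : 2 * qx0 w != 0.
  rewrite mulf_neq0 //; first by rewrite -polyC1 -rmorphMn polyC_eq0.
  by have [w0 _ _] := gw; apply: contra_neq w0 => ->; rewrite horner0.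
have k (z : {poly F}) : 2 * qx0 w * z = 0 -> z = 0.
  by move=> /eqP; rewrite mulf_eq0 (negPf w0) => /eqP.
move: k; rewrite quat_mulE; case: (w) => a0 a1 a2 a3 /= k h1 h2 h3.
by split; apply: k; [rewrite -h1|rewrite -h2|rewrite -h3]; ring.
Qed.

(** Conjugation moves the given vertices to the stars. The square of the conjugate then fixes all
    stars, so it acts trivially, and [act_square] applies. *)
Lemma act_free u : in_Gamma u ->
  (forall i, exists x : T i, act u (act u x) = x) -> forall i (x : T i), act u x = x.
Proof.
move=> Gu uf i x.
have [y yE] : exists y : forall i, T i, forall i, act u (act u (y i)) = y i.
  by exists (fun i => sval (cid (uf i))) => k; exact: svalP (cid (uf k)).
have [g Gg gE] := act_trans y.
pose v := (g^-1 * u * g)%g.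
have Gv : in_Gamma v by do ![apply: in_GammaM => //]; exact: in_GammaV.
have gK k (z : T k) : act g^-1%g (act g z) = z by rewrite -actM mulVg act1.
have gVK k (z : T k) : act g (act g^-1%g z) = z by rewrite -actM mulgV act1.
have vf k : act (v * v)%g (star k) = star k.
  by rewrite !actM -gE gVK yE gE gK.
have vv := act_free_star (in_GammaM Gv Gv) vf.
have v1 : act v (act g^-1%g x) = act g^-1%g x.
  by apply: act_square => // k z; rewrite -actM vv.
by move: (congr1 (fun z => act g z) v1); rewrite !actM !gVK.
Qed.

(** An element that fixes the whole tree at [j] has a scalar matrix, hence is a scalar quaternion
    since [phi] is injective. The last two coordinates of a power of the letter are multiples of
    those of the letter by a non-zero polynomial, and the letter is not scalar. *)
Lemma letter_power_moves i (l : letters c i) n j : (0 < n)%N ->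
  exists x : T j, act (letter_unit l ^+ n)%g x <> x.
Proof.
case: n => // n _; apply: contrapT => nx.
have fx (x : T j) : act (letter_unit l ^+ n.+1)%g x = x.
  by apply: contrapT => h; apply: nx; exists x.
have ve m : gu_val (letter_unit l ^+ m)%g = frac_quat (plam c (val l) ^+ m).
  elim: m => [|m IH]; first by rewrite expr0; exact: esym (quat_map1 (@tofrac {poly F}) _ _).
  by rewrite expgS exprS frac_quatM -IH.
have [a ae] : exists a, mat j (letter_unit l ^+ n.+1)%g = a%:M.
  apply: fix_all_scalar; first exact: mat_unit.
  by move=> x; rewrite -{2}(fx x); exact: act_image.
have : loc j (gu_val (letter_unit l ^+ n.+1)%g) = qscalar _ _ a.
  by apply: (bij_inj (@phi_bij j)); rewrite phi_scalar.
have /letterP ll := valP l.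
rewrite ve (plam_power _ ll) => /(congr1 (fun w => (qx2 w, qx3 w))) /= [].
have [_ y0] := lam_power_eval n (place_neq0 i).
set y := (lam_power _ n.+1).2 in y0 *.
have {}y0 : y != 0.
  by apply: contra_eq_neq y0 => ->; rewrite horner0 eq_sym expf_neq0.
have emb0 (z : {poly F}) : cemb (Kv j) (tofrac z) = 0 -> z = 0.
  by move=> /eqP; rewrite fmorph_eq0 tofrac_eq0 => /eqP.
have cy0 b : b%:P * y = 0 -> b = 0.
  by move=> /eqP; rewrite mulf_eq0 (negPf y0) orbF polyC_eq0 => /eqP.
move=> /emb0/cy0 a0 /emb0; rewrite -polyCN => /cy0/eqP; rewrite oppr_eq0 => /eqP b0.
move: ll; rewrite /is_letter a0 b0 !expr0n /= mulr0 subrr => /esym/eqP.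
by rewrite invr_eq0 (negPf (place_neq0 i)).
Qed.

End TreeAction.

(** * Edge loops of the double *)

Section Letters.
Context (R : realType) (F : finFieldType) (c : F) (S : {set option F}).
Context (Kv : forall i : 'I_#|S0 S|, completion (place i)).
Context (phi : forall i, local_quat (Kv i) c -> 'M[Kv i]_2).
Context (p : forall i, bt_tree (Kv i) -> bool).
Context (p_edge : forall i, edge_map (@p i)).
Local Notation U := (global_unit c S).
Local Notation I := 'I_#|S0 S|.
Local Notation T i := (bt_tree (Kv i)).
Context (act : U -> forall i, T i -> T i).
Hypothesis actE : forall u i (x y : T i), tree_act phi u x y <-> y = act u x.
Hypothesis act1 : forall i (x : T i), act 1%g x = x.
Hypothesis actM : forall u v i (x : T i), act (u * v)%g x = act u (act v x).
Hypothesis act_lclass : forall u v i (x : T i), lclass u = lclass v -> act u x = act v x.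
Hypothesis act_adj : forall u i (x y : T i), adj x y -> adj (act u x) (act u y).
Hypothesis act_type : forall u i, in_Gamma u ->
  exists s, forall x : T i, p (act u x) = p x (+) s.
Hypothesis act_free : forall u, in_Gamma u ->
  (forall i, exists x : T i, act u (act u x) = x) -> forall i (x : T i), act u x = x.
Context (star : forall i, T i).
Hypothesis p_star : forall i, p (star i) = false.
Hypothesis act_trans : forall x : forall i, T i,
  exists2 u, in_Gamma u & forall i, x i = act u (star i).
Hypothesis act_free_star : forall u, in_Gamma u ->
  (forall i, act u (star i) = star i) -> forall i (x : T i), act u x = x.
Context (L : I -> finType) (gl : forall i, L i -> U).
Hypothesis letter_Gamma : forall i (l : L i), in_Gamma (gl l).
Hypothesis letter_adj : forall i (l : L i), adj (star i) (act (gl l) (star i)).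
Hypothesis adj_letter : forall i (y : T i), adj (star i) y ->
  exists l : L i, y = act (gl l) (star i).
Hypothesis letter_other : forall i (l : L i) k, k != i -> act (gl l) (star k) = star k.
Hypothesis exists_letter : forall i, exists l : L i, True.
Hypothesis reach : forall i (x : T i), exists s : seq (L i),
  x = act (foldr (fun l u => gl l * u)%g 1%g s) (star i).
Hypothesis letter_power_moves : forall i (l : L i) n j, (0 < n)%N ->
  exists x : T j, act (gl l ^+ n)%g x <> x.

Local Notation Dbl := (cube_double phi p_edge).
Context (v : Dbl 0%N).

Let actKV u i (x : T i) : act u^-1%g (act u x) = x.
Proof. by rewrite -actM mulVg act1. Qed.

Let actVK u i (x : T i) : act u (act u^-1%g x) = x.
Proof. by rewrite -actM mulgV act1. Qed.

(** Replaces equality in [Gamma]: scalars act trivially on the trees, so cells of the double cannot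
    see them. *)
Definition eqact (u u' : U) : Prop := forall i (x : T i), act u x = act u' x.

Lemma eqact_star u u' : in_Gamma u -> in_Gamma u' ->
  (forall k, act u (star k) = act u' (star k)) -> eqact u u'.
Proof.
move=> Gu Gu' uu i x; have e : act (u^-1 * u')%g x = x.
  apply: act_free_star => [|k]; first by apply: in_GammaM => //; exact: in_GammaV.
  by rewrite actM -uu actKV.
by rewrite -{1}e actM actVK.
Qed.

Lemma letter_type i (l : L i) k (x : T k) : p (act (gl l) x) = p x (+) (k == i).
Proof.
have [s sE] := act_type k (letter_Gamma l); rewrite sE; congr (_ (+) _).
have := sE (star k); have [ki|ki] := eqVneq k i; last first.
  by rewrite letter_other // p_star; case: s {sE}.
by subst k; rewrite (p_edge (letter_adj l)) p_star; case: s {sE}.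
Qed.

(** The two ways round a square of the product of trees. As [l] fixes the star at [i], it sends the
    neighbour given by [m] to another neighbour, which defines [a]; then [n] is read off at [j], and
    [eqact_star] compares the products. *)
Lemma letter_swap i j (l : L j) (m : L i) : j != i ->
  exists (a : L i) (n : L j), eqact (gl l * gl m)%g (gl a * gl n)%g.
Proof.
move=> ji; have ij : i != j by rewrite eq_sym.
have [a aE] : exists a : L i, act (gl l) (act (gl m) (star i)) = act (gl a) (star i).
  by apply: adj_letter; rewrite -{1}(letter_other l ij); apply: act_adj; exact: letter_adj.
have aj : act (gl a)^-1%g (star j) = star j by rewrite -{1}(letter_other a ji) actKV.
have [n nE] : exists n : L j, act (gl a)^-1%g (act (gl l) (star j)) = act (gl n) (star j).
  by apply: adj_letter; rewrite -{1}aj; apply: act_adj; exact: letter_adj.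
exists a, n; apply: eqact_star; [by apply: in_GammaM; exact: letter_Gamma..|] => k.
rewrite !actM; have [ki|ki] := eqVneq k i; first by subst k; rewrite (letter_other n ij).
have [kj|kj] := eqVneq k j; first by subst k; rewrite (letter_other m ji) -nE actVK.
by rewrite !letter_other.
Qed.

Lemma letter_inv i (l : L i) : exists m : L i, eqact (gl m) (gl l)^-1%g.
Proof.
have [m mE] : exists m : L i, act (gl l)^-1%g (star i) = act (gl m) (star i).
  apply: adj_letter; rewrite -{1}[star i](actKV (gl l)); apply/act_adj/adj_sym.
  exact: letter_adj.
exists m; apply: eqact_star; [exact: letter_Gamma|by apply: in_GammaV; exact: letter_Gamma|] => k.
have [ki|ki] := eqVneq k i; first by subst k.
by rewrite letter_other // -{2}(letter_other l ki) actKV.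
Qed.

Definition movable (u u' : U) : Prop :=
  [/\ in_Gamma u, in_Gamma u' & same_type p act u u'].

Lemma movable1 : movable 1%g 1%g.
Proof. by split=> //; exact: in_Gamma1. Qed.

Lemma movableM u u' w w' : movable u u' -> movable w w' -> movable (u * w)%g (u' * w')%g.
Proof.
move=> [Gu Gu' uu] [Gw Gw' ww]; split; [exact: in_GammaM..|] => i x.
have [s sE] := act_type i Gu'; by rewrite !actM uu !sE ww.
Qed.

Lemma movableV u u' : movable u u' -> movable u^-1%g u'^-1%g.
Proof. by move=> [Gu Gu' uu]; split; [exact: in_GammaV..|exact: same_typeV]. Qed.

Lemma movable_letter i (l l' : L i) : movable (gl l) (gl l').
Proof. by split=> // k x; rewrite !letter_type. Qed.

Definition motion_of u u' (h : movable u u') : motion p act := exist _ (u, u') h.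

Lemma letter_edge_subproof i (l : L i) :
  is_param_cube (fun (a : signs 1) k => if a ord0 then act (gl l) (star k) else star k).
Proof.
exists (fun=> i); split.
- by move=> x y _; rewrite !ord1.
- move=> k; exists (star i), (act (gl l) (star i)); split; first exact: letter_adj.
  by move=> a; rewrite (ord1 k).
- move=> k ki; exists (star k) => a; case: (a ord0) => //.
  by apply: letter_other; apply/eqP => e; apply: (ki ord0).
Qed.

Definition letter_edge i (l : L i) : tree_product Kv 1%N :=
  exist _ _ (letter_edge_subproof l).

Lemma letter_edge_types i (l l' : L i) : same_types p (letter_edge l) (letter_edge l').
Proof. by move=> a k /=; case: (a ord0); rewrite ?letter_type. Qed.

Definition letter_cell i (l l' : L i) : Dbl 1%N :=
  sval (cid (rep_pair_mk phi p_edge (letter_edge_types l l'))).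

Lemma letter_cellP i (l l' : L i) : rep_pair (letter_cell l l') (letter_edge l) (letter_edge l').
Proof. by rewrite /letter_cell; case: cid. Qed.

Let one_vertex := double_one_vertex (p_edge := p_edge) actE act1 actM act_lclass act_adj
  act_type act_trans.

Definition rho i (l l' : L i) : pi1 R (base R v) :=
  edge_class R one_vertex v (letter_cell l l').

(** Two pairs of edges that differ by a motion represent the same cell of the double. *)
Lemma rho_mv i (l l' : L i) u u' (z : Dbl 1%N) x x' : movable u u' -> rep_pair z x x' ->
  (forall a k, sval x a k = act u (sval (letter_edge l) a k)) ->
  (forall a k, sval x' a k = act u' (sval (letter_edge l') a k)) ->
  edge_class R one_vertex v z = rho l l'.
Proof.
move=> h zx xE xE'; congr edge_class; apply: (rep_pair_uniq zx).
exact: (rep_pair_mv actE act1 actM act_lclass act_adj act_type (q := motion_of h)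
  (letter_cellP l l') xE xE').
Qed.

Lemma rho_inv i (l l' m m' : L i) :
  eqact (gl m) (gl l)^-1%g -> eqact (gl m') (gl l')^-1%g -> rho m m' = (rho l l')^-1%g.
Proof.
move=> mE mE'; rewrite -edge_class_flip; apply/esym.
have e (n : L i) k : eqact (gl k) (gl n)^-1%g -> forall (a : signs 1) t,
    sval (face flip (letter_edge n)) a t = act (gl n) (sval (letter_edge k) a t).
  move=> kE a t /=; rewrite flipE; case: (a ord0) => //=.
  by rewrite kE actVK.
apply: (rho_mv (movable_letter l l') (rep_pair_face flip (letter_cellP l l'))) => a k.
  exact: e.
exact: e.
Qed.

Section Square.
Context (i j : I) (ji : j != i) (l : L j) (m a : L i) (n : L j).
Hypothesis la : eqact (gl l * gl m)%g (gl a * gl n)%g.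

Let corner (b0 b1 : bool) : U :=
  if b0 then if b1 then (gl l * gl m)%g else gl l else if b1 then gl a else 1%g.

Lemma letter_square_subproof :
  is_param_cube (fun (b : signs 2) k => act (corner (b ord0) (b ord_max)) (star k)).
Proof.
have ij : i != j by rewrite eq_sym.
have om (k : 'I_2) : k <> ord0 -> k = ord_max.
  move=> k0; apply: val_inj; case: k k0 => -[|[|k]] //= hk k0.
  by case: k0; exact: val_inj.
exists (fun k : 'I_2 => if k == ord0 then j else i); split.
- move=> x y; case: (x =P ord0) => [->|x0]; case: (y =P ord0) => [->|y0] // e.
  + by have := ji; rewrite e eqxx.
  + by have := ji; rewrite e eqxx.
  + by rewrite (om x x0) (om y y0).
- move=> k; case: eqP => [->|k0].
    exists (star j), (act (gl l) (star j)); split; first exact: letter_adj.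
    move=> b; rewrite /corner; case: (b ord0); case: (b ord_max) => //.
    + by rewrite actM (letter_other m).
    + by rewrite letter_other.
  rewrite (om k k0).
  exists (star i), (act (gl a) (star i)); split; first exact: letter_adj.
  move=> b; rewrite /corner; case: (b ord0); case: (b ord_max) => //.
  + by rewrite la actM (letter_other n).
  + by rewrite letter_other.
- move=> k kk; exists (star k) => b.
  have kj : k != j by apply/eqP => e; apply: (kk ord0).
  have ki : k != i by apply/eqP => e; apply: (kk ord_max).
  rewrite /corner; case: (b ord0); case: (b ord_max);
    by rewrite ?actM ?act1 ?(letter_other _ ki) ?(letter_other _ kj).
Qed.

Definition letter_square : tree_product Kv 2%N := exist _ _ letter_square_subproof.

Lemma letter_square_type (b : signs 2) k :
  p (sval letter_square b k) = ((k == j) && b ord0) (+) ((k == i) && b ord_max).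
Proof.
rewrite /= /corner; case: (b ord0); case: (b ord_max);
  by rewrite ?actM ?act1 ?letter_type p_star /= ?andbT ?andbF ?addbF // addbC.
Qed.

Lemma letter_square_face (b : signs 1) k :
  [/\ sval (face (edge ord0 false) letter_square) b k = act 1%g (sval (letter_edge l) b k),
      sval (face (edge ord_max true) letter_square) b k = act (gl l) (sval (letter_edge m) b k),
      sval (face (edge ord_max false) letter_square) b k = act 1%g (sval (letter_edge a) b k)
    & sval (face (edge ord0 true) letter_square) b k = act (gl a) (sval (letter_edge n) b k)].
Proof.
split; rewrite /= !edgeE /= /corner; case: (b ord0) => //; rewrite ?act1 -?actM //.
exact: la.
Qed.
End Square.

Lemma rho_square i j (l l' : L j) (m m' a a' : L i) (n n' : L j) : j != i ->
  eqact (gl l * gl m)%g (gl a * gl n)%g -> eqact (gl l' * gl m')%g (gl a' * gl n')%g ->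
  (rho l l' * rho m m' = rho a a' * rho n n')%g.
Proof.
move=> ji la la'.
have ty : same_types p (letter_square ji la) (letter_square ji la').
  by move=> b k; rewrite !letter_square_type.
have [z zx] := rep_pair_mk phi p_edge ty.
have := edge_class_square R one_vertex v z.
have f k b := rep_pair_face (edge k b) zx.
have sf b k := letter_square_face ji la b k; have sf' b k := letter_square_face ji la' b k.
rewrite (rho_mv (l := l) (l' := l') movable1 (f ord0 false)); first last.
- by move=> b k; have [->] := sf' b k.
- by move=> b k; have [->] := sf b k.
rewrite (rho_mv (l := m) (l' := m') (movable_letter l l') (f ord_max true)); first last.
- by move=> b k; have [_ ->] := sf' b k.
- by move=> b k; have [_ ->] := sf b k.
rewrite (rho_mv (l := a) (l' := a') movable1 (f ord_max false)); first last.
- by move=> b k; have [_ _ ->] := sf' b k.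
- by move=> b k; have [_ _ ->] := sf b k.
rewrite (rho_mv (l := n) (l' := n') (movable_letter a a') (f ord0 true)); first last.
- by move=> b k; have [_ _ _ ->] := sf' b k.
- by move=> b k; have [_ _ _ ->] := sf b k.
by [].
Qed.

Lemma rho_eq i (l l' m m' : L i) :
  eqact (gl l) (gl m) -> eqact (gl l') (gl m') -> rho l l' = rho m m'.
Proof.
move=> lm lm'; apply: (rho_mv movable1 (letter_cellP l l')) => a k /=;
  by case: (a ord0); rewrite act1 ?lm ?lm'.
Qed.

Definition word i (s : seq (L i)) : U := foldr (fun l u => gl l * u)%g 1%g s.

Lemma word_Gamma i (s : seq (L i)) : in_Gamma (word s).
Proof.
elim: s => [|l s IH] /=; first exact: in_Gamma1.
by apply: in_GammaM => //; exact: letter_Gamma.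
Qed.

Lemma word_other i (s : seq (L i)) k : k != i -> act (word s) (star k) = star k.
Proof. by move=> ki; elim: s => [|l s IH] /=; rewrite ?act1 // actM IH letter_other. Qed.

Definition rhos i (s : seq (L i * L i)) : pi1 R (base R v) :=
  foldr (fun l g => rho l.1 l.2 * g)%g 1%g s.

Definition closed i (s : seq (L i * L i)) : Prop :=
  eqact (word (map fst s)) 1%g /\ eqact (word (map snd s)) 1%g.

Lemma eqact_step (x w a d w' b n : U) : eqact (w * a)%g (d * w')%g ->
  eqact (x * d)%g (b * n)%g -> eqact (x * w * a)%g (b * (n * w'))%g.
Proof.
move=> e f k y; have := e k y; rewrite !actM => ->.
by have := f k (act w' y); rewrite !actM.
Qed.

(** A pair of letters at [i] passes through the word one square at a time. The length of the word is
    kept, which confines the family in the main argument to a finite type. *)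
Lemma rhos_swap i j (s : seq (L j * L j)) (a a' : L i) : j != i ->
  exists (b b' : L i) (t : seq (L j * L j)),
  [/\ size t = size s, (rhos s * rho a a' = rho b b' * rhos t)%g,
      eqact (word (map fst s) * gl a)%g (gl b * word (map fst t))%g
    & eqact (word (map snd s) * gl a')%g (gl b' * word (map snd t))%g].
Proof.
move=> ji; elim: s => [|[l l'] s [d [d' [t [st e ed ed']]]]].
  exists a, a', [::]; split=> //; first by rewrite mul1g mulg1.
    by move=> k x /=; rewrite mul1g mulg1.
  by move=> k x /=; rewrite mul1g mulg1.
have [b [n ld]] := letter_swap l d ji; have [b' [n' ld']] := letter_swap l' d' ji.
exists b, b', ((n, n') :: t); split.
- by rewrite /= st.
- by rewrite /= -mulgA e mulgA (rho_square ji ld ld') mulgA.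
- exact: eqact_step ed ld.
- exact: eqact_step ed' ld'.
Qed.

(** Words at [j] fix the star at [i], so [a] and [b] agree there; being letters at [i], they agree
    at all stars. *)
Lemma closed_swap i j (w u : U) (a b : L i) (t : seq (L j)) : j != i -> eqact w 1%g ->
  eqact (w * gl a)%g (gl b * word t)%g -> eqact (gl b) (gl a) /\ eqact (word t) 1%g.
Proof.
move=> ji w1 e; have ij : i != j by rewrite eq_sym.
have ba : eqact (gl b) (gl a).
  apply: eqact_star; [exact: letter_Gamma..|] => k.
  have [ki|ki] := eqVneq k i; last by rewrite !letter_other.
  subst k; have := e i (star i); rewrite !actM w1 act1 => ->.
  by rewrite word_other.
split=> // k x; have := e k x; rewrite !actM w1 act1 -ba => h.
by rewrite -[LHS](actKV (gl b)) -h actKV act1.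
Qed.

Lemma closed_commute i j (s : seq (L j * L j)) (a : L i) : j != i -> closed s ->
  exists2 t : seq (L j * L j), size t = size s /\ closed t & (rhos s * rho a a = rho a a * rhos t)%g.
Proof.
move=> ji [s1 s2]; have [b [b' [t [st e e1 e2]]]] := rhos_swap s a a ji.
have [ba t1] := closed_swap 1%g ji s1 e1; have [ba' t2] := closed_swap 1%g ji s2 e2.
by exists t; rewrite ?e ?(rho_eq ba ba').
Qed.

Section Crossings.
Context (j : I) (b m : L j).
Hypothesis mE : eqact (gl m) (gl b)^-1%g.

Local Notation PP := (fun i => (T i * T i)%type : eqType).
Let sig : T j := star j.
Let bsig : T j := act (gl b) sig.
Let e0 : PP j := (sig, sig).
Let e1 : PP j := (bsig, bsig).

Let p_sig : p sig = false. Proof. exact: p_star. Qed.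

Let p_bsig : p bsig = true.
Proof. by rewrite letter_type p_sig eqxx. Qed.

Let e01 : e0 != e1.
Proof. by apply/eqP => -[] /(congr1 (@p j)); rewrite p_sig p_bsig. Qed.

Local Notation holonomy := (hol (@over_signed R #|S0 S| PP Dbl (@double_rep F c S Kv phi p p_edge))
  (@close_signed R #|S0 S| PP j e0 e1)).

Definition vertex_at (w w' : U) : wtype R PP :=
  vertex_weight R (fun k => (act w (star k), act w' (star k)) : PP k).

Lemma vertex_at_eq w w' u u' : eqact w u -> eqact w' u' -> vertex_at w w' = vertex_at u u'.
Proof.
move=> wu wu'; congr vertex_weight; apply: functional_extensionality_dep => k.
by rewrite wu wu'.
Qed.

Let mvK := pair_mvK (p := p) act1 actM.
Let mviK := pair_mviK (p := p) act1 actM.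
Let rep_orb n z X Y := @double_rep_orb F c S Kv phi p p_edge act actE act1 actM act_lclass
  act_type n z X Y.
Let rep_mv n z X q := @double_rep_mv F c S Kv phi p p_edge act actE act1 actM act_lclass
  act_adj act_type n z X q.
Let mv_free := pair_mv_free (p := p) act_free.

Let h_sym := @close_signed_sym R #|S0 S| PP j e0 e1.
Let h_refl := @close_signed_refl R #|S0 S| PP j e0 e1.
Let h_inj b u w t := @over_signed_inj R #|S0 S| PP Dbl _ _ _ _ mvK mviK (@double_rep_ex F c S Kv phi p p_edge)
  (@double_rep_cube F c S Kv phi p p_edge) (@double_rep_face F c S Kv phi p p_edge)
  rep_orb rep_mv mv_free j e0 e1 b u w t.
Let h_cover := @cover_signed R #|S0 S| PP Dbl _ _ _ _ mvK mviK (@double_rep_ex F c S Kv phi p p_edge)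
  (@double_rep_cube F c S Kv phi p p_edge) (@double_rep_face F c S Kv phi p p_edge)
  rep_orb rep_mv mv_free j e0 e1 e01.

Lemma hol_rho i (l l' : L i) w w' s : movable w w' ->
  holonomy (rho l l') (vertex_at w w', s) (vertex_at (w * gl l)%g (w' * gl l')%g,
    s (+) is_edge e0 e1 (act w sig, act w' sig) (act w (act (gl l) sig), act w' (act (gl l') sig))).
Proof.
move=> h; pose X (a : signs 1) k : PP k :=
  (act w (sval (letter_edge l) a k), act w' (sval (letter_edge l') a k)).
have rX : double_rep (letter_cell l l') X.
  have r0 : double_rep (letter_cell l l')
      (fun a k => (sval (letter_edge l) a k, sval (letter_edge l') a k) : PP k).
    by exists (letter_edge l), (letter_edge l'); split=> //; exact: letter_cellP.
  exact: (rep_mv (motion_of h) r0).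
have := @hol_edge R #|S0 S| PP Dbl _ _ _ _ mvK mviK (@double_rep_ex F c S Kv phi p p_edge)
  (@double_rep_cube F c S Kv phi p p_edge) (@double_rep_face F c S Kv phi p p_edge)
  rep_orb rep_mv mv_free j e0 e1 e01 one_vertex v _ X s rX.
have -> : X [ffun=> false] = (fun k => (act w (star k), act w' (star k))).
  by apply: functional_extensionality_dep => k; rewrite /X /= ffunE.
have -> : X [ffun=> true] = (fun k => (act (w * gl l)%g (star k), act (w' * gl l')%g (star k))).
  by apply: functional_extensionality_dep => k; rewrite /X /= ffunE !actM.
by rewrite !actM.
Qed.

(** The lift of [g] carries diagonal vertices to diagonal ones by right multiplication with [u]. Its
    change of sign [d] may depend on the starting vertex but not on the starting sign. *)
Definition tracks (g : pi1 R (base R v)) (u : U) : Prop := movable u u /\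
  forall w, movable w w -> exists d, forall s,
    holonomy g (vertex_at w w, s) (vertex_at (w * u)%g (w * u)%g, s (+) d).

Lemma tracks_rho i (l : L i) : tracks (rho l l) (gl l).
Proof.
split; first exact: movable_letter.
by move=> w hw; eexists => s; exact: hol_rho.
Qed.

Lemma tracksM g u h w : tracks g u -> tracks h w -> tracks (g * h)%g (u * w)%g.
Proof.
move=> [mu gu] [mw hw]; split; first exact: movableM.
move=> t mt; have [d gd] := gu t mt; have [d' hd] := hw _ (movableM mt mu).
exists (d (+) d') => s; rewrite addbA mulgA.
exact: (holM h_sym h_refl h_inj h_cover (gd s) (hd _)).
Qed.

Lemma tracksV g u : tracks g u -> tracks g^-1%g u^-1%g.
Proof.
move=> [mu gu]; split; first exact: movableV.
move=> t mt; have [d gd] := gu _ (movableM mt (movableV mu)).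
exists d => s; have := holV h_sym h_refl h_inj h_cover (gd (s (+) d)).
by rewrite mulgVK addbK.
Qed.

Lemma tracks1 : tracks 1%g 1%g.
Proof.
have [l _] := exists_letter j.
rewrite -(mulgV (rho l l)) -(mulgV (gl l)).
by apply: tracksM; [|apply: tracksV]; exact: tracks_rho.
Qed.

Lemma tracksX g u n : tracks g u -> tracks (g ^+ n)%g (u ^+ n)%g.
Proof.
move=> gu; elim: n => [|n IH]; first by rewrite !expg0; exact: tracks1.
by rewrite !expgS; exact: tracksM.
Qed.

(* Both component words are trivial in Gamma. *)
Definition cross_word : seq (L j * L j) := [:: (b, b); (m, b); (m, m); (b, m)].

Lemma cross_word_closed : closed cross_word.
Proof.
split=> k x /=; rewrite !actM !mE !act1.
  by rewrite actKV actVK.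
by rewrite !actVK.
Qed.

(** The parity with which the lift of [cross_word] started at [(w, w)] passes the edge, summed over
    its four steps. *)
Let crosses w : bool :=
  is_edge e0 e1 (act w sig, act w sig) (act w bsig, act w bsig) (+)
  is_edge e0 e1 (act w bsig, act w bsig) (act w sig, act w (act (gl b) bsig)) (+)
  is_edge e0 e1 (act w sig, act w (act (gl b) bsig)) (act w (act (gl m) sig), act w bsig) (+)
  is_edge e0 e1 (act w (act (gl m) sig), act w bsig) (act w sig, act w sig).

Lemma hol_cross_word w s : movable w w ->
  holonomy (rhos cross_word) (vertex_at w w, s) (vertex_at w w, s (+) crosses w).
Proof.
move=> h; rewrite /= mulg1.
have h1 := hol_rho b b s h.
have w2 := movableM h (movable_letter b b).
have h2 := hol_rho m b (s (+) _) w2.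
have w3 := movableM w2 (movable_letter m b).
have h3 := hol_rho m m (s (+) _ (+) _) w3.
have w4 := movableM w3 (movable_letter m m).
have h4 := hol_rho b m (s (+) _ (+) _ (+) _) w4.
have := holM h_sym h_refl h_inj h_cover (h1)
  (holM h_sym h_refl h_inj h_cover (h2 _) (holM h_sym h_refl h_inj h_cover (h3 _ _) (h4 _ _ _))).
rewrite (@vertex_at_eq _ _ w w); first last.
- by move=> k x; rewrite !actM !mE !actVK.
- by move=> k x; rewrite !actM !mE actKV actVK.
rewrite /crosses !actM !mE -/bsig ?actVK ?actKV ?addbA.
by [].
Qed.

Let p_m : p (act (gl m) sig) = true.
Proof. by rewrite letter_type p_sig eqxx. Qed.

(** If the square of [b] fixed the star, freeness would make [b] act trivially, but [b] changes the
    type. *)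
Let square_moves : act (gl b) bsig <> sig.
Proof.
move=> e; have : bsig = sig; last by move=> /(congr1 (@p j)); rewrite p_bsig p_sig.
apply: act_free => [|k]; first exact: letter_Gamma.
exists (star k); have [kj|kj] := eqVneq k j; first by subst k.
by rewrite !letter_other.
Qed.

Let not_e (x y : PP j) : x <> e0 -> y <> e0 -> is_edge e0 e1 x y = false.
Proof. by move=> /eqP/negPf x0 /eqP/negPf y0; rewrite /is_edge x0 y0 andbF. Qed.

(** The lift visits [(sig, sig)], [(bsig, bsig)], [(sig, b bsig)], [(m sig, bsig)] and returns. The
    first step is the edge in question. The last one ends at [e0] too, but it starts from [m sig],
    which differs from [bsig]. *)
Lemma crosses1 : crosses 1%g.
Proof.
have b0 : (bsig, bsig) <> e0 :> PP j.
  by case=> /(congr1 (@p j)); rewrite p_bsig p_sig.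
have bb0 : (sig, act (gl b) bsig) <> e0 :> PP j by case=> /square_moves.
have m0 : (act (gl m) sig, bsig) <> e0 :> PP j.
  by case=> /(congr1 (@p j)); rewrite p_m p_sig.
have m1 : (act (gl m) sig, bsig) <> e1 :> PP j.
  case; rewrite mE => /(congr1 (fun x => act (gl b) x)); rewrite actVK => /esym.
  exact: square_moves.
rewrite /crosses !act1 (not_e b0 bb0) (not_e bb0 m0).
by rewrite /is_edge !eqxx (negPf (introN eqP m0)) (negPf (introN eqP m1)).
Qed.

(** The first coordinates along the lift are alternately [act w sig], which is not [sig], and
    vertices of the opposite type, so the lift never meets [e0]. *)
Lemma crosses0 w : in_Gamma w -> p (act w sig) = false -> act w sig <> sig -> crosses w = false.
Proof.
move=> Gw pw wsig; have [t tE] := act_type j Gw.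
have t0 : t = false by move: pw; rewrite tE p_sig.
have u0 (y : T j) : (act w sig, y) <> e0 :> PP j by case.
have u1 (x y : T j) : p x = true -> (act w x, y) <> e0 :> PP j.
  by move=> px; case=> /(congr1 (@p j)); rewrite tE px t0 p_sig.
by rewrite /crosses !not_e //; exact: u1.
Qed.

Lemma tracks_not_commute g u : tracks g u -> p (act u sig) = false -> act u sig <> sig ->
  ~ commute g (rhos cross_word).
Proof.
move=> [mu gu] pu usig gk; have [d gd] := gu _ movable1.
have m1u := movableM movable1 mu.
have a1 := holM h_sym h_refl h_inj h_cover (gd false) (hol_cross_word _ m1u).
have a2 := holM h_sym h_refl h_inj h_cover (hol_cross_word false movable1) (gd _).
have u1 : act (1 * u)%g sig = act u sig by rewrite mul1g.
have [G1u _ _] := m1u.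
rewrite crosses0 ?u1 // addbF in a1; rewrite crosses1 -gk in a2.
have [/(_ erefl)] := hol_inj h_sym h_inj a1 a2.
by case; case: d {gd a1 a2}.
Qed.

End Crossings.

Theorem double_not_residually_finite (i j : I) : j != i ->
  ~ residually_finite (pi1 R (base R v)).
Proof.
move=> ji rf; have [a _] := exists_letter i; have [b _] := exists_letter j.
have [m mE] := letter_inv b.
(* Tuples that are not closed are sent to 1, so that the family is indexed by a finite type and
   stable under conjugation by the loops at [i]. *)
pose ka (k : 4.-tuple (L j * L j)%type) := if `[< closed k >] then rhos k else 1%g.
have al_inv (l : L i) : exists l' : L i, rho l' l' = (rho l l)^-1%g.
  by have [l' l'E] := letter_inv l; exists l'; exact: rho_inv.
have be_inv (l : L j) : exists l' : L j, rho l' l' = (rho l l)^-1%g.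
  by have [l' l'E] := letter_inv l; exists l'; exact: rho_inv.
have be_al (l : L j) (x : L i) :
    exists (x' : L i) (l' : L j), (rho l l * rho x x = rho x' x' * rho l' l')%g.
  by have [x' [l' e]] := letter_swap l x ji; exists x', l'; exact: rho_square.
have ka_al k (x : L i) : exists k', (ka k * rho x x = rho x x * ka k')%g.
  rewrite /ka; case: asboolP => [kc|nk]; last by exists k; rewrite asboolF // mul1g mulg1.
  have [t [st tc] e] := closed_commute x ji kc.
  have st4 : size t == 4%N by rewrite st size_tuple.
  by exists (Tuple st4); rewrite asboolT.
have [n n0 comm] := commensurated_commute (al := fun l : L i => rho l l)
  (be := fun l : L j => rho l l) rf al_inv be_al ka_al.
have [x ax] := letter_power_moves a j n0; have [s xs] := reach x.
rewrite -/(word s) in xs.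
pose A := range (fun l : L i => rho l l) `|` range (fun l : L j => rho l l).
have [g gA gt] : exists2 g, products A g & tracks b g (word s).
  elim: (s) => [|l t [g gA gt]]; first by exists 1%g; [exact: products1|exact: tracks1].
  exists (rho l l * g)%g; last exact: tracksM (tracks_rho _ _) gt.
  by apply: productsM gA; right; exists l.
have AV y : A y -> A y^-1%g.
  case=> -[l _ <-]; [left|right].
    by have [l' <-] := al_inv l; exists l'.
  by have [l' <-] := be_inv l; exists l'.
(* Since [a^n] moves [x], the image of the star under [word s], this conjugate moves the star
   itself; it preserves types at [j] because [a] is a letter at [i]. *)
pose u := ((word s)^-1 * gl a ^+ n * (word s)^-1^-1)%g.
have tu : tracks b (g^-1 * rho a a ^+ n * g^-1^-1)%g u.
  have gV := tracksV gt; apply: tracksM (tracksV gV); apply: tracksM gV _.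
  by apply: tracksX; exact: tracks_rho.
have c4 : size (cross_word b m) == 4%N by [].
have kaE : ka (Tuple c4) = rhos (cross_word b m).
  by rewrite /ka asboolT //; exact: cross_word_closed.
have uE : act u (star j) = act (word s)^-1%g (act (gl a ^+ n)%g x).
  by rewrite /u invgK !actM -xs.
have [t tE] := act_type j (in_GammaV (word_Gamma s)).
have px y k : p (act (gl a ^+ k)%g (y : T j)) = p y.
  elim: k => [|k IH]; first by rewrite expg0 act1.
  by rewrite expgS actM letter_type IH (negPf ji) addbF.
apply: (tracks_not_commute mE tu).
- by rewrite uE tE px xs -tE actKV p_star.
- by rewrite uE => e; apply: ax; rewrite -[LHS](actVK (word s)) e -xs.
- by rewrite -kaE; apply: comm; exact: productsV.
Qed.

End Letters.

Theorem theorem5p13 (R : realType) (F : finFieldType) (odd_F : odd #|F|)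
  (c : F) (c_nonsquare : forall x : F, x ^+ 2 <> c)
  (S : {set option F}) (S_zero : Some 0 \in S) (S_infty : None \in S)
  (two_places : (2 <= #|S0 S|)%N)
  (Kv : forall i : 'I_#|S0 S|, completion (place i))
  (phi : forall i, {lrmorphism local_quat (Kv i) c -> 'M[Kv i]_2})
  (phi_bij : forall i, bijective (phi i))
  (star : forall i, bt_tree (Kv i))
  (star_fixed : forall i (w w' : local_quat (Kv i) c),
     quat_order (local_integers (Kv := Kv i)) w ->
     quat_order (local_integers (Kv := Kv i)) w' ->
     w * w' = 1 -> w' * w = 1 -> bt_image (phi i w) (star i) (star i))
  (p : forall i, bt_tree (Kv i) -> bool)
  (p_edge : forall i, edge_map (p i))
  (p_star : forall i, p i (star i) = false)
  (x0 : realization R (cube_double (fun i => phi i) p_edge)) :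
  ~ residually_finite (pi1 R x0).

Proof.
have two := odd_card_two odd_F.
have types u i : in_Gamma u ->
    exists s, forall x : bt_tree (Kv i), p i (act phi u x) = p i x (+) s.
  by move=> _; exact: (act_type two c_nonsquare star_fixed p_edge).
have trans := act_trans two c_nonsquare star_fixed.
have v : cube_double (fun i => phi i) p_edge 0%N.
  have h : is_param_cube (fun _ : signs 0 => star).
    exists (fun k : 'I_0 => False_rect _ (notF (ltn_ord k))).
    by split=> [[]//|[]//|i _]; exists (star i).
  pose st : tree_product Kv 0 := exist _ _ h.
  have ty : same_types p st st by [].
  exact: sval (cid (rep_pair_mk (fun i => phi i) p_edge ty)).
have one_vertex := double_one_vertex (p_edge := p_edge) (actE phi) (act1 phi) (actM phi)
  (@act_lclass _ _ _ _ phi) (@act_adj _ _ _ _ phi) types trans.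
move=> rf; have [de [cde de0 de1]] := path_to_base one_vertex v x0.
have {rf} := residually_finite_base_change cde de0 de1 rf.
pose i : 'I_#|S0 S| := Ordinal (ltn_trans (ltnSn 0) two_places).
pose j : 'I_#|S0 S| := Ordinal two_places.
apply: (double_not_residually_finite (actE phi) (act1 phi) (actM phi)
  (@act_lclass _ _ _ _ phi) (@act_adj _ _ _ _ phi) types _ p_star trans _
  (L := letters c (S := S)) (gl := @letter_unit F c S) _ _ _ _ _ _ _ (i := i) (j := j)).
- exact: (act_free two c_nonsquare star_fixed).
- exact: (act_free_star two c_nonsquare star_fixed).
- exact: letter_Gamma.
- exact: (letter_adj two c_nonsquare star_fixed).
- exact: (adj_letter two c_nonsquare star_fixed).
- exact: (letter_other star_fixed).
- exact: (exists_letter c_nonsquare star_fixed).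
- exact: (reach two c_nonsquare star_fixed).
- exact: (letter_power_moves two phi_bij).
- by [].
Qed.
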